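(* (a) The following three knots are pairwise not isotopic: the trivial knot, the trefoil knot, the figure eight knot. (b) There is an infinite number of pairwise non-isotopic knots.
   Context: A knot is a closed non-self-intersecting polygonal line in $\mathbb{R}^3$ (non-oriented). Elementary move: suppose that two sides $AC$ and $CB$ of a triangle $ABC$ are edges of a knot and that the knot and the (filled, planar) triangle $ABC$ do not intersect at any other points. The elementary move $ACB\to AB$ replaces the two edges $AC$ and $CB$ by the edge $AB$; the inverse operation $AB\to ACB$ is also called an elementary move. If the triangle $ABC$ is degenerate, an elementary move is either subdivision of an edge or the inverse operation. Two knots $K$ and $L$ are isotopic if there is a sequence of knots $K_1,\ldots,K_n$ with $K_1=K$, $K_n=L$ such that each $K_{j+1}$ is obtained from $K_j$ by an elementary move. The trivial knot is the boundary of a triangle. The trefoil knot is the (polygonal) closure of the 2-strand braid $\sigma_1^3$ (the standard knot with a 3-crossing alternating diagram). The figure eight knot is the (polygonal) closure of the 3-strand braid $\sigma_1\sigma_2^{-1}\sigma_1\sigma_2^{-1}$ (the standard knot with a 4-crossing alternating diagram). *)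

(* Defs.v *)
From mathcomp Require Import all_boot all_order all_algebra.
From mathcomp Require Import boolp classical_sets reals.
From mathcomp Require Import ring lra.

Set Implicit Arguments.
Unset Strict Implicit.
Unset Printing Implicit Defensive.

Import Order.TTheory GRing.Theory Num.Theory.
Local Open Scope classical_set_scope.
Local Open Scope ring_scope.

Section Knots.
Variable R : realType.
Local Notation pt := 'rV[R]_3.

Definition segment_pt (A B : pt) (t : R) : pt := (1 - t) *: A + t *: B.

Definition segment (A B : pt) : set pt :=
  [set segment_pt A B t | t in [set t : R | 0 <= t <= 1]].

Definition triangle (A B C : pt) : set pt :=
  [set x | exists a b c : R, [/\ 0 <= a, 0 <= b, 0 <= c, a + b + c = 1 &
     x = a *: A + b *: B + c *: C]].

Definition noncollinear (A B C : pt) : bool := row_free (col_mx (B - A) (C - A)).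

(* A closed polygonal line is given by its vertices in cyclic order; its i-th
   edge joins vertex i to the next one, the last edge returning to vertex 0. *)
Definition edge_pt (p : seq pt) (i : nat) (t : R) : pt :=
  segment_pt p`_i p`_(i.+1 %% size p) t.

(* The circle is the set of pairs (i, t) with i < size p and 0 <= t < 1, and
   "non-self-intersecting" says that its parametrization of the line is
   injective: distinct edges meet only where one ends and the next one starts. *)
Definition is_knot (p : seq pt) : Prop :=
  (2 < size p)%N /\
  forall (i j : nat) (t u : R), (i < size p)%N -> (j < size p)%N ->
    0 <= t < 1 -> 0 <= u < 1 -> edge_pt p i t = edge_pt p j u -> i = j /\ t = u.

Record knot := Knot { vertices :> seq pt; knotP : is_knot vertices }.

(* Neither a base vertex nor an orientation is part of a polygonal line. *)
Definition same_polygon (p q : seq pt) : Prop :=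
  exists k : nat, p = rot k q \/ p = rot k (rev q).

Definition polygon_set (p : seq pt) : set pt :=
  [set x | exists2 i, (i < size p)%N & segment p`_i p`_(i.+1 %% size p) x].

(* The move ACB -> AB.  If A, C, B are collinear, then C lies strictly between
   A and B because K is a knot; the last condition then holds automatically and
   the move is the inverse of the subdivision of the edge AB at C. *)
Definition elementary_reduction (K L : knot) : Prop :=
  exists (A C B : pt) (s : seq pt),
    [/\ same_polygon K [:: A, C, B & s],
        same_polygon L [:: A, B & s] &
        polygon_set K `&` triangle A B C = segment A C `|` segment C B].

Definition elementary_move (K L : knot) : Prop :=
  elementary_reduction K L \/ elementary_reduction L K.

Definition isotopic (K L : knot) : Prop :=
  exists (n : nat) (Ks : nat -> knot),
    [/\ same_polygon K (Ks 0%N), same_polygon (Ks n) L &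
        forall j, (j < n)%N -> elementary_move (Ks j) (Ks j.+1)].

Lemma row_free2 (u v : pt) (a b : R) :
  row_free (col_mx u v) -> a *: u + b *: v = 0 -> a = 0 /\ b = 0.
Proof.
move=> /row_free_inj inj h.
have /inj : (row_mx a%:M b%:M : 'rV_(1 + 1)) *m col_mx u v = 0 *m col_mx u v.
  by rewrite mul_row_col !mul_scalar_mx mul0mx.
rewrite -row_mx0 => /eq_row_mx[/matrixP/(_ 0 0) + /matrixP/(_ 0 0)].
by rewrite !mxE eqxx !mulr1n.
Qed.

Lemma triangle_is_knot (A B C : pt) :
  noncollinear A B C -> is_knot [:: A; B; C].
Proof.
move=> nd; split=> //.
suff H (a b c a' b' c' : R) : a + b + c = 1 -> a' + b' + c' = 1 ->
    a *: A + b *: B + c *: C = a' *: A + b' *: B + c' *: C ->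
    [/\ a = a', b = b' & c = c'].
  have E i t : (i < 3)%N -> edge_pt [:: A; B; C] i t =
      [:: 1 - t; 0; t]`_i *: A + [:: t; 1 - t; 0]`_i *: B +
      [:: 0; t; 1 - t]`_i *: C.
    case: i => [|[|[|]]]//= _; rewrite /edge_pt /segment_pt /=.
    - by rewrite scale0r addr0.
    - by rewrite scale0r add0r.
    - by rewrite scale0r addr0 addrC.
  have S i t : (i < 3)%N -> [:: 1 - t; 0; t]`_i + [:: t; 1 - t; 0]`_i +
      [:: 0; t; 1 - t]`_i = 1 :> R.
    by case: i => [|[|[|]]]//= _; lra.
  move=> i j t u i3 j3 ht hu; rewrite !E// => /H[||]; rewrite ?S//.
  move: i j i3 j3 => [|[|[|]]]// [|[|[|]]]//= _ _ h1 h2 h3;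
    try (by exfalso; lra); split=> //; lra.
move=> h h' e.
have [b0 c0] : b - b' = 0 /\ c - c' = 0.
  apply: (row_free2 nd); apply/rowP => k.
  move/rowP/(_ k): e; rewrite !mxE.
  have -> : a = 1 - b - c by lra.
  have -> : a' = 1 - b' - c' by lra.
  by move=> e; lra.
by split; lra.
Qed.

Definition trivial_knot (A B C : pt) (h : noncollinear A B C) : knot :=
  Knot (triangle_is_knot h).

End Knots.

(* Polygonal closed braids.  Time runs along the x-axis and the i-th of the n
   strand positions (1 <= i <= n) is the line y = 2i, z = 0.  The k-th letter
   acts on 2k <= x <= 2k + 2; sigma i exchanges the positions i and i + 1, the
   strand going from i to i + 1 passing above (larger z), and sigmaV i is its
   inverse.  All coordinates are integers. *)
Definition ipoint : Type := int * int * int.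

Definition braid_letter : Type := nat * bool.
Definition sigma (i : nat) : braid_letter := (i, true).
Definition sigmaV (i : nat) : braid_letter := (i, false).

Definition next_position (p : nat) (l : braid_letter) : nat :=
  if p == l.1 then l.1.+1 else if p == l.1.+1 then l.1 else p.

Definition letter_vertices (k p : nat) (l : braid_letter) : seq ipoint :=
  ((2 * k)%:Z, (2 * p)%:Z, 0) ::
  if p == l.1 then [:: ((2 * k).+1%:Z, (2 * l.1).+1%:Z, if l.2 then 1 else -1)]
  else if p == l.1.+1 then
    [:: ((2 * k).+1%:Z, (2 * l.1).+1%:Z, if l.2 then -1 else 1)]
  else [::].

Fixpoint strand (k p : nat) (w : seq braid_letter) : seq ipoint :=
  if w is l :: w' then letter_vertices k p l ++ strand k.+1 (next_position p l) w'
  else [:: ((2 * k)%:Z, (2 * p)%:Z, 0)].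

(* The closing arcs are nested in the plane z = 0: the p-th one leaves the right
   end of position p, passes beyond all the strands and returns to its left end. *)
Definition closing_arc (n m p : nat) : seq ipoint :=
  let d := (2 * (n.+1 - p))%N in
  [:: ((2 * m + d)%:Z, (2 * p)%:Z, 0); ((2 * m + d)%:Z, (2 * n + d)%:Z, 0);
      (- d%:Z, (2 * n + d)%:Z, 0); (- d%:Z, (2 * p)%:Z, 0)].

(* Follows the closed braid from position 1 through n passes: this is the whole
   closure when the permutation of the n-strand braid w is an n-cycle. *)
Definition braid_closure (n : nat) (w : seq braid_letter) : seq ipoint :=
  let pass p := foldl next_position p w in
  flatten [seq strand 0 p w ++ closing_arc n (size w) (pass p)
          | p <- traject pass 1 n].

Definition point_of (R : realType) (q : ipoint) : 'rV[R]_3 :=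
  \row_(j < 3) ([:: q.1.1; q.1.2; q.2]`_j)%:~R.

(* A computable criterion for simplicity of an integer polygon: half-open edges
   [a, b) and [c, d) are separated by a functional with coefficients -1, 0, 1. *)
Section Simple.

Let ipoint0 : ipoint := (0, 0, 0).

Definition dot (u q : ipoint) : int :=
  u.1.1 * q.1.1 + u.1.2 * q.1.2 + u.2 * q.2.

Definition functionals : seq ipoint :=
  let c : seq int := [:: -1; 0; 1] in
  [seq (xy, z) | xy <- [seq (x, y) | x <- c, y <- c], z <- c].

Definition separated (a b c d : int) : bool :=
  [&& a < c, a < d, b <= c & b <= d] || [&& c < a, c < b, d <= a & d <= b].

Definition simple_polygon (p : seq ipoint) : bool :=
  let v := nth ipoint0 p in let w i := v (i.+1 %% size p)%N in
  (2 < size p)%N &&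
  all (fun i => all (fun j => if i == j then v i != w i else
      has (fun u => separated (dot u (v i)) (dot u (w i)) (dot u (v j))
                              (dot u (w j))) functionals)
    (iota 0 (size p))) (iota 0 (size p)).

Variable R : realType.

Let dotR (u : ipoint) (x : 'rV[R]_3) : R :=
  u.1.1%:~R * x 0 0 + u.1.2%:~R * x 0 1 + u.2%:~R * x 0 (inord 2).

Let dotR_segment u q r t :
  dotR u (segment_pt (point_of R q) (point_of R r) t) =
  (1 - t) * (dot u q)%:~R + t * (dot u r)%:~R.
Proof. by rewrite /dotR !mxE /= inordK//= /dot !rmorphD !rmorphM /=; ring. Qed.

Let point_of_inj : injective (point_of R).
Proof.
move=> [[x y] z] [[x' y'] z'] /rowP e.
move: (e 0) (e 1) (e (inord 2)); rewrite !mxE /= inordK//=.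
by move=> /intr_inj -> /intr_inj -> /intr_inj ->.
Qed.

Lemma simple_polygonP (p : seq ipoint) :
  simple_polygon p -> is_knot [seq point_of R q | q <- p].
Proof.
move=> /andP[p2 /allP chk]; split; rewrite size_map// => i j t u ip jp.
have p0 k : (k.+1 %% size p < size p)%N by rewrite ltn_mod (leq_trans _ p2).
have /chk/allP/(_ j) : i \in iota 0 (size p) by rewrite mem_iota.
rewrite mem_iota add0n => /(_ jp).
move=> + /andP[t0 t1] /andP[u0 u1].
rewrite /edge_pt !size_map !(nth_map ipoint0)//.
set a := nth _ p i; set b := nth _ p _; set c := nth _ p j; set d := nth _ p _.
case: eqP => [ij|_].
  rewrite /c /d -ij -/a -/b => ab e; split=> //.
  apply/eqP; apply: contraNT ab => tu.
  apply/eqP/point_of_inj/eqP; rewrite -subr_eq0.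
  have : (u - t) *: (point_of R a - point_of R b) = 0.
    by move/rowP : e => e; apply/rowP => k; move: (e k); rewrite !mxE; lra.
  move/eqP; rewrite scaler_eq0 => /orP[|//].
  by move=> /eqP ut; move: tu; rewrite (subr0_eq ut) eqxx.
move=> /hasP[f _ sep] /(congr1 (dotR f)); rewrite !dotR_segment.
move: sep; rewrite /separated -!(ltr_int R) -!(ler_int R).
set a' := (dot f a)%:~R; set b' := (dot f b)%:~R.
set c' := (dot f c)%:~R; set d' := (dot f d)%:~R.
have conv_le (x y m s : R) : 0 <= s -> s < 1 -> m <= x -> m <= y ->
    m <= (1 - s) * x + s * y by move=> *; nra.
have conv_lt (x y m s : R) : 0 <= s -> s < 1 -> x < m -> y <= m ->
    (1 - s) * x + s * y < m by move=> *; nra.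
move=> /orP[/and4P[h1 h2 h3 h4]|/and4P[h1 h2 h3 h4]] e; exfalso.
- have := conv_lt a' b' (Num.min c' d') t t0 t1.
  have := conv_le c' d' (Num.min c' d') u u0 u1.
  by rewrite !ge_min !lexx orbT !lt_min !le_min h1 h2 h3 h4; lra.
- have := conv_lt c' d' (Num.min a' b') u u0 u1.
  have := conv_le a' b' (Num.min a' b') t t0 t1.
  by rewrite !ge_min !lexx orbT !lt_min !le_min h1 h2 h3 h4; lra.
Qed.

End Simple.

Definition trefoil_polygon : seq ipoint :=
  braid_closure 2 [:: sigma 1; sigma 1; sigma 1].

Definition figure_eight_polygon : seq ipoint :=
  braid_closure 3 [:: sigma 1; sigmaV 2; sigma 1; sigmaV 2].

Lemma trefoil_simple : simple_polygon trefoil_polygon.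
Proof. by vm_compute. Qed.

Lemma figure_eight_simple : simple_polygon figure_eight_polygon.
Proof. by vm_compute. Qed.

Definition trefoil (R : realType) : knot R :=
  Knot (simple_polygonP R trefoil_simple).

Definition figure_eight (R : realType) : knot R :=
  Knot (simple_polygonP R figure_eight_simple).

(* Main.v *)
(** Project a polygon along a generic direction and colour its points by elements of
a commutative ring V so that the colour changes only where an edge passes under
another one, the colours v and w on both sides and the colour k of the upper edge
being related by v + w = 2k.  Whether a nonconstant colouring exists does not change
under an elementary move AB -> ACB: in coordinates where ABC is a horizontal
triangle, the colour of the strand AB extends over the triangle, with a reflection in
the colour of every strand passing above it, to a shadow which is well defined
because the triangle is simply connected; the new path takes its colours from the
shadow, and all strands below the triangle are reflected in it.  When ABC projects to
a segment, the move reduces to subdivisions of edges.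

For finitely many vertices the good directions are dense, so every isotopy admits one
that is as close as desired to a direction for which the two given diagrams are stable.
Over F_3 the trefoil has a nonconstant colouring, over F_5 the figure eight has one and
the trefoil has none, and a triangle never has one.  For (b), with p and q odd primes
the torus knot T(2, p) has a nonconstant colouring over F_q if and only if p = q. *)

Require Import Defs.
From mathcomp Require Import all_boot all_order all_algebra.
From mathcomp Require Import boolp classical_sets reals.
From mathcomp Require Import ring lra zify.
Set Implicit Arguments.
Unset Strict Implicit.
Unset Printing Implicit Defensive.
Import Order.TTheory GRing.Theory Num.Theory.
Local Open Scope classical_set_scope.
Local Open Scope ring_scope.

(** * Locally constant functions and their limits along edges *)

(** No planar graph of arcs and regions is built for an arbitrary knot. A colouring is a function on
    space of which only the limits along edges count: values at crossings and vertices are free, and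
    subdividing an edge costs nothing. The price is that the shadow cannot be defined region by
    region. It is a flat section of a local system on the triangle: at each point an explicit
    transport law is given, according to whether no strand, a strand, a turning strand or a crossing
    lies above, or an end of the replaced edge; interval induction then glues the laws over a
    square. Two reflections have to be compared only at a crossing above the triangle, and there the
    relation of the colouring is exactly what makes the two ways round agree, as in the third
    Reidemeister move. The construction is symmetric in the two paths, so it serves a move and its
    inverse alike. Coordinates are abstract affine functions, because each move is studied in its
    own ones; only the vertical lines and the order on them must be kept. *)

(** Interval induction: a local step taken at the supremum of the [t] with [P a t] reaches beyond
    it, so this supremum is [b]. It takes the place of compactness in the gluing arguments. *)
Lemma cousin (R : realType) (a b : R) (P : R -> R -> Prop) : a <= b ->
  (forall x, a <= x <= b -> exists2 d, 0 < d & forall u v,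
     a <= u -> u <= x -> x <= v -> v <= b -> x - u < d -> v - x < d -> P u v) ->
  (forall u v w, a <= u -> u <= v -> v <= w -> w <= b ->
     P u v -> P v w -> P u w) ->
  P a b.
Proof.
move=> ab loc cat.
pose E : set R := [set t | a <= t <= b /\ P a t].
have [d0 d0p Ha] := loc a (introT andP (conj (lexx a) ab)).
have Ea : E a by split; [rewrite lexx ab|apply: Ha; rewrite ?subrr].
have hs : has_sup E by split; [exists a|exists b => t [/andP[]]].
pose s := sup E.
have as_ : a <= s by apply: ub_le_sup => //; exact: hs.2.
have sb : s <= b by apply: ge_sup => //; [exists a|move=> t [/andP[]]].
have [d dp Hs] := loc s (introT andP (conj as_ sb)).
have [t [/andP[at_ tb] Pt] ts] := sup_adherent dp hs.
have tles : t <= s by apply: ub_le_sup; [exact: hs.2|split; rewrite ?at_ ?tb].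
have Ps u : s <= u -> u <= b -> u - s < d -> P a u.
  move=> su ub us; apply: (cat a t u) => //; first exact: le_trans su.
  by apply: Hs => //; rewrite -/s in ts; lra.
have [bs|sltb] := leP b s; first by apply: Ps => //; lra.
pose u := Num.min b (s + d / 2).
have us : s < u by rewrite lt_min sltb /=; lra.
have ub : u <= b by rewrite ge_min lexx.
have ud : u <= s + d / 2 by rewrite ge_min lexx orbT.
have : u <= s.
  apply: ub_le_sup; first exact: hs.2.
  split; [by rewrite ub andbT; lra|by apply: Ps; lra].
by lra.
Qed.

Section Limits.
Variables (R : realType) (V : zmodType).
Local Notation pt := 'rV[R]_3.

(** [U] serves only as a direction, and [M] itself is left out, so that the value of a colouring at
    a crossing or a vertex never matters. *)
Definition germ (M U : pt) (P : pt -> Prop) : Prop :=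
  exists2 t0 : R, 0 < t0 & forall s, 0 < s -> s < t0 -> P (segment_pt M U s).

Definition lim (c : pt -> V) (M U : pt) (v : V) : Prop :=
  germ M U (fun P => c P = v).

Lemma lim_uniq c M U v w : lim c M U v -> lim c M U w -> v = w.
Proof.
move=> [s s0 Hs] [t t0 Ht].
have h0 : 0 < Num.min s t by rewrite lt_min s0 t0.
have hs : Num.min s t <= s by rewrite ge_min lexx.
have ht : Num.min s t <= t by rewrite ge_min lexx orbT.
rewrite -(Hs (Num.min s t / 2)) ?(Ht (Num.min s t / 2)) //; lra.
Qed.

Lemma segment_ptA (P Q : pt) (m s : R) :
  segment_pt (segment_pt P Q m) Q s = segment_pt P Q (m + s * (1 - m)).
Proof. by rewrite /segment_pt; apply/rowP => k; rewrite !mxE; ring. Qed.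

Lemma segment_ptB (P Q : pt) (m s : R) :
  segment_pt (segment_pt P Q m) P s = segment_pt P Q (m - s * m).
Proof. by rewrite /segment_pt; apply/rowP => k; rewrite !mxE; ring. Qed.

Lemma segment_ptC (P Q : pt) (m : R) : segment_pt P Q m = segment_pt Q P (1 - m).
Proof. by rewrite /segment_pt; apply/rowP => k; rewrite !mxE; ring. Qed.

Lemma segment_pt0 (P Q : pt) : segment_pt P Q 0 = P.
Proof. by rewrite /segment_pt; apply/rowP => k; rewrite !mxE; ring. Qed.

Lemma segment_pt1 (P Q : pt) : segment_pt P Q 1 = Q.
Proof. by rewrite /segment_pt; apply/rowP => k; rewrite !mxE; ring. Qed.

Lemma lim_right (c : pt -> V) P Q (m : R) v : m < 1 ->
  lim c (segment_pt P Q m) Q v ->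
  exists2 d, 0 < d & forall s, m < s -> s < m + d -> c (segment_pt P Q s) = v.
Proof.
move=> m1 [t tp Ht]; exists (t * (1 - m)); first by rewrite mulr_gt0 ?subr_gt0.
move=> s ms sd.
have e : s = m + (s - m) / (1 - m) * (1 - m).
  by rewrite divfK; [ring|rewrite subr_eq0; apply/eqP => h; move: m1; rewrite h ltxx].
rewrite e -segment_ptA Ht // ?ltr_pdivrMr ?divr_gt0 ?subr_gt0 //; lra.
Qed.

Lemma lim_left (c : pt -> V) P Q (m : R) v : 0 < m ->
  lim c (segment_pt P Q m) P v ->
  exists2 d, 0 < d & forall s, m - d < s -> s < m -> c (segment_pt P Q s) = v.
Proof.
move=> m0 L.
have [] := @lim_right c Q P (1 - m) v; first by lra.
  by rewrite -segment_ptC.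
move=> d d0 H; exists d => // s h1 h2.
by rewrite segment_ptC H //; lra.
Qed.

Lemma right_lim (c : pt -> V) P Q (m d : R) v : m < 1 -> 0 < d ->
  (forall s, m < s -> s < m + d -> c (segment_pt P Q s) = v) ->
  lim c (segment_pt P Q m) Q v.
Proof.
move=> m1 d0 H; exists (d / (1 - m)); first by rewrite divr_gt0 ?subr_gt0.
move=> s s0; rewrite ltr_pdivlMr ?subr_gt0 // => h.
have : 0 < s * (1 - m) by rewrite mulr_gt0 ?subr_gt0.
by move=> h'; rewrite segment_ptA H //; lra.
Qed.

Lemma left_lim (c : pt -> V) P Q (m d : R) v : 0 < m -> 0 < d ->
  (forall s, m - d < s -> s < m -> c (segment_pt P Q s) = v) ->
  lim c (segment_pt P Q m) P v.
Proof.
move=> m0 d0 H; rewrite segment_ptC; apply: (@right_lim _ _ _ _ d); rewrite //; first lra.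
by move=> s h1 h2; rewrite segment_ptC H //; lra.
Qed.

(* Two functions with the same jumps agree along a segment as soon as they
   agree at its beginning. *)
Lemma lim_match (c a : pt -> V) (P Q : pt) v0 v1 w1 :
  (forall m : R, 0 < m < 1 -> exists v w v' w',
     [/\ lim c (segment_pt P Q m) P v, lim c (segment_pt P Q m) Q w,
         lim a (segment_pt P Q m) P v', lim a (segment_pt P Q m) Q w' &
         v = v' <-> w = w']) ->
  lim c P Q v0 -> lim a P Q v0 -> lim c Q P v1 -> lim a Q P w1 -> v1 = w1.
Proof.
move=> loc c0 a0 c1 a1.
pose f s := c (segment_pt P Q s) = a (segment_pt P Q s).
(* Agreement of the two functions just before and just after [x]. *)
pose L (x : R) := exists2 d, 0 < d & forall s, x - d < s -> s < x -> f s.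
pose Rt (x : R) := exists2 d, 0 < d & forall s, x < s -> s < x + d -> f s.
have mind (d d' : R) : 0 < d -> 0 < d' ->
    exists e : R, [/\ 0 < e, e <= d & e <= d'].
  move=> p p'; exists (Num.min d d').
  by rewrite lt_min p p' !ge_min !lexx orbT.
(* One-sided limits exist, so agreement has a constant truth value on a short interval on each side
   of a point. *)
have locR (x : R) : 0 <= x < 1 -> exists2 d, 0 < d & exists b : Prop,
    forall s, x < s -> s < x + d -> (f s <-> b).
  move=> /andP[x0 x1].
  have [w [w' [cw aw]]] : exists w w', lim c (segment_pt P Q x) Q w /\ lim a (segment_pt P Q x) Q w'.
    move: x0; rewrite le_eqVlt => /orP[/eqP <-|x0].
      by rewrite segment_pt0; exists v0, v0.
    have [//|v [w [v' [w' [_ cw _ aw _]]]]] := loc x _; first by rewrite x0 x1.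
    by exists w, w'.
  have [d dp Hd] := lim_right x1 cw; have [d' dp' Hd'] := lim_right x1 aw.
  have [e [e0 ed ed']] := mind _ _ dp dp'.
  exists e => //; exists (w = w') => s h1 h2.
  by rewrite /f Hd ?Hd' //; lra.
have locL (x : R) : 0 < x <= 1 -> exists2 d, 0 < d & exists b : Prop,
    forall s, x - d < s -> s < x -> (f s <-> b).
  move=> /andP[x0 x1].
  have [w [w' [cw aw]]] : exists w w', lim c (segment_pt P Q x) P w /\ lim a (segment_pt P Q x) P w'.
    move: x1; rewrite le_eqVlt => /orP[/eqP ->|x1].
      by rewrite segment_pt1; exists v1, w1.
    have [//|v [w [v' [w' [cw _ aw _ _]]]]] := loc x _; first by rewrite x0 x1.
    by exists v, v'.
  have [d dp Hd] := lim_left x0 cw; have [d' dp' Hd'] := lim_left x0 aw.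
  have [e [e0 ed ed']] := mind _ _ dp dp'.
  exists e => //; exists (w = w') => s h1 h2.
  by rewrite /f Hd ?Hd' //; lra.
(* This is where the equality of jumps is used: agreement passes across a point. *)
have LR (x : R) : 0 < x < 1 -> L x -> Rt x.
  move=> x01 [d dp Hd]; have [v [w [v' [w' [cv cw av aw e]]]]] := loc x x01.
  move/andP: x01 => [x0 x1].
  have [d1 dp1 H1] := lim_left x0 cv; have [d2 dp2 H2] := lim_left x0 av.
  have [d3 dp3 H3] := lim_right x1 cw; have [d4 dp4 H4] := lim_right x1 aw.
  have [e1 [e10 e1d e1d1]] := mind _ _ dp dp1.
  have [e2 [e20 e2d e2d1]] := mind _ _ e10 dp2.
  have [e3 [e30 e3d e3d1]] := mind _ _ dp3 dp4.
  exists e3 => // s h1 h2; rewrite /f (H3 s) ?(H4 s); [|lra..].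
  apply/e; have := Hd (x - e2 / 2); rewrite /f H1 ?H2; [|lra..].
  by apply; lra.
have sub (x d : R) b : 0 < d -> (forall s, x < s -> s < x + d -> (f s <-> b)) -> Rt x -> b.
  move=> dp H [d' dp' H']; have [e [e0 ed ed']] := mind _ _ dp dp'.
  by apply/(H (x + e / 2)); [lra|lra|apply: H'; lra].
have subL (x d : R) (b : Prop) : 0 < d -> (forall s, x - d < s -> s < x -> (f s <-> b)) -> b -> L x.
  by move=> dp H hb; exists d => // s h1 h2; apply/H.
(* Formulated with one-sided germs at both ends, the statement can be concatenated: [LR] bridges the
   common end of two intervals. *)
pose Pr (u v : R) := u < v -> Rt u -> L v.
have : Pr 0 1.
  apply: cousin => // [x /andP[x0 x1]|u v w u0 uv vw wle1 H1 H2 uw Ru].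
  - have [dR dRp HR] : exists2 d, 0 < d & forall v : R, x < v -> v <= 1 -> v - x < d -> Rt x -> L v.
      have [x1'|x1'] := ltP x 1; last by exists 1 => // v h1 h2; lra.
      have [d dp [b Hb]] := locR x (introT andP (conj x0 x1')).
      exists d => // v h1 h2 h3 Rx; have hb := sub _ _ _ dp Hb Rx.
      by exists (v - x); [lra|move=> s h4 h5; apply/Hb => //; lra].
    have [dL dLp HL] : exists2 d, 0 < d & forall u : R, u < x -> 0 <= u -> x - u < d -> Rt u -> L x.
      have [x0'|x0'] := ltP 0 x; last by exists 1 => // v h1 h2; lra.
      have [d dp [b Hb]] := locL x (introT andP (conj x0' x1)).
      exists d => // v h1 h2 h3 Rx; apply: (subL _ _ _ dp Hb).
      by apply: (sub v (x - v)); [lra|move=> s h4 h5; apply: Hb; lra|].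
    have [d [d0 dd1 dd2]] := mind _ _ dRp dLp.
    exists d => // u v u0 ux xv vle1 h1 h2 uv Ru.
    move: ux; rewrite le_eqVlt => /orP[/eqP ux|ux].
      by apply: HR; rewrite -?ux //; lra.
    have Lx : L x by apply: HL Ru => //; lra.
    move: xv; rewrite le_eqVlt => /orP[/eqP <- //|xv].
    by apply: HR => //; [lra|apply: LR => //; lra].
  - move: uv; rewrite le_eqVlt => /orP[/eqP uv|uv]; first by apply: H2; rewrite -uv.
    have Lv := H1 uv Ru.
    move: vw; rewrite le_eqVlt => /orP[/eqP <- //|vw].
    by apply: H2 => //; apply: LR => //; lra.
have h01 : 0 < 1 :> R by lra.
move=> /(_ h01) [].
  have [||d dp Hd] := @lim_right c P Q 0 v0; rewrite ?segment_pt0 //.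
  have [||d' dp' Hd'] := @lim_right a P Q 0 v0; rewrite ?segment_pt0 //.
  have [e [e0 ed ed']] := mind _ _ dp dp'.
  by exists e => // s h1 h2; rewrite /f Hd ?Hd' //; lra.
move=> d dp Hd.
have [||d1 dp1 Hd1] := @lim_left c P Q 1 v1; rewrite ?segment_pt1 //.
have [||d2 dp2 Hd2] := @lim_left a P Q 1 w1; rewrite ?segment_pt1 //.
have [e1 [e10 e1d e1d1]] := mind _ _ dp dp1.
have [e2 [e20 e2d e2d1]] := mind _ _ e10 dp2.
have := Hd (1 - e2 / 2); rewrite /f Hd1 ?Hd2; [|lra..].
by apply; lra.
Qed.
End Limits.

(** * Flat sections of a local system over a square *)

Section LocalSystem.
Variables (R : realType) (V : Type).

Definition nb (x1 x2 : R) (P : R -> R -> Prop) : Prop :=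
  exists2 d : R, 0 < d &
    forall y1 y2 : R, `|y1 - x1| < d -> `|y2 - x2| < d -> P y1 y2.

Lemma nb_sub x1 x2 (P Q : R -> R -> Prop) :
  (forall y1 y2, P y1 y2 -> Q y1 y2) -> nb x1 x2 P -> nb x1 x2 Q.
Proof. by move=> PQ [d dp H]; exists d => // *; apply/PQ/H. Qed.

Lemma nb_and x1 x2 (P Q : R -> R -> Prop) :
  nb x1 x2 P -> nb x1 x2 Q -> nb x1 x2 (fun y1 y2 => P y1 y2 /\ Q y1 y2).
Proof.
move=> [d dp H] [e ep K]; exists (Num.min d e); first by rewrite lt_min dp ep.
move=> y1 y2; rewrite !lt_min => /andP[h1 h2] /andP[h3 h4].
by split; [apply: H|apply: K].
Qed.

Lemma nbT x1 x2 (P : R -> R -> Prop) : (forall y1 y2, P y1 y2) -> nb x1 x2 P.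
Proof. by exists 1. Qed.

Lemma nb_self x1 x2 (P : R -> R -> Prop) : nb x1 x2 P -> P x1 x2.
Proof. by move=> [d dp]; apply; rewrite subrr normr0. Qed.

Lemma nb_all (I : eqType) (s : seq I) x1 x2 (P : I -> R -> R -> Prop) :
  (forall i, i \in s -> nb x1 x2 (P i)) ->
  nb x1 x2 (fun y1 y2 => forall i, i \in s -> P i y1 y2).
Proof.
elim: s => [|i s IH] H; first exact: nbT.
have := nb_and (H i (mem_head _ _)) (IH (fun j js => H j (mem_behead (s := i :: s) js))).
apply: nb_sub => y1 y2 [h1 h2] j; rewrite inE => /orP[/eqP -> //|]; exact: h2.
Qed.

Variables (tau : R -> R -> R -> R -> V -> V) (D : R -> R -> Prop).
Hypothesis tau_inj : forall x1 x2 y1 y2 u w,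
  tau x1 x2 y1 y2 u = tau x1 x2 y1 y2 w -> u = w.
Hypothesis tau_surj : forall x1 x2 y1 y2 w, exists u, tau x1 x2 y1 y2 u = w.

(** The inner neighbourhood depends on [y] and even on the colour [u]: the law based at [x] is
    compared with the law based at [y] only close to [y], which is all that the local models can
    provide. *)
Definition locally_transitive := forall x1 x2, D x1 x2 ->
  nb x1 x2 (fun y1 y2 => D y1 y2 -> forall u, nb y1 y2 (fun z1 z2 => D z1 z2 ->
    tau x1 x2 z1 z2 u = tau y1 y2 z1 z2 (tau x1 x2 y1 y2 u))).

Definition flat (Q : R -> R -> Prop) (v : R -> R -> V) := forall x1 x2, Q x1 x2 ->
  nb x1 x2 (fun y1 y2 => Q y1 y2 -> v y1 y2 = tau x1 x2 y1 y2 (v x1 x2)).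

Lemma flat_sub (Q Q' : R -> R -> Prop) v :
  (forall x1 x2, Q x1 x2 -> Q' x1 x2) -> flat Q' v -> flat Q v.
Proof.
move=> QQ' H x1 x2 /QQ' /H; apply: nb_sub => y1 y2 h /QQ'; exact: h.
Qed.

Definition rect (a b c d x y : R) := [/\ a <= x, x <= b, c <= y & y <= d].

(** Transport is injective, so agreement of two flat sections is locally constant along the
    segment. *)
Lemma flat_uniq (Q : R -> R -> Prop) v w x1 x2 y1 y2 :
  (forall t : R, 0 <= t <= 1 -> Q ((1 - t) * x1 + t * y1) ((1 - t) * x2 + t * y2)) ->
  flat Q v -> flat Q w -> v x1 x2 = w x1 x2 -> v y1 y2 = w y1 y2.
Proof.
move=> conv Fv Fw e.
pose p1 t := (1 - t) * x1 + t * y1; pose p2 t := (1 - t) * x2 + t * y2.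
pose f t := v (p1 t) (p2 t) = w (p1 t) (p2 t).
have : f 0 <-> f 1.
  apply: (cousin (P := fun s t => f s <-> f t)) => // [t t01|]; last first.
    by move=> r s t _ _ _ _ -> ->.
  have [d dp Hd] := nb_and (Fv _ _ (conv t t01)) (Fw _ _ (conv t t01)).
  (* [M] bounds the speed of the segment and turns closeness of parameters into closeness of
     points. *)
  pose M := 1 + `|y1 - x1| + `|y2 - x2|.
  have M0 : 0 < M by rewrite /M; have := normr_ge0 (y1 - x1); have := normr_ge0 (y2 - x2); lra.
  have near (s : R) : 0 <= s <= 1 -> `|s - t| < d / M -> f s <-> f t.
    move=> s01; rewrite ltr_pdivlMr // => st.
    have e1 : p1 s - p1 t = (s - t) * (y1 - x1) by rewrite /p1; ring.
    have e2 : p2 s - p2 t = (s - t) * (y2 - x2) by rewrite /p2; ring.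
    have h0 := normr_ge0 (s - t); have h1 := normr_ge0 (y1 - x1); have h2 := normr_ge0 (y2 - x2).
    have [||hv hw] := Hd (p1 s) (p2 s).
    - by rewrite -/(p1 t) e1 normrM /M in st *; nra.
    - by rewrite -/(p2 t) e2 normrM /M in st *; nra.
    rewrite /f hv ?hw; try exact: conv; rewrite -/(p1 t) -/(p2 t).
    by split=> [/tau_inj|-> //].
  exists (d / M); first exact: divr_gt0.
  move=> r s r0 rt ts s1 h1 h2; move/andP: t01 => [t0 t1].
  have -> : f r <-> f t.
    by apply: near; [apply/andP; split; lra|rewrite ltr_norml; apply/andP; split; lra].
  have -> // : f s <-> f t.
  by apply: near; [apply/andP; split; lra|rewrite ltr_norml; apply/andP; split; lra].
rewrite /f (_ : p1 0 = x1) 1?(_ : p2 0 = x2) 1?(_ : p1 1 = y1) 1?(_ : p2 1 = y2);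
  [by move=> h; apply/h|rewrite /p1 /p2; ring..].
Qed.

Lemma rect_conv a b c d x1 x2 y1 y2 : rect a b c d x1 x2 -> rect a b c d y1 y2 ->
  forall t : R, 0 <= t <= 1 ->
  rect a b c d ((1 - t) * x1 + t * y1) ((1 - t) * x2 + t * y2).
Proof.
move=> [h1 h2 h3 h4] [k1 k2 k3 k4] t /andP[t0 t1].
by split; nra.
Qed.

(** The value is prescribed at the lower left corner, from which a section can be continued both to
    the right and upwards. *)
Definition has_flat a b c d := forall u, exists2 v, flat (rect a b c d) v & v a c = u.

(** The second section is started with the value of the first at the lower end of the common side;
    by uniqueness the two then agree on that whole side. *)
Lemma has_flat_cat1 a b c d e : a <= b -> b <= e -> c <= d ->
  has_flat a b c d -> has_flat b e c d -> has_flat a e c d.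
Proof.
move=> ab be cd H1 H2 u; have [v Fv vu] := H1 u; have [w Fw wv] := H2 (v b c).
have e0 y : c <= y -> y <= d -> v b y = w b y.
  move=> cy yd; apply: (@flat_uniq (rect b b c d) v w b c b y) => //.
  - by apply: rect_conv; split.
  - by apply: flat_sub Fv => x1 x2 [? ? ? ?]; split=> //; exact: le_trans ab _.
  - by apply: flat_sub Fw => x1 x2 [? ? ? ?]; split=> //; exact: le_trans be.
exists (fun x y => if x <= b then v x y else w x y); last by rewrite ab.
move=> x1 x2 [h1 h2 h3 h4].
have [xb|xb|xb] := ltgtP x1 b.
- have : nb x1 x2 (fun y1 y2 => y1 < b).
    exists (b - x1); first lra.
    by move=> y1 y2; rewrite ltr_norml => /andP[? ?] _; lra.
  have := Fv x1 x2 (And4 h1 (ltW xb) h3 h4); move=> A B; move: (nb_and A B).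
  apply: nb_sub => y1 y2 [A' B'] [? ? ? ?]; rewrite (ltW B') A' //.
  by split=> //; exact: ltW.
- have : nb x1 x2 (fun y1 y2 => b < y1).
    exists (x1 - b); first lra.
    by move=> y1 y2; rewrite ltr_norml => /andP[? ?] _; lra.
  have := Fw x1 x2 (And4 (ltW xb) h2 h3 h4); move=> A B; move: (nb_and A B).
  apply: nb_sub => y1 y2 [A' B'] [? ? ? ?]; rewrite leNgt B' /= A' //.
  by split=> //; exact: ltW.
- subst x1.
  have := nb_and (Fv b x2 (And4 h1 (lexx b) h3 h4)) (Fw b x2 (And4 (lexx b) h2 h3 h4)).
  apply: nb_sub => y1 y2 [A B] [? ? ? ?]; case: leP => yb; first by rewrite A.
  by rewrite B ?e0 //; split=> //; exact: ltW.
Qed.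

Lemma has_flat_cat2 a b c d e : a <= b -> c <= d -> d <= e ->
  has_flat a b c d -> has_flat a b d e -> has_flat a b c e.
Proof.
move=> ab cd de H1 H2 u; have [v Fv vu] := H1 u; have [w Fw wv] := H2 (v a d).
have e0 x : a <= x -> x <= b -> v x d = w x d.
  move=> cy yd; apply: (@flat_uniq (rect a b d d) v w a d x d) => //.
  - by apply: rect_conv; split.
  - by apply: flat_sub Fv => x1 x2 [? ? ? ?]; split=> //; exact: le_trans cd _.
  - by apply: flat_sub Fw => x1 x2 [? ? ? ?]; split=> //; exact: le_trans de.
exists (fun x y => if y <= d then v x y else w x y); last by rewrite cd.
move=> x1 x2 [h1 h2 h3 h4].
have [xb|xb|xb] := ltgtP x2 d.
- have : nb x1 x2 (fun y1 y2 => y2 < d).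
    exists (d - x2); first lra.
    by move=> y1 y2 _; rewrite ltr_norml => /andP[? ?]; lra.
  have := Fv x1 x2 (And4 h1 h2 h3 (ltW xb)); move=> A B; move: (nb_and A B).
  apply: nb_sub => y1 y2 [A' B'] [? ? ? ?]; rewrite (ltW B') A' //.
  by split=> //; exact: ltW.
- have : nb x1 x2 (fun y1 y2 => d < y2).
    exists (x2 - d); first lra.
    by move=> y1 y2 _; rewrite ltr_norml => /andP[? ?]; lra.
  have := Fw x1 x2 (And4 h1 h2 (ltW xb) h4); move=> A B; move: (nb_and A B).
  apply: nb_sub => y1 y2 [A' B'] [? ? ? ?]; rewrite leNgt B' /= A' //.
  by split=> //; exact: ltW.
- subst x2.
  have := nb_and (Fv x1 d (And4 h1 h2 h3 (lexx d))) (Fw x1 d (And4 h1 h2 (lexx d) h4)).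
  apply: nb_sub => y1 y2 [A B] [? ? ? ?]; case: leP => yb; first by rewrite A.
  by rewrite B ?e0 //; split=> //; exact: ltW.
Qed.

(** Small rectangles are stacked into a thin column, and the columns are put side by side, by
    interval induction in each coordinate. There is no monodromy because every gluing takes place
    along a single connected side. *)
Lemma flat_square : (forall x y, rect 0 1 0 1 x y -> D x y) ->
  locally_transitive -> has_flat 0 1 0 1.
Proof.
move=> QD loc.
have small x1 x2 : rect 0 1 0 1 x1 x2 -> exists2 e : R, 0 < e & forall a b c d,
    [/\ 0 <= a, a <= x1, x1 <= b & b <= 1] -> [/\ 0 <= c, c <= x2, x2 <= d & d <= 1] ->
    x1 - a < e -> b - x1 < e -> x2 - c < e -> d - x2 < e -> has_flat a b c d.
  move=> Qx; have [e ep He] := loc _ _ (QD _ _ Qx).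
  exists e => // a b c d [a0 ax xb b1] [c0 cx xd d1] h1 h2 h3 h4 u.
  (* The corner colour is pulled back to the base point, from which local transitivity makes the
     transport flat. *)
  have [u0 eu0] := tau_surj x1 x2 a c u.
  exists (fun y1 y2 => tau x1 x2 y1 y2 u0) => // y1 y2 [k1 k2 k3 k4].
  have r : D y1 y2 by apply: QD; split; lra.
  have := He y1 y2; rewrite !ltr_norml => /(_ _ _ r).
  have [] : - e < y1 - x1 < e /\ - e < y2 - x2 < e by split; apply/andP; split; lra.
  move=> -> -> /(_ isT isT u0); apply: nb_sub => z1 z2 Hz [l1 l2 l3 l4].
  by rewrite Hz //; apply: QD; split; lra.
(* The width of the column is part of the property under induction, and stacking two columns takes
   the smaller width. *)
have col x : 0 <= x <= 1 -> exists2 e : R, 0 < e & forall a b,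
    0 <= a -> a <= x -> x <= b -> b <= 1 -> x - a < e -> b - x < e -> has_flat a b 0 1.
  move=> /andP[x0 x1].
  apply: (cousin (P := fun c d => exists2 e : R, 0 < e & forall a b,
    0 <= a -> a <= x -> x <= b -> b <= 1 -> x - a < e -> b - x < e -> has_flat a b c d)) => //.
  - move=> y /andP[y0 y1]; have [|e ep He] := small x y; first by split.
    exists e => // c d c0 cy yd d1 h1 h2; exists e => // a b a0 ax xb b1 h3 h4.
    exact: He.
  - move=> c d e c0 cd de e1 [e2 e2p H2] [e3 e3p H3].
    exists (Num.min e2 e3); first by rewrite lt_min e2p e3p.
    move=> a b a0 ax xb b1; rewrite !lt_min => /andP[h1 h2] /andP[h3 h4].
    apply: (@has_flat_cat2 a b c d e) => //; first exact: le_trans ax xb.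
      exact: H2.
    exact: H3.
apply: (cousin (P := fun a b => has_flat a b 0 1)) => //.
by move=> a b c a0 ab bc c1; apply: has_flat_cat1.
Qed.
End LocalSystem.

Section Triangle.
Variables (R : realType) (V : Type) (tau : R -> R -> R -> R -> V -> V).
Hypothesis tau_inj : forall x1 x2 y1 y2 u w,
  tau x1 x2 y1 y2 u = tau x1 x2 y1 y2 w -> u = w.
Hypothesis tau_surj : forall x1 x2 y1 y2 w, exists u, tau x1 x2 y1 y2 u = w.

Definition std_triangle (x y : R) := [/\ 0 <= x, 0 <= y & x + y <= 1].

Lemma min_near (x1 x2 y1 y2 d : R) : `|y1 - x1| < d -> `|y2 - x2| < d ->
  `|Num.min y1 (1 - y2) - Num.min x1 (1 - x2)| < d.
Proof.
rewrite !ltr_norml => /andP[h1 h2] /andP[h3 h4].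
by case: (leP y1 (1 - y2)) => ?; case: (leP x1 (1 - x2)) => ?; apply/andP; split; lra.
Qed.

(* The retraction (x, y) |-> (min (x, 1 - y), y) of the square onto the
   triangle reduces this to the square. *)
Lemma flat_triangle : locally_transitive tau std_triangle ->
  forall u, exists2 v, flat tau std_triangle v & v 0 0 = u.
Proof.
move=> loc u.
pose r (x y : R) := Num.min x (1 - y).
have rT x y : rect 0 1 0 1 x y -> std_triangle (r x y) y.
  by move=> [x0 x1 y0 y1]; rewrite /r; case: leP => ?; split; lra.
have rid x y : std_triangle x y -> r x y = x.
  by move=> [x0 y0 xy]; rewrite /r; case: leP => //; lra.
pose tau2 x1 x2 y1 y2 := tau (r x1 x2) x2 (r y1 y2) y2.
have i2 x1 x2 y1 y2 a b : tau2 x1 x2 y1 y2 a = tau2 x1 x2 y1 y2 b -> a = b by exact: tau_inj.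
have s2 x1 x2 y1 y2 w : exists a, tau2 x1 x2 y1 y2 a = w by exact: tau_surj.
have [|v Fv v0] := flat_square i2 s2 (D := rect 0 1 0 1) (fun x y h => h) _ u.

  move=> x1 x2 /rT /loc [d dp Hd]; exists d => // y1 y2 h1 h2 /rT yT w.
  have [e ep He] := Hd _ _ (min_near h1 h2) h2 yT w.
  exists e => // z1 z2 k1 k2 /rT zT; apply: He => //; exact: min_near.
have sub x y : std_triangle x y -> rect 0 1 0 1 x y by move=> [? ? ?]; split; lra.
exists v => // x1 x2 xT; have := Fv _ _ (sub _ _ xT).
by apply: nb_sub => y1 y2 + yT => /(_ (sub _ _ yT)); rewrite /tau2 !rid.
Qed.

End Triangle.

Section Linear.
Variables (R : realType).

Lemma affine_nb (a b c x1 x2 : R) : 0 < a * x1 + b * x2 + c ->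
  nb x1 x2 (fun y1 y2 => 0 < a * y1 + b * y2 + c).
Proof.
move=> h; pose M := 1 + `|a| + `|b|.
have a0 := normr_ge0 a; have b0 := normr_ge0 b.
have M0 : 0 < M by rewrite /M; lra.
exists ((a * x1 + b * x2 + c) / M); first exact: divr_gt0.
move=> y1 y2; rewrite !ltr_pdivlMr // => h1 h2.
have ha : `|a * (y1 - x1)| = `|a| * `|y1 - x1| by rewrite normrM.
have hb : `|b * (y2 - x2)| = `|b| * `|y2 - x2| by rewrite normrM.
have : - `|a * (y1 - x1)| <= a * (y1 - x1) by rewrite lerNl ler_normr lexx orbT.
have : - `|b * (y2 - x2)| <= b * (y2 - x2) by rewrite lerNl ler_normr lexx orbT.
rewrite ha hb.
have n1 := normr_ge0 (y1 - x1); have n2 := normr_ge0 (y2 - x2).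
set p := `|y1 - x1| in h1 n1 *; set q := `|y2 - x2| in h2 n2 *.
set s := a * x1 + b * x2 + c in h h1 h2 *.
move=> hb' ha'.
suff : s - `|a| * p - `|b| * q > 0 by rewrite /s; lra.
move: h1 h2; rewrite /M => h1 h2.
have [pq|pq] := leP p q; nra.
Qed.

End Linear.

(** * Coloured polygons in a projection *)

Section Frames.
Variable R : realType.
Local Notation pt := 'rV[R]_3.

(** The third axis is the direction of projection. *)
Record frame := Frame {
  fX : pt -> R; fY : pt -> R; fZ : pt -> R;
  affX : forall A B t, fX (segment_pt A B t) = (1 - t) * fX A + t * fX B;
  affY : forall A B t, fY (segment_pt A B t) = (1 - t) * fY A + t * fY B;
  affZ : forall A B t, fZ (segment_pt A B t) = (1 - t) * fZ A + t * fZ B;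
  frame_inj : forall P Q, fX P = fX Q -> fY P = fY Q -> fZ P = fZ Q -> P = Q }.

Variable V : zmodType.

Definition on_edges (E : pt -> pt -> Prop) (M : pt) : Prop :=
  exists U W, E U W /\ segment U W M.

Definition above (F : frame) (E : pt -> pt -> Prop) (M N : pt) : Prop :=
  [/\ on_edges E N, fX F N = fX F M, fY F N = fY F M & fZ F M < fZ F N].

(** For the symmetric edge relations used below, both half-edges at an interior point or at a vertex
    are covered; [U <> M] discards the direction of length zero. *)
Definition Lim (E : pt -> pt -> Prop) (c : pt -> V) (M : pt) (v : V) : Prop :=
  forall U W, E U W -> segment U W M -> U <> M -> lim c M U v.

(** A Fox colouring with values in a ring. The reflection law is asked only in the interior of
    edges, since in general position no vertex lies under another point of the polygon. *)
Definition coloring (F : frame) (E : pt -> pt -> Prop) (c : pt -> V) : Prop :=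
  forall U W M, E U W -> segment U W M ->
    ((forall N, ~ above F E M N) -> exists v, Lim E c M v) /\
    (forall N, M <> U -> M <> W -> above F E M N -> exists v w k,
       [/\ lim c M U v, lim c M W w, Lim E c N k & v + w = k + k]).

(** Stated through limits, because the values of [c] at isolated points are arbitrary. *)
Definition monochromatic (E : pt -> pt -> Prop) (c : pt -> V) (v0 : V) : Prop :=
  forall U W M v, E U W -> segment U W M -> U <> M -> lim c M U v -> v = v0.

Definition colorable (F : frame) (E : pt -> pt -> Prop) : Prop :=
  exists2 c, coloring F E c & forall v, ~ monochromatic E c v.

End Frames.

(** * Projected lines and their sides *)

Section Planar.
Variables (R : realType) (F : frame R).
Local Notation pt := 'rV[R]_3.
Local Notation X := (fX F).
Local Notation Y := (fY F).
Local Notation Z := (fZ F).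

Definition planar_neq (U W : pt) := X U <> X W \/ Y U <> Y W.

(** Twice the signed area of the projected triangle [U], [W], [z]: positive to the left of the
    directed line. *)
Definition lform (U W : pt) (z1 z2 : R) : R :=
  (X W - X U) * (z2 - Y U) - (Y W - Y U) * (z1 - X U).

Definition sqdist (U W : pt) : R := (X W - X U) ^+ 2 + (Y W - Y U) ^+ 2.

(** The parameter of the orthogonal projection onto the line. Being affine on the whole plane, it
    makes bounds on the parameter open conditions. *)
Definition ecoord (U W : pt) (z1 z2 : R) : R :=
  ((z1 - X U) * (X W - X U) + (z2 - Y U) * (Y W - Y U)) / sqdist U W.

Lemma sqdist_gt0 U W : planar_neq U W -> 0 < sqdist U W.
Proof.
rewrite /sqdist => h; have := sqr_ge0 (X W - X U); have := sqr_ge0 (Y W - Y U).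
move=> h1 h2; case: h => /eqP; rewrite -subr_eq0 -sqrf_eq0 => h.
  have : 0 < (X U - X W) ^+ 2 by rewrite lt0r h sqr_ge0.
  by rewrite -sqrrN opprB; lra.
have : 0 < (Y U - Y W) ^+ 2 by rewrite lt0r h sqr_ge0.
by rewrite -(sqrrN (Y U - Y W)) opprB; lra.
Qed.

Lemma planar_neqC U W : planar_neq U W -> planar_neq W U.
Proof. by case=> h; [left|right] => e; apply: h. Qed.

Lemma lform_eq0 U W z1 z2 : planar_neq U W -> lform U W z1 z2 = 0 ->
  X (segment_pt U W (ecoord U W z1 z2)) = z1 /\
  Y (segment_pt U W (ecoord U W z1 z2)) = z2.
Proof.
move=> /sqdist_gt0; rewrite /lform affX affY /ecoord => h e.
have n0 : sqdist U W != 0 by rewrite gt_eqF.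
pose l := (X W - X U) * (z2 - Y U) - (Y W - Y U) * (z1 - X U).
split.
- transitivity (z1 + (Y W - Y U) * l / sqdist U W).
    by rewrite /l /sqdist in n0 *; field.
  by rewrite /l e; ring.
- transitivity (z2 - (X W - X U) * l / sqdist U W).
    by rewrite /l /sqdist in n0 *; field.
  by rewrite /l e; ring.
Qed.

Lemma lform_segment U W t z1 z2 : planar_neq U W ->
  X (segment_pt U W t) = z1 -> Y (segment_pt U W t) = z2 ->
  lform U W z1 z2 = 0 /\ t = ecoord U W z1 z2.
Proof.
move=> /sqdist_gt0 h <- <-; rewrite /ecoord /lform !affX !affY.
have n0 : sqdist U W != 0 by rewrite gt_eqF.
by split; [ring|rewrite /sqdist in n0 *; field].
Qed.

Definition affine (f : R -> R -> R) :=
  exists a b c, forall y1 y2, f y1 y2 = a * y1 + b * y2 + c.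

Lemma affine_pos f x1 x2 : affine f -> 0 < f x1 x2 -> nb x1 x2 (fun y1 y2 => 0 < f y1 y2).
Proof.
move=> [a [b [c e]]]; rewrite e => /affine_nb; apply: nb_sub => y1 y2; by rewrite e.
Qed.

Lemma affine_scale f (k m : R) : affine f -> affine (fun y1 y2 => k * f y1 y2 + m).
Proof.
move=> [a [b [c e]]]; exists (k * a), (k * b), (k * c + m) => y1 y2; rewrite e; ring.
Qed.

Lemma affine_lt f (t x1 x2 : R) : affine f -> f x1 x2 < t -> nb x1 x2 (fun y1 y2 => f y1 y2 < t).
Proof.
move=> af h; have := affine_pos (x1 := x1) (x2 := x2) (affine_scale (-1) t af).
have -> : -1 * f x1 x2 + t = t - f x1 x2 by ring.
rewrite subr_gt0 => /(_ h); apply: nb_sub => y1 y2; lra.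
Qed.

Lemma affine_gt f (t x1 x2 : R) : affine f -> t < f x1 x2 -> nb x1 x2 (fun y1 y2 => t < f y1 y2).
Proof.
move=> af h; have := affine_pos (x1 := x1) (x2 := x2) (affine_scale 1 (- t) af).
have -> : 1 * f x1 x2 - t = f x1 x2 - t by ring.
rewrite subr_gt0 => /(_ h); apply: nb_sub => y1 y2; lra.
Qed.

Lemma affine_neq0 f x1 x2 : affine f -> f x1 x2 <> 0 ->
  nb x1 x2 (fun y1 y2 => f y1 y2 <> 0 /\ (0 < f y1 y2) = (0 < f x1 x2)).
Proof.
move=> af /eqP; rewrite neq_lt => /orP[h|h].
  have := affine_lt af h; apply: nb_sub => y1 y2 h'.
  by split; [apply/eqP; rewrite lt_eqF|rewrite !ltNge !ltW].
have := affine_gt af h; apply: nb_sub => y1 y2 h'.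
by split; [apply/eqP; rewrite gt_eqF|rewrite h' h].
Qed.

Lemma affine_lform U W : affine (lform U W).
Proof.
exists (- (Y W - Y U)), (X W - X U), (- (X W - X U) * Y U + (Y W - Y U) * X U).
by move=> y1 y2; rewrite /lform; ring.
Qed.

Lemma affine_ecoord U W : affine (ecoord U W).
Proof.
exists ((X W - X U) / sqdist U W), ((Y W - Y U) / sqdist U W),
  (- (X U * (X W - X U) + Y U * (Y W - Y U)) / sqdist U W).
by move=> y1 y2; rewrite /ecoord; ring.
Qed.

Lemma nb_neq (p1 p2 x1 x2 : R) : (x1, x2) <> (p1, p2) ->
  nb x1 x2 (fun y1 y2 => (y1, y2) <> (p1, p2)).
Proof.
move=> h.
have a1 : affine (fun y1 y2 => 1 * (1 * y1 + 0 * y2) - p1).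
  by exists 1, 0, (- p1) => ? ?; ring.
have a2 : affine (fun y1 y2 => 1 * (0 * y1 + 1 * y2) - p2).
  by exists 0, 1, (- p2) => ? ?; ring.
have [e1|/eqP n1] := eqVneq x1 p1; last first.
  have [|d dp Hd] := affine_neq0 (x1 := x1) (x2 := x2) a1; first by move=> e; apply: n1; lra.
  by exists d => // y1 y2 u v [e _]; have [n _] := Hd _ _ u v; apply: n; lra.
have [e2|/eqP n2] := eqVneq x2 p2; first by case: h; rewrite e1 e2.
have [|d dp Hd] := affine_neq0 (x1 := x1) (x2 := x2) a2; first by move=> e; apply: n2; lra.
by exists d => // y1 y2 u v [_ e]; have [n _] := Hd _ _ u v; apply: n; lra.
Qed.

(* An edge misses the part of a neighbourhood lying strictly above height 0 as
   soon as it does not meet the closed upper half of the vertical line there. *)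
Lemma not_over_nb U W x1 x2 : planar_neq U W ->
  (forall N, segment U W N -> X N = x1 -> Y N = x2 -> Z N < 0) ->
  nb x1 x2 (fun y1 y2 => forall N, segment U W N -> X N = y1 -> Y N = y2 -> Z N < 0).
Proof.
move=> pd H.
pose t := ecoord U W x1 x2.
have K (P : R -> R -> Prop) : nb x1 x2 P ->
    (forall y1 y2 s, P y1 y2 -> 0 <= s <= 1 -> X (segment_pt U W s) = y1 ->
       Y (segment_pt U W s) = y2 -> lform U W y1 y2 = 0 -> s = ecoord U W y1 y2 ->
       Z (segment_pt U W s) < 0) ->
    nb x1 x2 (fun y1 y2 => forall N, segment U W N -> X N = y1 -> Y N = y2 -> Z N < 0).
  move=> nP HP; apply: nb_sub nP => y1 y2 Py N [s s01 <-] e1 e2.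
  have [l0 st] := lform_segment pd e1 e2.
  exact: (HP y1 y2).
have [l0|l0] := eqVneq (lform U W x1 x2) 0; last first.
  have h : nb x1 x2 (fun y1 y2 => lform U W y1 y2 <> 0).
    have := affine_neq0 (affine_lform U W) (elimN eqP l0).
    by apply: nb_sub => y1 y2 [].
  by apply: K h _ => y1 y2 s ? _ _ _ ?.
have [e1 e2] := lform_eq0 pd l0.
have [t0|t0] := ltP t 0.
  by apply: K (affine_lt (affine_ecoord U W) t0) _ => y1 y2 s h /andP[? _] _ _ _ ?; lra.
have [t1|t1] := ltP 1 t.
  by apply: K (affine_gt (affine_ecoord U W) t1) _ => y1 y2 s h /andP[_ ?] _ _ _ ?; lra.
have zt : Z (segment_pt U W t) < 0.
  by apply: H => //; exists t => //=; rewrite t0 t1.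
have [a [b [c e]]] := affine_ecoord U W.
have az : affine (fun y1 y2 => Z (segment_pt U W (ecoord U W y1 y2))).
  exists ((Z W - Z U) * a), ((Z W - Z U) * b), ((Z W - Z U) * c + Z U) => y1 y2.
  by rewrite affZ e; ring.
by apply: K (affine_lt az zt) _ => y1 y2 s h _ _ _ _ ->.
Qed.

(** The points of the line itself are assigned to a side by its direction, so that reversing the
    line negates [side] everywhere, also on the line. *)
Definition side (U W : pt) (z1 z2 : R) : bool :=
  (0 < lform U W z1 z2) || ((lform U W z1 z2 == 0) &&
     ((Y W < Y U) || ((Y W == Y U) && (X U < X W)))).

Lemma lformC U W z1 z2 : lform W U z1 z2 = - lform U W z1 z2.
Proof. by rewrite /lform; ring. Qed.

Lemma sideC U W z1 z2 : planar_neq U W -> side W U z1 z2 = ~~ side U W z1 z2.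
Proof.
move=> pd; rewrite /side lformC oppr_gt0 oppr_eq0.
case: (ltgtP (lform U W z1 z2) 0) => //= _.
case: (ltgtP (Y W) (Y U)) => //= e.
by case: (ltgtP (X U) (X W)) => //= e'; case: pd => n; exfalso; apply: n.
Qed.

(** The linear form is multiplied by a positive factor, and the tie-break on the line depends on the
    direction alone. *)
Lemma side_scale U W U' W' (k : R) z1 z2 : 0 < k ->
  X W' = X U' + k * (X W - X U) -> Y W' = Y U' + k * (Y W - Y U) ->
  lform U W (X U') (Y U') = 0 -> side U' W' z1 z2 = side U W z1 z2.
Proof.
move=> k0 eX eY e0.
have el : lform U' W' z1 z2 = k * lform U W z1 z2.
  transitivity (k * (lform U W z1 z2 - lform U W (X U') (Y U'))).
    by rewrite /lform eX eY; ring.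
  by rewrite e0 subr0.
have lt_k (p q r : R) : (p + k * (q - r) < p) = (q < r).
  rewrite -[RHS]subr_lt0 -[RHS](pmulr_rlt0 _ k0).
  by apply/idP/idP; lra.
rewrite /side el pmulr_rgt0 // mulf_eq0 (gt_eqF k0) /= eX eY lt_k.
have -> : (Y U' + k * (Y W - Y U) == Y U') = (Y W == Y U).
  by rewrite -subr_eq0 addrAC subrr add0r mulf_eq0 (gt_eqF k0) /= subr_eq0.
have -> // : (X U' < X U' + k * (X W - X U)) = (X U < X W).
rewrite -[RHS]subr_gt0 -[RHS](pmulr_rgt0 _ k0).
by apply/idP/idP; lra.
Qed.

Lemma side_nb U W x1 x2 : lform U W x1 x2 <> 0 ->
  nb x1 x2 (fun y1 y2 => side U W y1 y2 = side U W x1 x2).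
Proof.
move=> n0; have := affine_neq0 (affine_lform U W) n0.
by apply: nb_sub => y1 y2 [/eqP/negbTE n e]; rewrite /side e n (negbTE (introN eqP n0)).
Qed.

End Planar.

Section Segments.
Variables (R : realType) (V : comNzRingType) (F : frame R).
Local Notation pt := 'rV[R]_3.
Local Notation X := (fX F).
Local Notation Y := (fY F).
Local Notation Z := (fZ F).

Lemma segmentC (U W N : pt) : segment U W N -> segment W U N.
Proof.
move=> [t /= /andP[t0 t1] <-]; exists (1 - t); first by apply/andP; split; lra.
by rewrite -segment_ptC.
Qed.

Lemma segment_start (U W : pt) : segment U W U.
Proof. by exists 0; rewrite /= ?lexx ?ler01 ?segment_pt0. Qed.

Lemma segment_end (U W : pt) : segment U W W.
Proof. by exists 1; rewrite /= ?lexx ?ler01 ?segment_pt1. Qed.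

Lemma segment_pt_inj (U W : pt) s t : planar_neq F U W ->
  segment_pt U W s = segment_pt U W t -> s = t.
Proof.
move=> pd e.
have [_ ->] := lform_segment pd (erefl (X (segment_pt U W s))) (erefl (Y (segment_pt U W s))).
by have [_ ->] := lform_segment pd (erefl (X (segment_pt U W t))) (erefl (Y (segment_pt U W t))); rewrite e.
Qed.

Lemma small_pos (a b : R) : 0 < a -> exists2 e : R, 0 < e &
  forall s, 0 < s -> s < e -> 0 < (1 - s) * a + s * b.
Proof.
move=> a0; have b0 := normr_ge0 b; have D0 : 0 < a + `|b| by lra.
exists (a / (a + `|b|)); first exact: divr_gt0.
move=> s s0; rewrite ltr_pdivlMr // => h.
have : - `|b| <= b by rewrite lerNl ler_normr lexx orbT.
by nra.
Qed.

Definition interior (U W M : pt) := [/\ segment U W M, M <> U & M <> W].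

Lemma interiorP U W M : planar_neq F U W -> interior U W M ->
  exists2 t : R, 0 < t < 1 & M = segment_pt U W t.
Proof.
move=> pd [[t /= /andP[t0 t1] <-] nU nW]; exists t => //.
rewrite !lt_neqAle t0 t1 !andbT; apply/andP; split; apply/eqP => e.
  by apply: nU; rewrite -e segment_pt0.
by apply: nW; rewrite e segment_pt1.
Qed.

Lemma interior_pt U W (t : R) : planar_neq F U W -> 0 < t < 1 ->
  interior U W (segment_pt U W t).
Proof.
move=> pd /andP[t0 t1]; split; first by exists t => //=; rewrite !ltW.
  by rewrite -[X in _ <> X](segment_pt0 U W) => /(segment_pt_inj pd) e; move: t0; rewrite e ltxx.
by rewrite -[X in _ <> X](segment_pt1 U W) => /(segment_pt_inj pd) e; move: t1; rewrite e ltxx.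
Qed.

Lemma interiorC U W M : interior U W M -> interior W U M.
Proof. by move=> [/segmentC ? ? ?]; split. Qed.

Lemma segment_sub P Q N : planar_neq F P Q -> segment P Q N -> N <> Q ->
  exists2 t, 0 <= t < 1 & N = segment_pt P Q t.
Proof.
move=> pd [t /= /andP[t0 t1] <-] n; exists t => //; rewrite t0 lt_neqAle t1 andbT.
by apply/eqP => e; apply: n; rewrite e segment_pt1.
Qed.

Lemma ray_interior P Q N (s : R) : planar_neq F P Q -> segment P Q N -> N <> Q ->
  0 < s < 1 -> interior P Q (segment_pt N Q s).
Proof.
move=> pd h1 h2 /andP[s0 s1]; have [t /andP[t0 t1] ->] := segment_sub pd h1 h2.
by rewrite segment_ptA; apply: interior_pt => //; apply/andP; split; nra.
Qed.

Lemma planar_neq_sub P Q N : planar_neq F P Q -> segment P Q N -> N <> Q ->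
  planar_neq F N Q.
Proof.
move=> pd h1 h2; have [t /andP[t0 t1] ->] := segment_sub pd h1 h2.
have n0 : 1 - t != 0 by apply/eqP; lra.
rewrite /planar_neq affX affY; case: pd => h; [left|right] => e; apply: h; apply: (mulfI n0); lra.
Qed.

Lemma side_sub P Q N z1 z2 : planar_neq F P Q -> segment P Q N -> N <> Q ->
  side F N Q z1 z2 = side F P Q z1 z2.
Proof.
move=> pd h1 h2; have [t /andP[t0 t1] e] := segment_sub pd h1 h2.
apply: (@side_scale _ F _ _ _ _ (1 - t)); rewrite ?e ?affX ?affY; [lra|ring|ring|].
rewrite /lform; ring.
Qed.

End Segments.

(** * The shadow of a strand on a triangle *)

Section Shadow.
Variables (R : realType) (V : comNzRingType) (F : frame R).
Local Notation pt := 'rV[R]_3.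
Local Notation X := (fX F).
Local Notation Y := (fY F).
Local Notation Z := (fZ F).
Local Notation T := (@std_triangle R).

Definition in_edges (E0 : seq (pt * pt)) (U W : pt) :=
  (U, W) \in E0 \/ (W, U) \in E0.

Variables (A B : pt) (E0 : seq (pt * pt)) (c : pt -> V).
Local Notation Ed := (in_edges E0).

Definition strand (y1 y2 : R) (N : pt) :=
  [/\ on_edges Ed N, X N = y1, Y N = y2 & 0 < Z N].

Definition cross (U W U' W' : pt) :=
  (X W - X U) * (Y W' - Y U') - (Y W - Y U) * (X W' - X U').

(** What the shadow needs from the edges [E0] that the move leaves alone: simplicity of the polygon,
    general position, and the colouring law for points above the triangle. The triangle is the
    standard one in the plane of height zero, with corners [A] and [B] where the replaced path
    starts and ends. *)
Record shadow_data : Prop := ShadowData {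
  sd_A : [/\ X A = 0, Y A = 0 & Z A = 0];
  sd_B : [/\ X B = 1, Y B = 0 & Z B = 0];
  sd_pd : forall U W, Ed U W -> planar_neq F U W;
  sd_touch : forall U W N, Ed U W -> segment U W N -> T (X N) (Y N) -> Z N = 0 ->
    N = A \/ N = B;
  sd_simple : forall U W U' W' N, Ed U W -> Ed U' W' -> interior U W N ->
    segment U' W' N -> (U = U' /\ W = W') \/ (U = W' /\ W = U');
  sd_vertex : forall N U, N <> A -> N <> B -> Ed N U ->
    exists W, [/\ W <> U, Ed N W & forall Q, Ed N Q -> Q = U \/ Q = W];
  sd_end : forall D U U', D = A \/ D = B -> Ed D U -> Ed D U' -> U = U';
  sd_endpt : forall D U W, D = A \/ D = B -> Ed U W -> segment U W D -> D = U \/ D = W;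
  sd_disj : forall N U W M, Ed N U -> Ed N W -> U <> W -> segment N U M ->
    segment N W M -> M = N;
  sd_gen2 : forall U W U' W' M N, Ed U W -> Ed U' W' -> segment U W M ->
    segment U' W' N -> X M = X N -> Y M = Y N -> M <> N ->
    [/\ M <> U, M <> W & cross U W U' W' <> 0];
  sd_gen_end : forall D N, D = A \/ D = B -> on_edges Ed N -> X N = X D -> Y N = Y D -> N = D;
  sd_gen3 : forall M N P, on_edges Ed M -> on_edges Ed N -> on_edges Ed P ->
    X M = X N -> Y M = Y N -> X M = X P -> Y M = Y P -> M <> N -> P = M \/ P = N;
  sd_lim : forall N, on_edges Ed N -> 0 < Z N -> T (X N) (Y N) ->
    (forall N', ~ above F Ed N N') -> exists k, Lim Ed c N k;
  sd_jump : forall U W N N', Ed U W -> interior U W N -> 0 < Z N -> T (X N) (Y N) ->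
    above F Ed N N' ->
    exists v w k, [/\ lim c N U v, lim c N W w, Lim Ed c N' k & v + w = k + k];
  sd_lim_end : forall D, D = A \/ D = B -> exists k, Lim Ed c D k }.

Hypothesis H : shadow_data.

Lemma in_edgesC U W : Ed U W -> Ed W U.
Proof. by case=> h; [right|left]. Qed.

Lemma Lim_uniq N k k' : on_edges Ed N -> Lim Ed c N k -> Lim Ed c N k' -> k = k'.
Proof.
move=> [U [W [e s]]] L L'.
have [nU|/eqP nU] := eqVneq U N; last exact: lim_uniq (L _ _ e s nU) (L' _ _ e s nU).
have nW : W <> N.
  by move=> eW; case: (sd_pd H e) => h; apply: h; rewrite nU eW.
exact: lim_uniq (L _ _ (in_edgesC e) (segmentC s) nW) (L' _ _ (in_edgesC e) (segmentC s) nW).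
Qed.

(** An edge that avoids the closed upper half-line over [x] also avoids those over nearby points
    ([not_over_nb]). Height zero is included because an edge may start at [A] or [B] and rise from
    there. *)
Lemma strands_nb x1 x2 (P : pt -> pt -> Prop) :
  (forall U W N, Ed U W -> segment U W N -> X N = x1 -> Y N = x2 -> 0 <= Z N -> P U W) ->
  nb x1 x2 (fun y1 y2 => forall N, strand y1 y2 N ->
    exists U W, [/\ Ed U W, P U W & segment U W N]).
Proof.
move=> HP.
have : nb x1 x2 (fun y1 y2 => forall e, e \in E0 -> P e.1 e.2 \/
    forall N, segment e.1 e.2 N -> X N = y1 -> Y N = y2 -> Z N < 0).
  apply: nb_all => -[U W] eE /=.
  have [p|np] := pselect (P U W); first by apply: nbT; left.
  have eE' : Ed U W by left.
  have := @not_over_nb _ F U W x1 x2 (sd_pd H eE').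
  case=> [N s e1 e2|d dp Hd]; last by exists d => // y1 y2 h1 h2; right; exact: Hd.
  by rewrite ltNge; apply/negP => z; apply: np; exact: HP eE' s e1 e2 z.
apply: nb_sub => y1 y2 h N [[U [W [[e|e] s]]] e1 e2 z].
  case: (h _ e) => /= [p|n]; first by exists U, W; split=> //; left.
  by move: (n N s e1 e2); rewrite ltNge (ltW z).
case: (h _ e) => /= [p|n].
  by exists W, U; split=> //; [left|exact: segmentC].
by move: (n N (segmentC s) e1 e2); rewrite ltNge (ltW z).
Qed.

(** Nothing is asked where strands cross or a strand turns: the models below take care of these
    points. The two exceptional points are the projections of [A] and [B]. *)
Definition rule (y1 y2 : R) (b : R -> R -> V) : Prop :=
  ((y1, y2) <> (0, 0) -> (y1, y2) <> (1, 0) -> (forall N, ~ strand y1 y2 N) ->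
     nb y1 y2 (fun z1 z2 => T z1 z2 -> b z1 z2 = b y1 y2)) /\
  (forall U W N k, Ed U W -> interior U W N -> strand y1 y2 N ->
     (forall N', strand y1 y2 N' -> N' = N) -> Lim Ed c N k ->
     nb y1 y2 (fun z1 z2 => T z1 z2 -> b z1 z2 =
       if side F U W z1 z2 == side F U W y1 y2 then b y1 y2 else k + k - b y1 y2)).

(** The points where [rule] determines a function nearby from its value there. *)
Definition regular (y1 y2 : R) : Prop :=
  [/\ (y1, y2) <> (0, 0), (y1, y2) <> (1, 0) & (forall N, ~ strand y1 y2 N) \/
   exists U W N k, [/\ Ed U W, interior U W N, strand y1 y2 N,
     (forall N', strand y1 y2 N' -> N' = N) & Lim Ed c N k]].

Lemma rule_none y1 y2 : (forall N, ~ strand y1 y2 N) ->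
  ((y1, y2) <> (0, 0) -> (y1, y2) <> (1, 0) -> regular y1 y2) /\
  forall b, nb y1 y2 (fun z1 z2 => T z1 z2 -> b z1 z2 = b y1 y2) -> rule y1 y2 b.
Proof.
move=> n; split=> [h1 h2|b h]; first by split=> //; left.
by split=> [//|U W N k _ _ /n].
Qed.

(** By [sd_simple] an interior point lies on one edge up to orientation, and reversal negates both
    sides, leaving their comparison unchanged. So it is enough to test one orientation. *)
Lemma rule_one y1 y2 P Q M k : T y1 y2 -> Ed P Q -> interior P Q M -> strand y1 y2 M ->
  (forall N', strand y1 y2 N' -> N' = M) -> (forall k', Lim Ed c M k' -> k' = k) ->
  ((y1, y2) <> (0, 0) -> (y1, y2) <> (1, 0) -> regular y1 y2) /\
  forall b, nb y1 y2 (fun z1 z2 => T z1 z2 -> b z1 z2 =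
    if side F P Q z1 z2 == side F P Q y1 y2 then b y1 y2 else k + k - b y1 y2) -> rule y1 y2 b.
Proof.
move=> Ty e i s u Hk; split=> [h1 h2|b h]; last first.
  split=> [_ _ /(_ _ s) //|U W N k' e' i' s' u' L].
  have NM := u _ s'; rewrite NM in i' L; rewrite (Hk _ L).
  have [sM _ _] := i'.
  case: (sd_simple H e e' i sM) => [[<- <-] //|[eU eW]].
  apply: nb_sub h => z1 z2 h Tz; rewrite h // -eU -eW.
  by rewrite !(sideC (U := P) (W := Q)) ?(inj_eq negb_inj) //; exact: sd_pd e.
have [oM XM YM ZM] := s.
split=> //; right; exists P, Q, M, k.
have TM : T (X M) (Y M) by rewrite XM YM.
have [N' [oN eX eY zN]|k' L] := sd_lim H oM ZM TM.
  have := u N'; rewrite /strand eX eY XM YM.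
  by move=> /(_ (And4 oN erefl erefl (lt_trans ZM zN))) eN; move: zN; rewrite eN ltxx.
by split=> //; rewrite -(Hk _ L).
Qed.

(** The case of height zero at [N] covers a strand that leaves an end [A] or [B] upwards: its germ
    is above the triangle although its origin is not. *)
Lemma ray_near P Q N k : Ed P Q -> segment P Q N -> N <> Q ->
  0 < Z N \/ (Z N = 0 /\ 0 < Z Q) -> lim c N Q k ->
  exists2 e : R, 0 < e & forall s, 0 < s -> s < e ->
    [/\ interior P Q (segment_pt N Q s), 0 < Z (segment_pt N Q s) &
        forall k', Lim Ed c (segment_pt N Q s) k' -> k' = k].
Proof.
move=> e sN NQ zN L; have pd := sd_pd H e.
have [e1 e10 He1] : exists2 e1 : R, 0 < e1 & forall s, 0 < s -> s < e1 ->
    0 < Z (segment_pt N Q s).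
  case: zN => [zN|[zN zQ]].
    have [e1 e10 He1] := small_pos (Z Q) zN.
    by exists e1 => // s s0 s1; rewrite affZ He1.
  by exists 1 => // s s0 s1; rewrite affZ zN mulr0 add0r mulr_gt0.
have [||d dp Hd] := @lim_right _ _ c N Q 0 k; rewrite ?segment_pt0 //.
pose m := Num.min e1 (Num.min d 1).
have [m1 m2 m3] : [/\ m <= e1, m <= d & m <= 1].
  by rewrite /m !ge_min !lexx !orbT.
exists m; first by rewrite /m !lt_min e10 dp ltr01.
move=> s s0 sm; have s1 : s < 1 by exact: lt_le_trans sm m3.
have iM : interior P Q (segment_pt N Q s).
  by apply: (ray_interior pd) => //; rewrite s0.
split=> //; first by apply: He1 => //; exact: lt_le_trans sm m1.
move=> k' L'; have [sM _ MQ] := iM.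
have := L' _ _ (in_edgesC e) (segmentC sM) (nesym MQ).
move=> L1; apply: (lim_uniq L1); apply: (@right_lim R V c N Q s (d - s) k) => //; first lra.
by move=> r h1 h2; apply: Hd; lra.
Qed.

(** Reflecting twice in [k] is the identity, so only the change of side matters; the bit [sg]
    absorbs the orientation of the line. *)
Lemma refl_rule (y1 y2 : R) (k u : V) (b0 sg : bool) (s ins : R -> R -> bool) :
  nb y1 y2 (fun z1 z2 => ins z1 z2 = s z1 z2 (+) sg) ->
  nb y1 y2 (fun z1 z2 => T z1 z2 -> (if ins z1 z2 == b0 then u else k + k - u) =
    if s z1 z2 == s y1 y2 then (if ins y1 y2 == b0 then u else k + k - u)
    else k + k - (if ins y1 y2 == b0 then u else k + k - u)).
Proof.
move=> h; have e := nb_self h; apply: nb_sub h => z1 z2 -> _; rewrite e {e}.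
by case: (s z1 z2); case: (s y1 y2); case: sg; case: b0 => //=; ring.
Qed.

(** A transport law from [x]: [t z1 z2 u] continues the colour [u] at [x] to the point [z]. All
    other points of the triangle close to [x] are regular, so [rule] pins the law down there. The
    last two clauses keep a constant colouring constant and describe the shadow near the ends of the
    path. *)
Definition model (x1 x2 : R) (t : R -> R -> V -> V) : Prop :=
  [/\ forall u, t x1 x2 u = u,
      (forall z1 z2 u w, t z1 z2 u = t z1 z2 w -> u = w) /\
        (forall z1 z2 w, exists u, t z1 z2 u = w),
      nb x1 x2 (fun y1 y2 => T y1 y2 -> ((y1, y2) = (x1, x2) \/ regular y1 y2) /\
        forall u, rule y1 y2 (fun z1 z2 => t z1 z2 u)),
      (forall v0, (forall U W N v, Ed U W -> segment U W N -> U <> N -> 0 <= Z N ->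
         T (X N) (Y N) -> lim c N U v -> v = v0) -> forall z1 z2, t z1 z2 v0 = v0) &
      (forall D k, D = A \/ D = B -> X D = x1 -> Y D = x2 -> Lim Ed c D k ->
         forall z1 z2 u, t z1 z2 u = u \/ t z1 z2 u = k + k - u)].

Lemma refl_bij (b : bool) (k : V) :
  (forall u w : V, (if b then u else k + k - u) = (if b then w else k + k - w) -> u = w) /\
  (forall w : V, exists u, (if b then u else k + k - u) = w).
Proof.
case: b; first by split=> // w; exists w.
split=> [u w /addrI /oppr_inj //|w]; exists (k + k - w); ring.
Qed.

Lemma A_or_B D : D = A \/ D = B ->
  [/\ (X D, Y D) = (0, 0) \/ (X D, Y D) = (1, 0), Z D = 0 & T (X D) (Y D)].
Proof.
have [xA yA zA] := sd_A H; have [xB yB zB] := sd_B H.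
case=> ->; rewrite ?xA ?yA ?zA ?xB ?yB ?zB; split=> //; try by [left|right].
  by split; lra.
by split; lra.
Qed.

Lemma model_none x1 x2 : T x1 x2 -> (x1, x2) <> (0, 0) -> (x1, x2) <> (1, 0) ->
  (forall N, ~ strand x1 x2 N) -> exists t, model x1 x2 t.
Proof.
move=> Tx xA xB n; exists (fun _ _ u => u); split=> //; last by left.
  by split=> // _ _ w; exists w.
have : nb x1 x2 (fun y1 y2 => forall N, strand y1 y2 N ->
    exists U W, [/\ Ed U W, False & segment U W N]).
  apply: strands_nb => U W N e s eX eY; rewrite le_eqVlt => /orP[/eqP z|z].
    have eAB : N = A \/ N = B by apply: (sd_touch H e s); rewrite ?eX ?eY.
    by have [[|]] := A_or_B eAB; rewrite eX eY.
  by apply: (n N); split=> //; exists U, W.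
have := nb_and (nb_neq xA) (nb_neq xB); move=> h1 h2; move: (nb_and h1 h2).
apply: nb_sub => y1 y2 [[yA yB] h] Ty.
have n' N : ~ strand y1 y2 N by move=> /h[U [W []]].
have [rg rl] := rule_none n'.
by split; [right; exact: rg|move=> u; apply: rl; exact: nbT].
Qed.

(* [N] is a point above [x], interior to an edge or a vertex; in both cases the
   strand leaves [N] along two rays, towards [Q1] and [Q2]. *)
Lemma model_star x1 x2 N P1 Q1 P2 Q2 k :
  T x1 x2 -> (x1, x2) <> (0, 0) -> (x1, x2) <> (1, 0) ->
  strand x1 x2 N -> (forall N', strand x1 x2 N' -> N' = N) -> Lim Ed c N k ->
  Ed P1 Q1 -> segment P1 Q1 N -> N <> Q1 ->
  Ed P2 Q2 -> segment P2 Q2 N -> N <> Q2 ->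
  (forall U W M, Ed U W -> segment U W N -> segment U W M ->
     exists2 s : R, 0 <= s & M = segment_pt N Q1 s \/ M = segment_pt N Q2 s) ->
  0 <= lform F N Q1 (X Q2) (Y Q2) ->
  (lform F N Q1 (X Q2) (Y Q2) = 0 -> exists2 m : R, 0 < m &
     X Q2 = X N - m * (X Q1 - X N) /\ Y Q2 = Y N - m * (Y Q1 - Y N)) ->
  (forall U W, Ed U W -> interior U W N -> lform F N Q1 (X Q2) (Y Q2) = 0 /\
     exists sg, forall z1 z2, side F N Q1 z1 z2 = side F U W z1 z2 (+) sg) ->
  exists t, model x1 x2 t.
Proof.
move=> Tx xA xB sN uN L E1 s1 n1 E2 s2 n2 cover D0 opp flatN.
have [oN XN YN ZN] := sN.
have pd1 := sd_pd H E1; have pd2 := sd_pd H E2.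
have pn1 := planar_neq_sub pd1 s1 n1; have pn2 := planar_neq_sub pd2 s2 n2.
have [e1 e10 He1] := ray_near E1 s1 n1 (or_introl ZN) (L _ _ (in_edgesC E1) (segmentC s1) (nesym n1)).
have [e2 e20 He2] := ray_near E2 s2 n2 (or_introl ZN) (L _ _ (in_edgesC E2) (segmentC s2) (nesym n2)).
set Dt := lform F N Q1 (X Q2) (Y Q2) in D0 opp flatN *.
(* The wedge between the two rays. By [D0] its angle is at most a half turn, so it is an
   intersection of two half-planes; for opposite rays these coincide. *)
pose ins z1 z2 := side F N Q1 z1 z2 && side F Q2 N z1 z2.
have flat_ins : Dt = 0 -> forall z1 z2, ins z1 z2 = side F N Q1 z1 z2.
  move=> /opp [m m0 [eX eY]] z1 z2.
  rewrite /ins (@side_scale _ F N Q1 Q2 N m) ?andbb //.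
  - by rewrite eX; ring.
  - by rewrite eY; ring.
  - by rewrite eX eY /lform; ring.
exists (fun z1 z2 u => if ins z1 z2 == ins x1 x2 then u else k + k - u); split.
- by move=> u; rewrite eqxx.
- by split=> z1 z2; have [] := refl_bij (ins z1 z2 == ins x1 x2) k.
- have c1 : ecoord F N Q1 x1 x2 = 0 by rewrite /ecoord -XN -YN !subrr !mul0r addr0 mul0r.
  have c2 : ecoord F N Q2 x1 x2 = 0 by rewrite /ecoord -XN -YN !subrr !mul0r addr0 mul0r.
  have near1 : nb x1 x2 (fun y1 y2 => ecoord F N Q1 y1 y2 < e1).
    by apply: affine_lt; [exact: affine_ecoord|rewrite c1].
  have near2 : nb x1 x2 (fun y1 y2 => ecoord F N Q2 y1 y2 < e2).
    by apply: affine_lt; [exact: affine_ecoord|rewrite c2].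
  have near4 : nb x1 x2 (fun y1 y2 => forall N', strand y1 y2 N' ->
      exists U W, [/\ Ed U W, segment U W N & segment U W N']).
    apply: (strands_nb (P := fun U W => segment U W N)) => U W M e s eX eY.
    rewrite le_eqVlt => /orP[/eqP z|z].
      have eAB : M = A \/ M = B by apply: (sd_touch H e s); rewrite ?eX ?eY.
      by have [[|]] := A_or_B eAB; rewrite eX eY.
    by rewrite -(uN M) //; split=> //; exists U, W.
  have := nb_and (nb_and near1 near2) (nb_and near4 (nb_and (nb_neq xA) (nb_neq xB))).
  apply: nb_sub => y1 y2 [[k1 k2] [cov [yA yB]]] Ty.
  have [[ey1 ey2]|/eqP nyx] := eqVneq (y1, y2) (x1, x2).
    split; first by left; rewrite ey1 ey2.
    rewrite ey1 ey2 => u; split=> [_ _ /(_ _ sN) //|U W N' k' eE iN sN' uN' L'].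
    have eN := uN _ sN'; rewrite eN in iN L' uN'.
    have -> : k' = k by exact: Lim_uniq oN L' L.
    have [Dt0 [sg Hsg]] := flatN U W eE iN.
    apply: (@refl_rule _ _ _ _ _ sg).
    by apply: nbT => z1 z2; rewrite flat_ins.
  have pnQ (i : bool) : planar_neq F N (if i then Q1 else Q2) by case: i.
  have NM i (Q := if i : bool then Q1 else Q2) (kap := ecoord F N Q y1 y2) :
      lform F N Q y1 y2 = 0 ->
      X (segment_pt N Q kap) = y1 /\ Y (segment_pt N Q kap) = y2.
    exact: lform_eq0 (pnQ i).
  have kap0 i (Q := if i : bool then Q1 else Q2) (kap := ecoord F N Q y1 y2) :
      lform F N Q y1 y2 = 0 -> kap <> 0.
    move=> /NM; rewrite -/Q -/kap => -[eX eY] kap0; apply: nyx.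
    by rewrite -eX -eY kap0 segment_pt0 XN YN.
  (* [on i] says that [y] lies on the projection of the open half-line from [N] towards [Q1] or
     [Q2]. *)
  pose on i := let Q := if i : bool then Q1 else Q2 in
    lform F N Q y1 y2 = 0 /\ 0 < ecoord F N Q y1 y2.
  have strand_on N' : strand y1 y2 N' -> exists i, on i /\
      N' = segment_pt N (if i then Q1 else Q2) (ecoord F N (if i then Q1 else Q2) y1 y2).
    move=> sN'; have [U [W [eE seg seg']]] := cov _ sN'.
    have [_ XN' YN' _] := sN'.
    have [s s0 HN'] := cover _ _ _ eE seg seg'.
    have [i ei] : exists i : bool, N' = segment_pt N (if i then Q1 else Q2) s.
      by case: HN' => ->; [exists true|exists false].
    exists i; rewrite /on; set Q := if i then Q1 else Q2.
    have pn := pnQ i.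
    have [l0 es] := lform_segment (z1 := y1) (z2 := y2) pn (etrans (congr1 X (esym ei)) XN')
       (etrans (congr1 Y (esym ei)) YN').
    split; last by rewrite -es.
    split=> //; rewrite lt_neqAle -es s0 andbT; apply/eqP => s00.
    by apply: (kap0 i l0); rewrite -es.
  have not_both : on true -> on false -> False.
    move=> [l1 p1] [l2 p2]; have [a1 b1] := NM true l1; have [a2 b2] := NM false l2.
    move: a1 b1 a2 b2 p1 p2 => /=; set p := ecoord F N Q1 y1 y2; set q := ecoord F N Q2 y1 y2.
    rewrite !affX !affY => a1 b1 a2 b2 p0 q0.
    have Dt0 : Dt = 0.
      have : q * Dt = 0.
        transitivity ((X Q1 - X N) * (q * (Y Q2 - Y N)) - (Y Q1 - Y N) * (q * (X Q2 - X N))).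
          by rewrite /Dt /lform; ring.
        have -> : q * (Y Q2 - Y N) = p * (Y Q1 - Y N) by lra.
        have -> : q * (X Q2 - X N) = p * (X Q1 - X N) by lra.
        ring.
      by move/eqP; rewrite mulf_eq0 gt_eqF //= => /eqP.
    have [m m0 [eX eY]] := opp Dt0.
    have pm : 0 < p + q * m by apply: addr_gt0 p0 (mulr_gt0 q0 m0).
    have pm0 : p + q * m != 0 by rewrite gt_eqF.
    rewrite eX in a2; rewrite eY in b2.
    by case: pn1 => h; apply: h; apply: (mulfI pm0); [clear -a1 a2|clear -b1 b2]; lra.
  (* Under a single ray, the wedge agrees near [y] with a side of that ray up to orientation. *)
  have finish i (P := if i : bool then P1 else P2) (Q := if i then Q1 else Q2) sg :
      on i -> nb y1 y2 (fun z1 z2 => ins z1 z2 = side F N Q z1 z2 (+) sg) ->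
      ((y1, y2) = (x1, x2) \/ regular y1 y2) /\
      forall u, rule y1 y2 (fun z1 z2 => if ins z1 z2 == ins x1 x2 then u else k + k - u).
    move=> oni ni; have [l0 p0] := oni; have [eX eY] := NM i l0.
    pose M := segment_pt N Q (ecoord F N Q y1 y2).
    have [iM zM kM] : [/\ interior P Q M, 0 < Z M & forall k', Lim Ed c M k' -> k' = k].
      by rewrite /M /P /Q; case: (i) p0 => p0; [exact: He1|exact: He2].
    have eE : Ed P Q by rewrite /P /Q; case: (i).
    have sM : strand y1 y2 M.
      by split=> //; exists P, Q; split=> //; case: iM.
    have uM N' : strand y1 y2 N' -> N' = M.
      move=> /strand_on [j [onj ->]]; rewrite /M /Q.
      by case: (i) (j) oni onj => -[] // oni onj; exfalso; apply: not_both.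
    have [rg rl] := rule_one Ty eE iM sM uM kM.
    split=> [|u]; first by right; exact: rg.
    apply: rl; apply: (@refl_rule _ _ _ _ _ sg); apply: nb_sub ni => z1 z2 ->.
    by rewrite /P /Q; case: (i); [rewrite (side_sub _ _ pd1 s1 n1)|rewrite (side_sub _ _ pd2 s2 n2)].
  have aux1 (p : R) : X (segment_pt N Q1 p) = y1 -> Y (segment_pt N Q1 p) = y2 ->
      lform F Q2 N y1 y2 = p * Dt.
    by rewrite affX affY => <- <-; rewrite /Dt /lform; ring.
  have aux2 (p : R) : X (segment_pt N Q2 p) = y1 -> Y (segment_pt N Q2 p) = y2 ->
      lform F N Q1 y1 y2 = p * Dt.
    by rewrite affX affY => <- <-; rewrite /Dt /lform; ring.
  have [on1|off1] := pselect (on true).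
    apply: (finish true false) => //; have [l0 p0] := on1; have [eX eY] := NM true l0.
    rewrite /= in l0 p0 eX eY *.
    have [Dt0|/eqP Dtn] := eqVneq Dt 0.
      by apply: nbT => z1 z2; rewrite flat_ins // addbF.
    have e' := aux1 _ eX eY.
    have l2 : 0 < lform F Q2 N y1 y2.
      by rewrite e' mulr_gt0 // lt_neqAle D0 andbT; apply/eqP => h; exact: Dtn.
    have := side_nb (elimN eqP (lt0r_neq0 l2)).
    by apply: nb_sub => z1 z2; rewrite /ins addbF => ->; rewrite /side l2 andbT.
  have [on2|off2] := pselect (on false).
    apply: (finish false true) => //; have [l0 p0] := on2; have [eX eY] := NM false l0.
    rewrite /= in l0 p0 eX eY *.
    have sC z1 z2 : side F Q2 N z1 z2 = side F N Q2 z1 z2 (+) true.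
      by rewrite addbT sideC.
    have [Dt0|/eqP Dtn] := eqVneq Dt 0.
      have [m m0 [mX mY]] := opp Dt0.
      have sS z1 z2 : side F Q2 N z1 z2 = side F N Q1 z1 z2.
        apply: (@side_scale _ F N Q1 Q2 N m) => //.
        - by rewrite mX; ring.
        - by rewrite mY; ring.
      by apply: nbT => z1 z2; rewrite flat_ins // -sC sS.
    have e' := aux2 _ eX eY.
    have l2 : 0 < lform F N Q1 y1 y2.
      by rewrite e' mulr_gt0 // lt_neqAle D0 andbT; apply/eqP => h; exact: Dtn.
    have := side_nb (elimN eqP (lt0r_neq0 l2)).
    by apply: nb_sub => z1 z2; rewrite /ins sC => ->; rewrite /side l2.
  have none N' : ~ strand y1 y2 N' by move=> /strand_on [[] []].
  have [rg rl] := rule_none none.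
  split=> [|u]; first by right; exact: rg.
  apply: rl; suff : nb y1 y2 (fun z1 z2 => ins z1 z2 = ins y1 y2).
    by apply: nb_sub => z1 z2 -> _.
  (* Under neither ray the wedge is locally constant. The delicate points lie on the backward
     extension of one ray, where the other half-plane excludes a whole neighbourhood. *)
  have [l1|/eqP l1] := eqVneq (lform F N Q1 y1 y2) 0.
    have p1 : ecoord F N Q1 y1 y2 < 0.
      rewrite lt_neqAle leNgt; apply/andP; split; first by apply/eqP; exact: (kap0 true).
      by apply/negP => p; apply: off1.
    have [eX eY] := NM true l1; rewrite /= in eX eY.
    have [Dt0|/eqP Dtn] := eqVneq Dt 0.
      case: off2; have [m m0 [mX mY]] := opp Dt0.
      set p := ecoord F N Q1 y1 y2 in p1 eX eY.
      have [||l2 ec] := @lform_segment _ F N Q2 (- p / m) y1 y2 pn2.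
      - by rewrite affX mX -eX affX; field; exact: lt0r_neq0.
      - by rewrite affY mY -eY affY; field; exact: lt0r_neq0.
      by split=> //=; rewrite -ec divr_gt0 // oppr_gt0.
    have e' := aux1 _ eX eY.
    have l2 : lform F Q2 N y1 y2 < 0.
      by rewrite e' nmulr_rlt0 // lt_neqAle D0 andbT; apply/eqP => h; exact: Dtn.
    have := side_nb (elimN eqP (ltr0_neq0 l2)).
    apply: nb_sub => z1 z2; rewrite /ins => ->.
    by rewrite [side F Q2 N _ _]/side ltNge (ltW l2) (lt_eqF l2) !andbF.
  have [l2|/eqP l2] := eqVneq (lform F N Q2 y1 y2) 0.
    have p1 : ecoord F N Q2 y1 y2 < 0.
      rewrite lt_neqAle leNgt; apply/andP; split; first by apply/eqP; exact: (kap0 false).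
      by apply/negP => p; apply: off2.
    have [eX eY] := NM false l2; rewrite /= in eX eY.
    have e' := aux2 _ eX eY.
    have l3 : lform F N Q1 y1 y2 < 0.
      rewrite e' nmulr_rlt0 // lt_neqAle D0 andbT; apply/eqP => h.
      by apply: l1; rewrite e' -h mulr0.
    have := side_nb l1.
    apply: nb_sub => z1 z2; rewrite /ins => ->.
    by rewrite [side F N Q1 _ _]/side ltNge (ltW l3) (lt_eqF l3) /= .
  have l2' : lform F Q2 N y1 y2 <> 0 by rewrite lformC => /eqP; rewrite oppr_eq0 => /eqP.
  by apply: nb_sub (nb_and (side_nb l1) (side_nb l2')) => z1 z2 [a b]; rewrite /ins a b.
- move=> v0 Hv z1 z2; have -> : k = v0.
    have := L _ _ (in_edgesC E1) (segmentC s1) (nesym n1).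
    apply: Hv => //; [exact: in_edgesC E1|exact: segmentC|exact: nesym|exact: ltW|].
    by rewrite XN YN.
  by case: ifP => // _; ring.
- move=> D kD eD eX eY _.
  by have [[|]] := A_or_B eD; rewrite eX eY.
Qed.

(** The limits at [N] hold on an interval to each side, so nearby points of the same strand carry
    [v] before [N] and [w] after it. *)
Lemma line_near x1 x2 U W N v w : Ed U W -> interior U W N -> strand x1 x2 N ->
  lim c N U v -> lim c N W w ->
  nb x1 x2 (fun y1 y2 => lform F U W y1 y2 = 0 ->
    let s := ecoord F U W y1 y2 in let M := segment_pt U W s in
    [/\ interior U W M, strand y1 y2 M & forall k', Lim Ed c M k' ->
        (s < ecoord F U W x1 x2 -> k' = v) /\ (ecoord F U W x1 x2 < s -> k' = w)]).
Proof.
move=> e iN [oN XN YN ZN] Lv Lw; have pd := sd_pd H e.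
have [t /andP[t0 t1] eN] := interiorP pd iN; subst N.
have [l0 et] := lform_segment pd XN YN.
have [d1 d10 H1] := lim_left t0 Lv; have [d2 d20 H2] := lim_right t1 Lw.
have [a [b [a' ea]]] := affine_ecoord F U W.
have az : affine (fun y1 y2 => Z (segment_pt U W (ecoord F U W y1 y2))).
  exists ((Z W - Z U) * a), ((Z W - Z U) * b), ((Z W - Z U) * a' + Z U) => y1 y2.
  by rewrite affZ ea; ring.
have n1 := affine_pos (x1 := x1) (x2 := x2) az; rewrite -et in n1.
have n2 (r : R) : r < t -> nb x1 x2 (fun y1 y2 => r < ecoord F U W y1 y2).
  by rewrite et => /(affine_gt (affine_ecoord F U W)).
have n3 (r : R) : t < r -> nb x1 x2 (fun y1 y2 => ecoord F U W y1 y2 < r).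
  by rewrite et => /(affine_lt (affine_ecoord F U W)).
have h1 : t - d1 < t by lra.
have h2 : t < t + d2 by lra.
have := nb_and (n1 ZN) (nb_and (nb_and (n2 _ t0) (n3 _ t1)) (nb_and (n2 _ h1) (n3 _ h2))).
apply: nb_sub => y1 y2 [zM [[s0 s1] [s2 s3]]] l; rewrite -et.
set s := ecoord F U W y1 y2 in zM s0 s1 s2 s3 *.
have iM : interior U W (segment_pt U W s) by apply: (interior_pt pd); rewrite s0 s1.
have [sM MU MW] := iM; have [eX eY] := lform_eq0 pd l.
split=> //; first by split=> //; exists U, W.
move=> k' L; split=> st.
  apply: (lim_uniq (L _ _ (in_edgesC e) (segmentC sM) (nesym MW))).
  apply: (@right_lim R V c U W s (t - s) v) => //; first by rewrite subr_gt0.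
  by move=> r r1 r2; apply: H1; lra.
apply: (lim_uniq (L _ _ e sM (nesym MU))).
apply: (@left_lim R V c U W s (s - t) w) => //; first by rewrite subr_gt0.
by move=> r r1 r2; apply: H2; lra.
Qed.

Lemma Lim_interior U W N k : Ed U W -> interior U W N -> Lim Ed c N k ->
  lim c N U k /\ lim c N W k.
Proof.
move=> e [sN nU nW] L; split; first by apply: L e sN (nesym nU).
exact: L (in_edgesC e) (segmentC sN) (nesym nW).
Qed.

(** Going round the crossing both ways gives the same colour: reflecting in [k] and then in the
    lower colour on the far side equals reflecting in the lower colour on the near side and then in
    [k], because the two lower colours add up to [k + k]. *)
Lemma model_cross x1 x2 N1 N2 U1 W1 U2 W2 :
  T x1 x2 -> (x1, x2) <> (0, 0) -> (x1, x2) <> (1, 0) ->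
  strand x1 x2 N1 -> strand x1 x2 N2 -> Z N2 < Z N1 ->
  (forall N', strand x1 x2 N' -> N' = N1 \/ N' = N2) ->
  Ed U1 W1 -> interior U1 W1 N1 -> Ed U2 W2 -> interior U2 W2 N2 ->
  cross U1 W1 U2 W2 <> 0 ->
  exists t, model x1 x2 t.
Proof.
move=> Tx xA xB s1 s2 Z21 u12 E1 i1 E2 i2 cr.
have [o1 X1 Y1 Z1] := s1; have [o2 X2 Y2 Z2] := s2.
have pd1 := sd_pd H E1; have pd2 := sd_pd H E2.
have ov : above F Ed N2 N1 by rewrite /above X1 X2 Y1 Y2.
have T2 : T (X N2) (Y N2) by rewrite X2 Y2.
have [v [w [k [Lv Lw Lk vwk]]]] := sd_jump H E2 i2 Z2 T2 ov.
have [Lk1 Lk2] := Lim_interior E1 i1 Lk.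
have near1 := line_near E1 i1 s1 Lk1 Lk2.
have near2 := line_near E2 i2 s2 Lv Lw.
have [t1 t1i eN1] := interiorP pd1 i1; have [t2 t2i eN2] := interiorP pd2 i2.
have [l10 et1] : lform F U1 W1 x1 x2 = 0 /\ t1 = ecoord F U1 W1 x1 x2.
  by apply: lform_segment => //; rewrite -eN1.
have [l20 et2] : lform F U2 W2 x1 x2 = 0 /\ t2 = ecoord F U2 W2 x1 x2.
  by apply: lform_segment => //; rewrite -eN2.
rewrite -et1 in near1; rewrite -et2 in near2.
pose g := lform F U1 W1 (X U2) (Y U2).
have eg (s : R) : lform F U1 W1 (X (segment_pt U2 W2 s)) (Y (segment_pt U2 W2 s)) =
    g + s * cross U1 W1 U2 W2.
  by rewrite affX affY /g /lform /cross; ring.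
have g0 : g = - t2 * cross U1 W1 U2 W2.
  by have := eg t2; rewrite -eN2 X2 Y2 l10 => e; lra.
set C := cross U1 W1 U2 W2 in cr eg g0.
move/andP: t2i => [t20 t21].
have gn : g <> 0 by rewrite g0 => /eqP; rewrite mulf_eq0 oppr_eq0 (gt_eqF t20) /= => /eqP.
pose sU := 0 < g.
(* The colour of the lower strand on the side [b] of the upper one; [sU] is the side of [U2]. *)
pose cg (b : bool) : V := if b == sU then v else w.
have cgN b b' : b' != b -> cg b' = k + k - cg b.
  by rewrite /cg -vwk; case: (b) (b') => -[]; case: (sU) => //= _; ring.
pose S1 := side F U1 W1; pose S2 := side F U2 W2.
(* The lower strand is crossed first, with the colour it has on the side of [x], and then the upper
   one. *)
exists (fun z1 z2 u =>
  let u1 := if S2 z1 z2 == S2 x1 x2 then u else cg (S1 x1 x2) + cg (S1 x1 x2) - u in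
  if S1 z1 z2 == S1 x1 x2 then u1 else k + k - u1); split.
- by move=> u; rewrite !eqxx.
- split=> z1 z2 /=.
    move=> u u'; have [inj1 _] := refl_bij (S1 z1 z2 == S1 x1 x2) k.
    have [inj2 _] := refl_bij (S2 z1 z2 == S2 x1 x2) (cg (S1 x1 x2)).
    by move=> /inj1 /inj2.
  move=> u; have [_ /(_ u) [u1 <-]] := refl_bij (S1 z1 z2 == S1 x1 x2) k.
  have [_ /(_ u1) [u2 <-]] := refl_bij (S2 z1 z2 == S2 x1 x2) (cg (S1 x1 x2)).
  by exists u2.
- have near3 : nb x1 x2 (fun y1 y2 => forall N', strand y1 y2 N' -> exists U W,
      [/\ Ed U W, (U = U1 /\ W = W1 \/ U = W1 /\ W = U1) \/
                  (U = U2 /\ W = W2 \/ U = W2 /\ W = U2) & segment U W N']).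
    apply: strands_nb => U W M e s eX eY; rewrite le_eqVlt => /orP[/eqP z|z].
      have eAB : M = A \/ M = B by apply: (sd_touch H e s); rewrite ?eX ?eY.
      by have [[|]] := A_or_B eAB; rewrite eX eY.
    have sM : strand x1 x2 M by split=> //; exists U, W.
    case: (u12 M sM) => eM; rewrite eM in s.
      by left; case: (sd_simple H E1 e i1 s) => -[-> ->]; [left|right].
    by right; case: (sd_simple H E2 e i2 s) => -[-> ->]; [left|right].
  have := nb_and (nb_and near1 near2) (nb_and near3 (nb_and (nb_neq xA) (nb_neq xB))).
  apply: nb_sub => y1 y2 [[n1 n2] [n3 [yA yB]]] Ty.
  have cov N' : strand y1 y2 N' -> segment U1 W1 N' \/ segment U2 W2 N'.
    move=> /n3 [U [W [_ h s]]].
    case: h => -[] [eU eW]; rewrite eU eW in s; [left|left|right|right] => //; exact: segmentC.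
  have on_line U W N' : planar_neq F U W -> strand y1 y2 N' -> segment U W N' ->
      lform F U W y1 y2 = 0 /\ N' = segment_pt U W (ecoord F U W y1 y2).
    move=> pd [_ XN YN _] [s _ es]; rewrite -es in XN YN.
    by have [l es'] := lform_segment pd XN YN; rewrite -es'.
  (* Four cases: [y] is the projected crossing, lies on the upper line only, on the lower line only,
     or on neither. *)
  have [ly1|/eqP ly1] := eqVneq (lform F U1 W1 y1 y2) 0;
  have [ly2|/eqP ly2] := eqVneq (lform F U2 W2 y1 y2) 0.
  + have eyx : (y1, y2) = (x1, x2).
      have [eX eY] := lform_eq0 pd2 ly2.
      have := eg (ecoord F U2 W2 y1 y2); rewrite eX eY ly1 g0 => e.
      have : (ecoord F U2 W2 y1 y2 - t2) * C = 0 by rewrite mulrBl; lra.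
      move/eqP; rewrite mulf_eq0 (negbTE (introN eqP cr)) orbF subr_eq0 => /eqP e2.
      by move: eX eY; rewrite e2 -eN2 X2 Y2 => -> ->.
    split; first by left.
    case: eyx => -> -> u; split=> [_ _ /(_ _ s1) //|U W N k' _ _ _ u' _].
    by have := Z21; rewrite (u' N1 s1) (u' N2 s2) ltxx.
  + have [iM sM kM] := n1 ly1; set M := segment_pt _ _ _ in iM sM kM.
    have uM N' : strand y1 y2 N' -> N' = M.
      move=> sN'; case: (cov _ sN') => h; first by have [] := on_line _ _ _ pd1 sN' h.
      by have [/ly2] := on_line _ _ _ pd2 sN' h.
    have kM' k' : Lim Ed c M k' -> k' = k.
      move=> L; have [h1 h2] := kM _ L.
      have [/h1 //|/h2 //|es] := ltgtP (ecoord F U1 W1 y1 y2) t1.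
      have eM : M = N1 by rewrite /M es -eN1.
      by apply: Lim_uniq L _ => //; rewrite eM.
    have [rg rl] := rule_one Ty E1 iM sM uM kM'.
    split=> [|u]; first by right; exact: rg.
    apply: rl; have e2 := nb_self (side_nb ly2).
    apply: nb_sub (side_nb ly2) => z1 z2 h2 _ /=; rewrite /S2 h2 -/S1.
    set u1 := if _ then u else _.
    by case: (S1 z1 z2); case: (S1 y1 y2); case: (S1 x1 x2) => //=; ring.
  + have [iM sM kM] := n2 ly2; set M := segment_pt _ _ _ in iM sM kM.
    have uM N' : strand y1 y2 N' -> N' = M.
      move=> sN'; case: (cov _ sN') => h; last by have [] := on_line _ _ _ pd2 sN' h.
      by have [/ly1] := on_line _ _ _ pd1 sN' h.
    have [_ XM YM _] := sM.
    have ey : lform F U1 W1 y1 y2 = g + ecoord F U2 W2 y1 y2 * C by rewrite -eg XM YM.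
    have kM' k' : Lim Ed c M k' -> k' = cg (S1 y1 y2).
      move=> L; have [h1 h2] := kM _ L; rewrite /cg /S1 /side ey.
      set s := ecoord F U2 W2 y1 y2 in h1 h2 ey *.
      (* Before the crossing, the lower strand is on the same side of the upper line as [U2]. *)
      have eg2 : t2 * (g + s * C) = (t2 - s) * g by rewrite g0; ring.
      have sg : (0 < g + s * C) = (0 < (t2 - s) * g) by rewrite -eg2 pmulr_rgt0.
      have nz : (g + s * C == 0) = false by rewrite -ey; apply/eqP.
      rewrite nz orbF sg.
      have [st|st|es] := ltgtP s t2.
      - have p : 0 < t2 - s by rewrite subr_gt0.
        by rewrite (pmulr_rgt0 _ p) eqxx h1.
      - have p : t2 - s < 0 by rewrite subr_lt0.
        rewrite (nmulr_rgt0 _ p) h2 // /sU.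
        by case: (ltgtP g 0) => //= /gn.
      - by exfalso; apply: ly1; rewrite ey es g0; ring.
    have [rg rl] := rule_one Ty E2 iM sM uM kM'.
    split=> [|u]; first by right; exact: rg.
    apply: rl; apply: nb_sub (side_nb ly1) => z1 z2 h1 _ /=; rewrite /S1 h1 -/S1 -/S2.
    have [e1|n1'] := eqVneq (S1 y1 y2) (S1 x1 x2).
      rewrite e1; set q := cg _.
      by case: (S2 z1 z2); case: (S2 y1 y2); case: (S2 x1 x2) => //=; ring.
    rewrite (cgN _ _ n1'); set q := cg _.
    by case: (S2 z1 z2); case: (S2 y1 y2); case: (S2 x1 x2) => //=; ring.
  + have none N' : ~ strand y1 y2 N'.
      move=> sN'; case: (cov _ sN') => h; first by have [/ly1] := on_line _ _ _ pd1 sN' h.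
      by have [/ly2] := on_line _ _ _ pd2 sN' h.
    have [rg rl] := rule_none none.
    split=> [|u]; first by right; exact: rg.
    apply: rl; apply: nb_sub (nb_and (side_nb ly1) (side_nb ly2)) => z1 z2 [h1 h2] _.
    by rewrite /S1 /S2 h1 h2.
- move=> v0 Hv z1 z2 /=.
  have kv : k = v0.
    have [sg nU _] := i1.
    by apply: (Hv U1 W1 N1) Lk1; rewrite ?X1 ?Y1 ?(ltW Z1) //; exact: nesym.
  have [sg nU nW] := i2.
  have vv : v = v0 by apply: (Hv U2 W2 N2) Lv; rewrite ?X2 ?Y2 ?(ltW Z2) //; exact: nesym.
  have wv : w = v0.
    apply: (Hv W2 U2 N2) Lw; rewrite ?X2 ?Y2 ?(ltW Z2) //; last exact: nesym.
      exact: in_edgesC.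
    exact: segmentC.
  have -> : cg (S1 x1 x2) = v0 by rewrite /cg vv wv; case: ifP.
  by rewrite kv; case: (S1 z1 z2 == _); case: (S2 z1 z2 == _) => //; ring.
- move=> D kD eD eX eY _.
  by have [[|]] := A_or_B eD; rewrite eX eY.
Qed.

(** By [sd_end] at most one edge of [E0] leaves [D], at height zero. It reflects colours near [D]
    only if it rises and its projection points into the triangle; otherwise the transport is
    trivial. At [D] itself [rule] demands nothing. *)
Lemma model_end D : D = A \/ D = B -> exists t, model (X D) (Y D) t.
Proof.
move=> eD; have [eXY ZD TD] := A_or_B eD.
have [k L] := sd_lim_end H eD.
have onD U W N : Ed U W -> segment U W N -> X N = X D -> Y N = Y D -> N = D.
  by move=> e s; apply: (sd_gen_end H eD); exists U, W.
have none_D N : ~ strand (X D) (Y D) N.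
  by move=> [[U [W [e s]]] eX eY]; rewrite (onD U W N e s eX eY) ZD ltxx.
have near : nb (X D) (Y D) (fun y1 y2 => forall N', strand y1 y2 N' -> exists U W,
      [/\ Ed U W, U = D \/ W = D & segment U W N']).
  apply: strands_nb => U W M e s eX eY _.
  have eM := onD U W M e s eX eY; rewrite eM in s.
  by case: (sd_endpt H eD e s) => ->; [left|right].
have near' p1 p2 : nb (X D) (Y D) (fun y1 y2 => (y1, y2) <> (X D, Y D) ->
    (y1, y2) <> (p1, p2)).
  case: (eqVneq (X D, Y D) (p1, p2)) => [<-|/eqP n]; first exact: nbT.
  by apply: nb_sub (nb_neq n).
have {near} near : nb (X D) (Y D) (fun y1 y2 => forall N', strand y1 y2 N' -> exists U,
      Ed D U /\ segment D U N').
  apply: nb_sub near => y1 y2 h N' /h [U [W [e [eU|eW] s]]].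
    by exists W; rewrite -eU.
  by exists U; rewrite -eW; split; [exact: in_edgesC|exact: segmentC].
have ruleD b : rule (X D) (Y D) b.
  split=> [nA nB|U W N k' _ _ sN _ _]; last by case: (none_D N).
  by case: eXY.
have nonstrict N' U (y1 y2 : R) : Ed D U -> strand y1 y2 N' -> segment D U N' ->
    exists2 s : R, 0 < s <= 1 & [/\ N' = segment_pt D U s, 0 < Z U,
      lform F D U y1 y2 = 0 & s = ecoord F D U y1 y2].
  move=> e [_ eX eY zN] [s /andP[s0 s1] es]; subst N'.
  have [l0 es] := lform_segment (sd_pd H e) eX eY.
  have s0' : 0 < s.
    rewrite lt_neqAle s0 andbT; apply/eqP => s00.
    by move: zN; rewrite -s00 segment_pt0 ZD ltxx.
  exists s; first by rewrite s0'.
  by split=> //; move: zN; rewrite affZ ZD mulr0 add0r pmulr_rgt0.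
have [[U [e zU [kap kap0 Tkap]]]|nU] := pselect (exists U, [/\ Ed D U, 0 < Z U &
    exists2 kap : R, 0 < kap & T (X D + kap * (X U - X D)) (Y D + kap * (Y U - Y D))]).
- have pd := sd_pd H e.
  have nDU : D <> U by move=> eDU; move: zU; rewrite -eDU ZD ltxx.
  have LU := L _ _ (in_edgesC e) (segment_end U D) (nesym nDU).
  have [e1 e10 He1] := ray_near e (segment_start D U) nDU (or_intror (conj ZD zU)) LU.
  pose S := side F D U.
  exists (fun z1 z2 u => if S z1 z2 == S (X D) (Y D) then u else k + k - u); split.
  + by move=> u; rewrite eqxx.
  + by split=> z1 z2; have [] := refl_bij (S z1 z2 == S (X D) (Y D)) k.
  + have c0 : ecoord F D U (X D) (Y D) = 0 by rewrite /ecoord !subrr !mul0r addr0 mul0r.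
    have near1 : nb (X D) (Y D) (fun y1 y2 => ecoord F D U y1 y2 < e1).
      by apply: affine_lt; [exact: affine_ecoord|rewrite c0].
    have := nb_and (nb_and near near1) (nb_and (near' 0 0) (near' 1 0)).
    apply: nb_sub => y1 y2 [[n1 n2] [nA nB]] Ty.
    have [eyx|/eqP nyx] := eqVneq (y1, y2) (X D, Y D).
      split; first by left.
      by case: eyx => -> ->.
    have {}n1 N' : strand y1 y2 N' -> 0 < ecoord F D U y1 y2 /\
        (lform F D U y1 y2 = 0 /\ N' = segment_pt D U (ecoord F D U y1 y2)).
      move=> sN'; have [U' [e' s']] := n1 _ sN'.
      have eU : U' = U by apply: (sd_end H eD).
      rewrite eU in s'; have [s /andP[s0 _] [-> _ l0 <-]] := nonstrict _ _ _ _ e sN' s'.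
      by [].
    have [l0|/eqP l0] := eqVneq (lform F D U y1 y2) 0; last first.
      have none N' : ~ strand y1 y2 N' by move=> /n1 [_ [/l0]].
      have [rg rl] := rule_none none.
      split=> [|u]; first by right; apply: rg; [exact: nA|exact: nB].
      by apply: rl; apply: nb_sub (side_nb l0) => z1 z2; rewrite /S => ->.
    have [eX eY] := lform_eq0 pd l0; set s := ecoord F D U y1 y2 in n1 n2 eX eY.
    (* The triangle has a corner at [D]: two opposite directions cannot both point into it, so the
       backward half of the line is outside. *)
    have s0 : 0 < s.
      have sn : s <> 0.
        by move=> s00; apply: nyx; rewrite -eX -eY s00 segment_pt0.
      rewrite lt_neqAle eq_sym (introN eqP sn) leNgt; apply/negP => sneg.
      have [xA yA zA] := sd_A H; have [xB yB zB] := sd_B H.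
      move: eX eY Tkap Ty pd; rewrite affX affY /planar_neq.
      case: eD => ->; rewrite ?xA ?yA ?xB ?yB => <- <- [h1 h2 h3] [h4 h5 h6] h.
        have a1 : X U = 0 by nra.
        have a2 : Y U = 0 by nra.
        by case: h; rewrite ?a1 ?a2.
      have a2 : Y U = 0 by nra.
      have a1 : X U = 1 by rewrite a2 in h3 h6; nra.
      by case: h; rewrite ?a1 ?a2.
    have [iM zM kM] := He1 s s0 n2.
    have [sgM _ _] := iM.
    have sM : strand y1 y2 (segment_pt D U s) by split=> //; exists D, U.
    have uM N' : strand y1 y2 N' -> N' = segment_pt D U s by move=> /n1 [_ []].
    have [rg rl] := rule_one Ty e iM sM uM kM.
    split=> [|u]; first by right; apply: rg; [exact: nA|exact: nB].
    apply: rl; apply: (@refl_rule _ _ _ _ _ false); apply: nbT => z1 z2.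
    by rewrite addbF.
  + move=> v0 Hv z1 z2; have -> : k = v0.
      have T' : T (X D) (Y D) by [].
      apply: (Hv U D D) LU => //; [exact: in_edgesC|exact: segment_end|exact: nesym|].
      by rewrite ZD.
    by case: ifP => // _; ring.
  + move=> D' kD eD' eX eY LD' z1 z2 u.
    have [U' [W' [e' s']]] : on_edges Ed D by exists D, U; split=> //; exact: segment_start.
    have eDD : D' = D.
      apply: frame_inj eX eY _; rewrite ZD; by have [_ -> _] := A_or_B eD'.
    have -> : kD = k by rewrite eDD in LD'; apply: Lim_uniq LD' L; exists U', W'.
    by case: ifP => _; [left|right].
- exists (fun _ _ u => u); split=> //; last by left.
    by split=> // _ _ w; exists w.
  have := nb_and near (nb_and (near' 0 0) (near' 1 0)).
  apply: nb_sub => y1 y2 [n1 [nA nB]] Ty.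
  have [eyx|/eqP nyx] := eqVneq (y1, y2) (X D, Y D).
    split; first by left.
    by case: eyx => -> ->.
  have none N' : ~ strand y1 y2 N'.
    move=> sN'; have [U' [e' s']] := n1 _ sN'.
    have [s /andP[s0 _] [eN zU l0 es]] := nonstrict _ _ _ _ e' sN' s'.
    apply: nU; exists U'; split=> //; exists s => //.
    have [_ eX eY _] := sN'; move: eX eY; rewrite eN affX affY => eX eY.
    have -> : X D + s * (X U' - X D) = y1 by rewrite -eX; ring.
    by have -> : Y D + s * (Y U' - Y D) = y2 by rewrite -eY; ring.
  have [rg rl] := rule_none none.
  split=> [|u]; first by right; apply: rg; [exact: nA|exact: nB].
  by apply: rl; apply: nbT.
Qed.

End Shadow.

(** * Existence of the shadow on the whole triangle *)

Section ShadowExists.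
Variables (R : realType) (V : comNzRingType) (F : frame R).
Local Notation pt := 'rV[R]_3.
Local Notation X := (fX F).
Local Notation Y := (fY F).
Local Notation Z := (fZ F).
Local Notation T := (@std_triangle R).
Variables (A B : pt) (E0 : seq (pt * pt)) (c : pt -> V).
Local Notation Ed := (in_edges E0).
Hypothesis H : shadow_data F A B E0 c.
Local Notation strand := (strand F E0).
Local Notation model := (model F A B E0 c).

(** The case of two opposite rays, for which the wedge is a half-plane. *)
Lemma model_interior x1 x2 N k U W :
  T x1 x2 -> (x1, x2) <> (0, 0) -> (x1, x2) <> (1, 0) ->
  strand x1 x2 N -> (forall N', strand x1 x2 N' -> N' = N) -> Lim Ed c N k ->
  Ed U W -> interior U W N -> exists t, model x1 x2 t.
Proof.
move=> Tx xA xB sN uN L e iN; have pd := sd_pd H e.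
have [sg nU nW] := iN.
have [t /andP[t0 t1] eN] := interiorP pd iN.
have n1 : 1 - t != 0 by apply/eqP; lra.
have n0 : t != 0 by rewrite gt_eqF.
apply: (model_star H Tx xA xB sN uN L e sg nW (in_edgesC e) (segmentC sg) nU).
- move=> U' W' M e' s s'.
  have sM : segment U W M.
    by case: (sd_simple H e e' iN s) => -[-> ->] //; exact: segmentC.
  have [r /andP[r0 r1] <-] := sM.
  have [rt|rt] := leP t r.
    exists ((r - t) / (1 - t)); first by rewrite divr_ge0 //; lra.
    by left; rewrite eN segment_ptA divfK //; congr segment_pt; ring.
  exists ((t - r) / t); first by rewrite divr_ge0 //; lra.
  by right; rewrite eN segment_ptB divfK //; congr segment_pt; ring.
- by rewrite eN /lform !affX !affY le_eqVlt; apply/orP; left; apply/eqP; ring.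
- move=> _; exists (t / (1 - t)); first by rewrite divr_gt0 //; lra.
  by rewrite eN !affX !affY; split; field.
- move=> U' W' e' iN'; split; first by rewrite eN /lform !affX !affY; ring.
  have [sg' _ _] := iN'.
  case: (sd_simple H e e' iN sg') => -[<- <-].
    by exists false => z1 z2; rewrite addbF (side_sub _ _ pd sg nW).
  by exists true => z1 z2; rewrite addbT -(sideC _ _ (planar_neqC pd)) (side_sub _ _ pd sg nW).
Qed.

Lemma model_vertex x1 x2 N k U W :
  T x1 x2 -> (x1, x2) <> (0, 0) -> (x1, x2) <> (1, 0) ->
  strand x1 x2 N -> (forall N', strand x1 x2 N' -> N' = N) -> Lim Ed c N k ->
  Ed N U -> Ed N W -> U <> W -> (forall Q, Ed N Q -> Q = U \/ Q = W) ->
  (forall U' W', Ed U' W' -> ~ interior U' W' N) ->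
  0 <= lform F N U (X W) (Y W) -> exists t, model x1 x2 t.
Proof.
move=> Tx xA xB sN uN L eU eW UW only nint D0.
have pU := sd_pd H eU; have pW := sd_pd H eW.
have nU : N <> U by move=> e; case: pU; rewrite e.
have nW : N <> W by move=> e; case: pW; rewrite e.
apply: (model_star H Tx xA xB sN uN L eU (segment_start N U) nU eW (segment_start N W) nW) => //.
- move=> U' W' M e s s'.
  have [Q eQ sQ] : exists2 Q, Ed N Q & segment N Q M.
    have [eNU|nNU] := pselect (N = U'); first by exists W'; rewrite eNU.
    have [eNW|nNW] := pselect (N = W').
      by exists U'; rewrite eNW; [exact: in_edgesC|exact: segmentC].
    by case: (nint _ _ e).
  have [r /andP[r0 r1] <-] := sQ.
  by exists r => //; case: (only _ eQ) => ->; [left|right].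
- move=> Dt; have [eX eY] := lform_eq0 pU Dt.
  set q := ecoord F N U (X W) (Y W) in eX eY.
  have q0 : q <> 0.
    move=> q0; rewrite q0 segment_pt0 in eX eY; case: pW; by rewrite ?eX ?eY.
  have [q1|q1|//] := ltgtP q 0.
    exists (- q); first lra.
    by rewrite -eX -eY affX affY; split; ring.
  exfalso.
  (* The projected rays would overlap: [W] lies over the parameter [q > 0] of the line [NU], hence
     the parameter [r] of [NW] over [r * q] on [NU]. This [r] keeps both parameters below 1; then
     either the two edges share a second point or general position is violated. *)
  pose r := (1 + q)^-1; have q1' : 0 < 1 + q by lra.
  have r0 : 0 < r by rewrite invr_gt0.
  have rq : r * q = 1 - r by rewrite /r; field; exact: lt0r_neq0.
  have rq0 : 0 < r * q by rewrite mulr_gt0.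
  have r1 : r <= 1 by rewrite rq in rq0; lra.
  have sM : segment N W (segment_pt N W r) by exists r => //=; rewrite (ltW r0) r1.
  have sM' : segment N U (segment_pt N U (r * q)).
    by exists (r * q) => //=; rewrite ltW //= rq; lra.
  have mX : X (segment_pt N W r) = X (segment_pt N U (r * q)).
    by rewrite !affX -eX affX; ring.
  have mY : Y (segment_pt N W r) = Y (segment_pt N U (r * q)).
    by rewrite !affY -eY affY; ring.
  have [eM|nM] := pselect (segment_pt N W r = segment_pt N U (r * q)).
    have eN : segment_pt N W r = N.
      by apply: (sd_disj H eU eW UW) => //; rewrite eM.
    have : r = 0 by apply: (segment_pt_inj pW); rewrite segment_pt0.
    by move=> r00; rewrite r00 ltxx in r0.
  have [_ _] := sd_gen2 H eW eU sM sM' mX mY nM; apply.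
  by move: Dt; rewrite /cross /lform; lra.
- by move=> U' W' e /(nint _ _ e).
Qed.

(** The cases are exhausted because at most two strands lie over a point ([sd_gen3]), and two of
    them are interior and transversal by [sd_gen2]. *)
Lemma model_exists x1 x2 : T x1 x2 -> exists t, model x1 x2 t.
Proof.
move=> Tx.
have [xA yA zA] := sd_A H; have [xB yB zB] := sd_B H.
have [eA|/eqP nA] := eqVneq (x1, x2) (0, 0).
  by case: eA => -> ->; have := model_end H (or_introl (erefl A)); rewrite xA yA.
have [eB|/eqP nB] := eqVneq (x1, x2) (1, 0).
  by case: eB => -> ->; have := model_end H (or_intror (erefl B)); rewrite xB yB.
have [[N sN]|none] := pselect (exists N, strand x1 x2 N); last first.
  by apply: (model_none H) => // N sN; apply: none; exists N.
have two N1 N2 : strand x1 x2 N1 -> strand x1 x2 N2 -> Z N2 < Z N1 -> exists t, model x1 x2 t.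
  move=> s1 s2 z21; have [o1 X1 Y1 Z1] := s1; have [o2 X2 Y2 Z2] := s2.
  have n12 : N1 <> N2 by move=> e; rewrite e ltxx in z21.
  have eX : X N1 = X N2 by rewrite X1 X2.
  have eY : Y N1 = Y N2 by rewrite Y1 Y2.
  have [U1 [W1 [e1 g1]]] := o1; have [U2 [W2 [e2 g2]]] := o2.
  have [a1 b1 cr] := sd_gen2 H e1 e2 g1 g2 eX eY n12.
  have [a2 b2 _] := sd_gen2 H e2 e1 g2 g1 (esym eX) (esym eY) (nesym n12).
  apply: (model_cross H Tx nA nB s1 s2 z21 _ e1 _ e2 _ cr) => // N' [o' X' Y' Z'].
  by apply: (sd_gen3 H) => //; rewrite ?X1 ?X' ?Y1 ?Y'.
have [[N' [sN' nN]]|uN] := pselect (exists N', strand x1 x2 N' /\ N' <> N).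
  have [_ X1 Y1 _] := sN; have [_ X2 Y2 _] := sN'.
  case: (ltgtP (Z N) (Z N')) => [z|z|z]; [exact: two sN' sN z|exact: two sN sN' z|].
  by case: nN; apply: (@frame_inj _ F); rewrite ?X1 ?X2 ?Y1 ?Y2.
have {}uN N' : strand x1 x2 N' -> N' = N.
  by move=> s; have [//|n] := pselect (N' = N); case: uN; exists N'.
have [oN XN YN ZN] := sN.
have TN : T (X N) (Y N) by rewrite XN YN.
have [N' [oN' eX eY zN]|k L] := sd_lim H oN ZN TN.
  have := uN N'; rewrite /strand eX eY XN YN.
  by move=> /(_ (And4 oN' erefl erefl (lt_trans ZN zN))) e; move: zN; rewrite e ltxx.
have [[U [W [e i]]]|nint] := pselect (exists U W, Ed U W /\ interior U W N).
  exact: model_interior Tx nA nB sN uN L e i.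
have {}nint U W : Ed U W -> ~ interior U W N by move=> e i; apply: nint; exists U, W.
have nAB D : D = A \/ D = B -> N <> D.
  by move=> /(A_or_B H) [_ z _] e; move: ZN; rewrite e z ltxx.
have [U eU] : exists U, Ed N U.
  have [U [W [e s]]] := oN.
  have [eNU|nNU] := pselect (N = U); first by exists W; rewrite eNU.
  have [eNW|nNW] := pselect (N = W); first by exists U; rewrite eNW; exact: in_edgesC.
  by case: (nint _ _ e).
have [W [WU eW only]] := sd_vertex H (nAB A (or_introl erefl)) (nAB B (or_intror erefl)) eU.
have [D0|D0] := leP 0 (lform F N U (X W) (Y W)).
  exact: model_vertex Tx nA nB sN uN L eU eW (nesym WU) only nint D0.
apply: (model_vertex Tx nA nB sN uN L eW eU WU _ nint).
  by move=> Q /only [->|->]; [right|left].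
by move: D0; rewrite /lform => D0; lra.
Qed.

(** Laws based at different points are compatible: at a regular point, two functions that obey
    [rule] and agree there agree nearby. This gives local transitivity, and the shadow is the flat
    section with value [u0] at the corner [A]. *)
Lemma shadow_exists u0 : exists a : R -> R -> V,
  [/\ a 0 0 = u0, forall y1 y2, T y1 y2 -> rule F E0 c y1 y2 a,
      (forall D k, D = A \/ D = B -> Lim Ed c D k -> nb (X D) (Y D) (fun z1 z2 =>
         T z1 z2 -> a z1 z2 = a (X D) (Y D) \/ a z1 z2 = k + k - a (X D) (Y D))) &
      forall v0, (forall U W N v, Ed U W -> segment U W N -> U <> N -> 0 <= Z N ->
         T (X N) (Y N) -> lim c N U v -> v = v0) -> u0 = v0 ->
         forall y1 y2, T y1 y2 -> a y1 y2 = v0].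
Proof.
have ch (x : R * R) : exists t, (T x.1 x.2 -> model x.1 x.2 t) /\
    (~ T x.1 x.2 -> forall z1 z2 u, t z1 z2 u = u).
  case: x => x1 x2 /=.
  have [/[dup] Tx /model_exists [t mt]|nT] := pselect (T x1 x2); first by exists t.
  by exists (fun _ _ u => u).
have [tau Htau] := boolp.choice ch.
pose tau' x1 x2 := tau (x1, x2).
have mod x1 x2 : T x1 x2 -> model x1 x2 (tau' x1 x2) by have [] := Htau (x1, x2).
have inj x1 x2 z1 z2 u w : tau' x1 x2 z1 z2 u = tau' x1 x2 z1 z2 w -> u = w.
  have [/mod [_ [h _] _ _ _]|nT] := pselect (T x1 x2); first exact: h.
  by rewrite /tau' !(proj2 (Htau (x1, x2)) nT).
have surj x1 x2 z1 z2 w : exists u, tau' x1 x2 z1 z2 u = w.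
  have [/mod [_ [_ h] _ _ _]|nT] := pselect (T x1 x2); first exact: h.
  by exists w; rewrite /tau' (proj2 (Htau (x1, x2)) nT).
have idt x1 x2 u : T x1 x2 -> tau' x1 x2 x1 x2 u = u by move=> /mod [].
have rules y1 y2 (b b' : R -> R -> V) : T y1 y2 -> regular F E0 c y1 y2 ->
    rule F E0 c y1 y2 b -> rule F E0 c y1 y2 b' -> b y1 y2 = b' y1 y2 ->
    nb y1 y2 (fun z1 z2 => T z1 z2 -> b z1 z2 = b' z1 z2).
  move=> Ty [nA nB [none|[U [W [N [k [e i s u L]]]]]]] [r1 r2] [r1' r2'] e0.
    apply: nb_sub (nb_and (r1 nA nB none) (r1' nA nB none)) => z1 z2 [h h'] Tz.
    by rewrite h // h'.
  apply: nb_sub (nb_and (r2 U W N k e i s u L) (r2' U W N k e i s u L)) => z1 z2 [h h'] Tz.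
  by rewrite h // h' // e0.
have loc : locally_transitive tau' T.
  move=> x1 x2 Tx; have [i0 _ near _ _] := mod _ _ Tx.
  apply: nb_sub near => y1 y2 h Ty; have [reg rl] := h Ty.
  have [[e1 e2]|/eqP nyx] := eqVneq (y1, y2) (x1, x2).
    by rewrite e1 e2 => u; apply: nbT => z1 z2 _; rewrite i0.
  have {}reg : regular F E0 c y1 y2 by case: reg.
  have [j0 _ near' _ _] := mod _ _ Ty.
  have [_ rl'] := nb_self near' Ty.
  move=> u.
  have := rules y1 y2 (fun z1 z2 => tau' x1 x2 z1 z2 u)
    (fun z1 z2 => tau' y1 y2 z1 z2 (tau' x1 x2 y1 y2 u)) Ty reg (rl u) (rl' _).
  by apply; rewrite j0.
have [a Fa a0] := flat_triangle inj surj loc u0.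
have conv x1 x2 y1 y2 : T x1 x2 -> T y1 y2 -> forall t : R, 0 <= t <= 1 ->
    T ((1 - t) * x1 + t * y1) ((1 - t) * x2 + t * y2).
  move=> [h1 h2 h3] [k1 k2 k3] t /andP[t0 t1].
  have s0 : 0 <= 1 - t by rewrite subr_ge0.
  split; [by rewrite addr_ge0 ?mulr_ge0|by rewrite addr_ge0 ?mulr_ge0|].
  have h := mulr_ge0 s0 (_ : 0 <= 1 - (x1 + x2)).
  have k := mulr_ge0 t0 (_ : 0 <= 1 - (y1 + y2)).
  rewrite !subr_ge0 in h k; have := h h3; have := k k3; lra.
have TA : T 0 0 by split; lra.
exists a; split=> //.
- move=> y1 y2 Ty; have [j0 _ near _ _] := mod _ _ Ty.
  have [_ /(_ (a y1 y2)) [r1 r2]] := nb_self near Ty.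
  split.
    move=> nA nB none; apply: nb_sub (nb_and (r1 nA nB none) (Fa _ _ Ty)) => z1 z2 [h h'] Tz.
    by rewrite h' // h // j0.
  move=> U W N k e i s u L.
  apply: nb_sub (nb_and (r2 U W N k e i s u L) (Fa _ _ Ty)) => z1 z2 [h h'] Tz.
  by rewrite h' // h // j0.
- move=> D k eD L; have [_ _ TD] := A_or_B H eD.
  have [_ _ _ _ ends] := mod _ _ TD.
  apply: nb_sub (Fa _ _ TD) => z1 z2 h Tz; rewrite h //.
  exact: (ends D k eD erefl erefl L).
- move=> v0 Hv e0 y1 y2 Ty.
  apply: (flat_uniq inj (v := a) (w := fun _ _ => v0) (conv _ _ _ _ TA Ty) Fa).
    move=> x1 x2 Tx; have [_ _ _ cst _] := mod _ _ Tx.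
    (* The constant [v0] is itself a flat section, and flat sections are unique. *)
    by apply: nbT => z1 z2 _; rewrite cst.
  by rewrite a0.
Qed.

End ShadowExists.

(** * Pushing a strand across a triangle *)

Section Germs.
Variables (R : realType) (F : frame R).
Local Notation pt := 'rV[R]_3.
Local Notation X := (fX F).
Local Notation Y := (fY F).

Lemma germ_sub M U (P Q : pt -> Prop) : (forall N, P N -> Q N) -> germ M U P -> germ M U Q.
Proof. by move=> PQ [t t0 h]; exists t => // s s0 s1; apply/PQ/h. Qed.

Lemma germ_and M U (P Q : pt -> Prop) :
  germ M U P -> germ M U Q -> germ M U (fun N => P N /\ Q N).
Proof.
move=> [t t0 h] [r r0 k]; exists (Num.min t r); first by rewrite lt_min t0 r0.
by move=> s s0; rewrite lt_min => /andP[s1 s2]; split; [apply: h|apply: k].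
Qed.

Lemma germ_ex M U (P : pt -> Prop) : germ M U P ->
  exists2 s : R, 0 < s < 1 & P (segment_pt M U s).
Proof.
move=> [t t0 h]; pose m := Num.min t 1.
have m1 : m <= t by rewrite /m ge_min lexx.
have m2 : m <= 1 by rewrite /m ge_min lexx orbT.
have m0 : 0 < m by rewrite lt_min t0 ltr01.
by exists (m / 2); [apply/andP; split; lra|apply: h; lra].
Qed.

Lemma germ_segment M U : germ M U (fun N => exists2 s : R, 0 < s < 1 & N = segment_pt M U s).
Proof. by exists 1 => // s s0 s1; exists s; rewrite ?s0. Qed.

Definition affine_pt (f : pt -> R) :=
  forall M U s, f (segment_pt M U s) = (1 - s) * f M + s * f U.

Lemma germ_pos f M U : affine_pt f -> 0 < f M -> germ M U (fun N => 0 < f N).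
Proof.
move=> af h; have [e e0 H] := small_pos (f U) h.
by exists e => // s s0 s1; rewrite af H.
Qed.

Lemma germ_neg f M U : affine_pt f -> f M < 0 -> germ M U (fun N => f N < 0).
Proof.
move=> af h; have af' : affine_pt (fun P => - f P) by move=> P Q s; rewrite af; ring.
have := @germ_pos _ M U af'; rewrite oppr_gt0 => /(_ h).
by apply: germ_sub => N; rewrite oppr_gt0.
Qed.

Lemma germ_sgn f M U : affine_pt f ->
  [\/ germ M U (fun N => 0 < f N), germ M U (fun N => f N < 0) | f M = 0 /\ f U = 0].
Proof.
move=> af; have [h|h|h] := ltgtP (f M) 0.
- by constructor 2; apply: germ_neg.
- by constructor 1; apply: germ_pos.
have [k|k|k] := ltgtP (f U) 0; last by constructor 3.
- constructor 2; exists 1 => // s s0 s1; rewrite af h mulr0 add0r.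
  by rewrite pmulr_rlt0.
- by constructor 1; exists 1 => // s s0 s1; rewrite af h mulr0 add0r mulr_gt0.
Qed.

Lemma germ_nb M U (P : R -> R -> Prop) : nb (X M) (Y M) P ->
  germ M U (fun N => P (X N) (Y N)).
Proof.
move=> [d dp Hd]; pose m := 1 + `|X U - X M| + `|Y U - Y M|.
have x0 := normr_ge0 (X U - X M); have y0 := normr_ge0 (Y U - Y M).
have m0 : 0 < m by rewrite /m; lra.
exists (d / m); first exact: divr_gt0.
move=> s s0; rewrite ltr_pdivlMr // /m => sd; apply: Hd; rewrite ?affX ?affY.
  rewrite (_ : _ - _ = s * (X U - X M)); last by ring.
  by rewrite normrM gtr0_norm //; nra.
rewrite (_ : _ - _ = s * (Y U - Y M)); last by ring.
by rewrite normrM gtr0_norm //; nra.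
Qed.

Lemma germ_scale M U (r : R) (P : pt -> Prop) : 0 < r ->
  germ M U P <-> germ M (segment_pt M U r) P.
Proof.
move=> r0; have e (s : R) : segment_pt M (segment_pt M U r) s = segment_pt M U (s * r).
  by rewrite /segment_pt; apply/rowP => k; rewrite !mxE; ring.
split=> -[t t0 h].
  exists (t / r); first exact: divr_gt0.
  by move=> s s0; rewrite ltr_pdivlMr // => s1; rewrite e; apply: h => //; rewrite mulr_gt0.
exists (t * r); first exact: mulr_gt0.
move=> s s0 s1; have -> : s = s / r * r by rewrite divfK // gt_eqF.
by rewrite -e; apply: h; [rewrite divr_gt0|rewrite ltr_pdivrMr].
Qed.

Lemma affine_fX : affine_pt X. Proof. by move=> *; rewrite affX. Qed.
Lemma affine_fY : affine_pt Y. Proof. by move=> *; rewrite affY. Qed.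
Lemma affine_fZ : affine_pt (fZ F). Proof. by move=> *; rewrite affZ. Qed.
Lemma affine_f3 : affine_pt (fun P => 1 - X P - Y P).
Proof. by move=> M U s; rewrite affX affY; ring. Qed.

End Germs.

(** * The remaining edges and the triangle of a move *)

Section Transfer.
Variables (R : realType) (V : comNzRingType) (F : frame R).
Local Notation pt := 'rV[R]_3.
Local Notation X := (fX F).
Local Notation Y := (fY F).
Local Notation Z := (fZ F).
Local Notation T := (@std_triangle R).
Variables (A B C : pt) (E0 : seq (pt * pt)).
Local Notation Ed := (in_edges E0).
Local Notation g1 := [:: (A, B)].
Local Notation g2 := [:: (A, C); (C, B)].
Local Notation EdA := (in_edges (g1 ++ g2 ++ E0)).

Record move_data : Prop := MoveData {
  md_A : [/\ X A = 0, Y A = 0 & Z A = 0];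
  md_B : [/\ X B = 1, Y B = 0 & Z B = 0];
  md_C : [/\ X C = 0, Y C = 1 & Z C = 0];
  md_pd : forall U W, EdA U W -> planar_neq F U W;
  md_touch : forall U W N, Ed U W -> segment U W N -> T (X N) (Y N) -> Z N = 0 ->
    N = A \/ N = B;
  md_simple : forall U W U' W' N, Ed U W -> Ed U' W' -> interior U W N ->
    segment U' W' N -> (U = U' /\ W = W') \/ (U = W' /\ W = U');
  md_vertex : forall N U, N <> A -> N <> B -> Ed N U ->
    exists W, [/\ W <> U, Ed N W & forall Q, Ed N Q -> Q = U \/ Q = W];
  md_end : forall D U U', D = A \/ D = B -> Ed D U -> Ed D U' -> U = U';
  md_endpt : forall D U W, D = A \/ D = B -> Ed U W -> segment U W D -> D = U \/ D = W;
  md_disj : forall N U W M, Ed N U -> Ed N W -> U <> W -> segment N U M ->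
    segment N W M -> M = N;
  md_gen2 : forall U W U' W' M N, EdA U W -> EdA U' W' -> segment U W M ->
    segment U' W' N -> X M = X N -> Y M = Y N -> M <> N ->
    [/\ M <> U, M <> W & cross F U W U' W' <> 0];
  md_gen3 : forall M N P, on_edges EdA M -> on_edges EdA N -> on_edges EdA P ->
    X M = X N -> Y M = Y N -> X M = X P -> Y M = Y P -> M <> N -> P = M \/ P = N }.

Hypothesis H : move_data.

Lemma in_edges_cat (s1 s2 : seq (pt * pt)) U W :
  in_edges (s1 ++ s2) U W <-> in_edges s1 U W \/ in_edges s2 U W.
Proof.
rewrite /in_edges !mem_cat; split.
  by move=> [] /orP[] h; [left; left|right; left|left; right|right; right].
by move=> [] [] h; [left|right|left|right]; rewrite h ?orbT.
Qed.

Lemma EdA0 U W : Ed U W -> EdA U W.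
Proof. by move=> h; apply/in_edges_cat; right; apply/in_edges_cat; right. Qed.

Lemma EdAg U W : in_edges (g1 ++ g2) U W -> EdA U W.
Proof.
move=> /in_edges_cat[] h; apply/in_edges_cat; first by left.
by right; apply/in_edges_cat; left.
Qed.

Lemma sub_on_edges (E E' : pt -> pt -> Prop) N : (forall U W, E U W -> E' U W) ->
  on_edges E N -> on_edges E' N.
Proof. by move=> h [U [W [/h e s]]]; exists U, W. Qed.

Lemma side_pt U W N : in_edges (g1 ++ g2) U W -> segment U W N ->
  [/\ Z N = 0, T (X N) (Y N) & [\/ X N = 0, Y N = 0 | X N + Y N = 1]].
Proof.
have [xA yA zA] := md_A H; have [xB yB zB] := md_B H; have [xC yC zC] := md_C H.
have main U' W' t : (U', W') \in g1 ++ g2 -> 0 <= t <= 1 ->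
    [/\ Z (segment_pt U' W' t) = 0, T (X (segment_pt U' W' t)) (Y (segment_pt U' W' t)) &
     [\/ X (segment_pt U' W' t) = 0, Y (segment_pt U' W' t) = 0 |
         X (segment_pt U' W' t) + Y (segment_pt U' W' t) = 1]].
  rewrite !inE => /or3P[] /eqP[-> ->] /andP[t0 t1];
    rewrite affX affY affZ ?xA ?yA ?zA ?xB ?yB ?zB ?xC ?yC ?zC.
  - by split; [ring|split; lra|constructor 2; ring].
  - by split; [ring|split; lra|constructor 1; ring].
  - by split; [ring|split; lra|constructor 3; ring].
move=> [e|e] [t /= t01 <-]; first exact: main.
rewrite segment_ptC; apply: main => //; move/andP: t01 => [t0 t1].
by apply/andP; split; lra.
Qed.

Lemma side_above y1 y2 : T y1 y2 -> [\/ y1 = 0, y2 = 0 | y1 + y2 = 1] ->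
  exists2 N, on_edges (in_edges (g1 ++ g2)) N & X N = y1 /\ Y N = y2.
Proof.
have [xA yA zA] := md_A H; have [xB yB zB] := md_B H; have [xC yC zC] := md_C H.
move=> [h1 h2 h3] [e|e|e].
- exists (segment_pt A C y2); last by rewrite affX affY xA xC yA yC e; split; ring.
  exists A, C; split; first by left; rewrite !inE eqxx orbT.
  by exists y2 => //=; rewrite h2; lra.
- exists (segment_pt A B y1); last by rewrite affX affY xA xB yA yB e; split; ring.
  exists A, B; split; first by left; rewrite !inE eqxx.
  by exists y1 => //=; rewrite h1; lra.
- exists (segment_pt C B y1); last first.
    by rewrite affX affY xC xB yC yB; split; lra.
  exists C, B; split; first by left; rewrite !inE eqxx !orbT.
  by exists y1 => //=; rewrite h1; lra.
Qed.

(** [D] ends the edge [AB], and [md_gen2] lets no endpoint of an edge share its projection with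
    another point. *)
Lemma above_end D N : D = A \/ D = B -> on_edges EdA N -> X N = X D -> Y N = Y D -> N = D.
Proof.
move=> eD [U [W [e s]]] eX eY.
have [//|n] := pselect (N = D); exfalso.
have e' : EdA A B by apply: EdAg; left; rewrite !inE eqxx.
case: eD => eD; rewrite eD in eX eY n.
  by have [h] := md_gen2 H e' e (segment_start A B) s (esym eX) (esym eY) (nesym n).
by have [_ h] := md_gen2 H e' e (segment_end A B) s (esym eX) (esym eY) (nesym n).
Qed.

Definition in_T (P : pt) : Prop := T (X P) (Y P) /\ Z P = 0.
Definition below_T (P : pt) : Prop := [/\ 0 < X P, 0 < Y P, 0 < 1 - X P - Y P & Z P < 0].

(** The signs of four affine functions decide. What remains are edges inside a wall of the prism
    below the triangle, against general position, and edges inside the triangle, which may touch it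
    only at [A] and [B]. *)
Lemma germ_off_below U W M : Ed U W -> segment U W M -> U <> M ->
  germ M U (fun P => ~ in_T P /\ ~ below_T P) \/ germ M U below_T.
Proof.
move=> e s nUM; have eA := EdA0 e.
have pd : planar_neq F W U := planar_neqC (md_pd H eA).
have pM : planar_neq F M U := planar_neq_sub pd (segmentC s) (nesym nUM).
have [tM /andP[tM0 tM1] eM] := segment_sub pd (segmentC s) (nesym nUM).
have onU (f : pt -> R) : affine_pt f -> f M = 0 -> f U = 0 -> f W = 0.
  move=> af; rewrite eM af => h h'; rewrite h' mulr0 addr0 in h.
  by move/eqP: h; rewrite mulf_eq0 => /orP[/eqP|/eqP //]; lra.
have germU : germ M U (segment U W).
  apply: germ_sub (germ_segment M U) => N [r /andP[r0 r1] ->]; rewrite eM segment_ptA.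
  by apply: segmentC; exists (tM + r * (1 - tM)) => //=; apply/andP; split; nra.
have [xA yA zA] := md_A H; have [xB yB zB] := md_B H; have [xC yC zC] := md_C H.
have eAB : EdA A B by apply: EdAg; left; rewrite !inE eqxx.
have eAC : EdA A C by apply: EdAg; left; rewrite !inE eqxx orbT.
have eCB : EdA C B by apply: EdAg; left; rewrite !inE eqxx !orbT.
have off : germ M U (fun P => X P < 0) \/ germ M U (fun P => Y P < 0) \/
    germ M U (fun P => 1 - X P - Y P < 0) \/ germ M U (fun P => 0 < Z P) ->
    germ M U (fun P => ~ in_T P /\ ~ below_T P).
  rewrite /in_T /below_T.
  by move=> [|[|[|]]]; apply: germ_sub => N h; split=> [[[]]|[]]; lra.
have side_contra (D D' : pt) (N N' : pt) : EdA D D' -> segment D D' N' ->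
    cross F U W D D' = 0 -> segment U W N -> X N = X N' -> Y N = Y N' -> Z N < 0 ->
    Z N' = 0 -> False.
  move=> eD sD c0 sN eX eY z z'.
  have n : N <> N' by move=> h; rewrite h z' ltxx in z.
  by have [_ _] := md_gen2 H eA eD sN sD eX eY n; rewrite c0.
pose nn (f : pt -> R) := germ M U (fun P => 0 < f P) \/ (f M = 0 /\ f U = 0).
have [hX|] : germ M U (fun P => X P < 0) \/ nn X.
  by have [h|h|h] := germ_sgn M U (@affine_fX R F); rewrite /nn; auto.
  by left; apply: off; left.
have [hY|] : germ M U (fun P => Y P < 0) \/ nn Y.
  by have [h|h|h] := germ_sgn M U (@affine_fY R F); rewrite /nn; auto.
  by left; apply: off; right; left.
have [h3|] : germ M U (fun P => 1 - X P - Y P < 0) \/ nn (fun P => 1 - X P - Y P).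
  by have [h|h|h] := germ_sgn M U (@affine_f3 R F); rewrite /nn; auto.
  by left; apply: off; right; right; left.
move=> n3 nY nX.
have ge f : affine_pt f -> nn f -> germ M U (fun P => 0 <= f P).
  move=> af [h|[h k]]; first by apply: germ_sub h => N /ltW.
  by exists 1 => // r _ _; rewrite af h k !mulr0 addr0.
have gX := ge _ (@affine_fX R F) nX; have gY := ge _ (@affine_fY R F) nY.
have g3 := ge _ (@affine_f3 R F) n3.
have gT : germ M U (fun P => T (X P) (Y P)).
  by apply: germ_sub (germ_and gX (germ_and gY g3)) => N [a [b d]]; split; lra.
have [hZ|hZ|[Z0 ZU]] := germ_sgn M U (@affine_fZ R F).
- by left; apply: off; right; right; right.
- right.
  have [s0 s01 [segN [TN ZN]]] := germ_ex (germ_and germU (germ_and gT hZ)).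
  set N := segment_pt M U s0 in segN TN ZN.
  have eN (f : pt -> R) : affine_pt f -> f M = 0 -> f U = 0 -> f N = 0.
    by move=> af h k; rewrite /N af h k !mulr0 addr0.
  have [hX|[X0 XU]] := nX; last first.
    exfalso; have XW := onU _ (@affine_fX R F) X0 XU.
    apply: (side_contra A C N (segment_pt A C (Y N)) eAC) => //.
    + by exists (Y N) => //=; case: TN => h1 h2 h3; apply/andP; split; lra.
    + by rewrite /cross xA xC yA yC XW XU; ring.
    + by rewrite affX xA xC (eN _ (@affine_fX R F) X0 XU); ring.
    + by rewrite affY yA yC; ring.
    + by rewrite affZ zA zC; ring.
  have [hY|[Y0 YU]] := nY; last first.
    exfalso; have YW := onU _ (@affine_fY R F) Y0 YU.
    apply: (side_contra A B N (segment_pt A B (X N)) eAB) => //.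
    + by exists (X N) => //=; case: TN => h1 h2 h3; apply/andP; split; lra.
    + by rewrite /cross xA xB yA yB YW YU; ring.
    + by rewrite affX xA xB; ring.
    + by rewrite affY yA yB (eN _ (@affine_fY R F) Y0 YU); ring.
    + by rewrite affZ zA zB; ring.
  have [h3|[f0 fU]] := n3; last first.
    exfalso; have fW := onU _ (@affine_f3 R F) f0 fU.
    have fN := eN _ (@affine_f3 R F) f0 fU.
    apply: (side_contra C B N (segment_pt C B (X N)) eCB) => //.
    + by exists (X N) => //=; case: TN => h1 h2 h3; apply/andP; split; lra.
    + by rewrite /cross xC xB yC yB; lra.
    + by rewrite affX xC xB; ring.
    + by rewrite affY yC yB; lra.
    + by rewrite affZ zC zB; ring.
  by apply: germ_sub (germ_and hX (germ_and hY (germ_and h3 hZ))) => N' [a [b [d g]]].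
- exfalso; have [t0 t0p Ht] := germ_and germU gT.
  have AB (r : R) : 0 < r -> r < t0 -> segment_pt M U r = A \/ segment_pt M U r = B.
    move=> r0 r1; have [sr Tr] := Ht r r0 r1; apply: (md_touch H e sr Tr).
    by rewrite affZ Z0 ZU !mulr0 addr0.
  have inj (r r' : R) : segment_pt M U r = segment_pt M U r' -> r = r' by exact: (segment_pt_inj pM).
  (* Three distinct points of the edge cannot all be [A] or [B]. *)
  have n12 : t0 / 2 <> t0 / 3 by lra.
  have n13 : t0 / 2 <> t0 / 4 by lra.
  have n23 : t0 / 3 <> t0 / 4 by lra.
  have h1 : segment_pt M U (t0 / 2) = A \/ segment_pt M U (t0 / 2) = B by apply: AB; lra.
  have h2 : segment_pt M U (t0 / 3) = A \/ segment_pt M U (t0 / 3) = B by apply: AB; lra.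
  have h3 : segment_pt M U (t0 / 4) = A \/ segment_pt M U (t0 / 4) = B by apply: AB; lra.
  case: h1 => e1; case: h2 => e2;
    try (by apply: n12; apply: inj; rewrite e1 e2);
  case: h3 => e3; solve [by apply: n13; apply: inj; rewrite e1 e3|
         by apply: n23; apply: inj; rewrite e2 e3].
Qed.

End Transfer.

Lemma lim_scale (R : realType) (V : comNzRingType) (f : 'rV[R]_3 -> V) M U (r : R) v :
  0 < r -> lim f M U v -> lim f M (segment_pt M U r) v.
Proof. by move=> r0; have [h _] := @germ_scale R M U r (fun P => f P = v) r0. Qed.

(** * The shadow agrees with the colouring along the old path *)

Section Matching.
Variables (R : realType) (V : comNzRingType) (F : frame R).
Local Notation pt := 'rV[R]_3.
Local Notation X := (fX F).
Local Notation Y := (fY F).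
Local Notation Z := (fZ F).
Local Notation T := (@std_triangle R).
Variables (A B C : pt) (E0 : seq (pt * pt)).
Local Notation Ed := (in_edges E0).
Local Notation g1 := [:: (A, B)].
Local Notation g2 := [:: (A, C); (C, B)].
Local Notation EdA := (in_edges (g1 ++ g2 ++ E0)).
Hypothesis H : move_data F A B C E0.
Let EdA0 U W : Ed U W -> EdA U W := @EdA0 R A B C E0 U W.
Let EdAg U W : in_edges (g1 ++ g2) U W -> EdA U W := @EdAg R A B C E0 U W.
(** [Gam] is the old path and [Gam'] the new one; keeping both possibilities treats a move and its
    inverse at once. *)
Variables Gam Gam' : seq (pt * pt).
Hypothesis hG : (Gam = g1 /\ Gam' = g2) \/ (Gam = g2 /\ Gam' = g1).
Local Notation EG := (in_edges Gam).
Local Notation ES := (in_edges (Gam ++ E0)).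

Lemma gam_sides U W : EG U W -> in_edges (g1 ++ g2) U W.
Proof. by case: hG => -[-> _] h; apply/in_edges_cat; [left|right]. Qed.

Lemma sides_gam U W : in_edges (g1 ++ g2) U W -> EG U W \/ in_edges Gam' U W.
Proof. by move=> /in_edges_cat; case: hG => -[-> ->] []; auto. Qed.

Lemma ES_EdA U W : ES U W -> EdA U W.
Proof. by move=> /in_edges_cat[/gam_sides /EdAg //|/EdA0]; apply. Qed.

Lemma ES_Ed U W : Ed U W -> ES U W.
Proof. by move=> h; apply/in_edges_cat; right. Qed.

Lemma ES_EG U W : EG U W -> ES U W.
Proof. by move=> h; apply/in_edges_cat; left. Qed.

Lemma end_edge D : D = A \/ D = B -> exists U, EG D U.
Proof.
case: hG => -[-> _] [->|->].
- by exists B; left; rewrite mem_head.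
- by exists A; right; rewrite mem_head.
- by exists C; left; rewrite mem_head.
- by exists C; right; rewrite !inE eqxx orbT.
Qed.

Lemma gam_pt N : on_edges EG N -> [/\ Z N = 0, T (X N) (Y N) &
  [\/ X N = 0, Y N = 0 | X N + Y N = 1]].
Proof. move=> [U [W [/gam_sides e s]]]. by have := side_pt H e s. Qed.

Lemma side_interior P Q N : in_edges (g1 ++ g2) P Q -> interior P Q N ->
  [/\ N <> A, N <> B & N <> C].
Proof.
have [xA yA zA] := md_A H; have [xB yB zB] := md_B H; have [xC yC zC] := md_C H.
have main P' Q' : (P', Q') \in g1 ++ g2 -> interior P' Q' N -> [/\ N <> A, N <> B & N <> C].
  move=> e i; have eA : EdA P' Q' by apply: EdAg; left.
  have [t /andP[t0 t1] ->] := interiorP (md_pd H eA) i.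
  have k (f : pt -> R) (D : pt) : f (segment_pt P' Q' t) <> f D -> segment_pt P' Q' t <> D.
    by move=> h h'; apply: h; rewrite h'.
  move: e; rewrite !inE => /or3P[] /eqP[eP eQ]; subst P' Q'.
  - by split; [apply: (k X)|apply: (k X)|apply: (k Y)];
      rewrite ?affX ?affY ?xA ?yA ?xB ?yB ?xC ?yC; lra.
  - by split; [apply: (k Y)|apply: (k Y)|apply: (k Y)];
      rewrite ?affX ?affY ?xA ?yA ?xB ?yB ?xC ?yC; lra.
  - by split; [apply: (k Y)|apply: (k X)|apply: (k X)];
      rewrite ?affX ?affY ?xA ?yA ?xB ?yB ?xC ?yC; lra.
case=> e i; first exact: main e i.
exact: main e (interiorC i).
Qed.

Lemma planar_end D N : D = A \/ D = B -> (X N, Y N) = (X D, Y D) -> Z N = 0 -> N = D.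
Proof.
have [xA yA zA] := md_A H; have [xB yB zB] := md_B H.
by move=> eD [eX eY] z; apply: (@frame_inj _ F) => //; case: eD => ->; rewrite ?zA ?zB.
Qed.

Lemma planar_not_end N : N <> A -> N <> B -> Z N = 0 ->
  (X N, Y N) <> (0, 0) /\ (X N, Y N) <> (1, 0).
Proof.
have [xA yA zA] := md_A H; have [xB yB zB] := md_B H => nA nB z; split=> e.
  by apply: nA; apply: planar_end => //; [left|rewrite xA yA].
by apply: nB; apply: planar_end => //; [right|rewrite xB yB].
Qed.

Variable c : pt -> V.
Hypothesis col : coloring F ES c.

Lemma Lim_sub (E E' : pt -> pt -> Prop) M v : (forall U W, E U W -> E' U W) ->
  Lim E' c M v -> Lim E c M v.
Proof. by move=> sub L U W /sub; exact: L. Qed.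

Lemma ES_on N : on_edges ES N -> on_edges EdA N.
Proof. exact: sub_on_edges ES_EdA. Qed.

Lemma end_nice D N : D = A \/ D = B -> ~ above F ES D N.
Proof.
move=> eD [/ES_on oN eX eY z].
by have eN := above_end H eD oN eX eY; rewrite eN ltxx in z.
Qed.

Lemma end_Lim D : D = A \/ D = B -> exists k, Lim ES c D k.
Proof.
move=> eD; have [U eU] := end_edge eD.
have [h _] := col (ES_EG eU) (segment_start D U).
by apply: h => N; exact: end_nice eD.
Qed.

(** The path has height zero, so it never passes above a point of height at least zero: dropping it
    loses no crossing over the triangle. *)
Lemma shadow_of_coloring : shadow_data F A B E0 c.
Proof.
have [xA yA zA] := md_A H; have [xB yB zB] := md_B H.
have up N N' : 0 <= Z N -> above F ES N N' -> above F Ed N N'.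
  move=> zN [[U [W [/in_edges_cat[e|e] s]]] eX eY z].
    by have [z' _ _] := gam_pt (ex_intro _ U (ex_intro _ W (conj e s))); move: z; rewrite z' ltNge zN.
  by split=> //; exists U, W.
have down N N' : above F Ed N N' -> above F ES N N'.
  by move=> [oN eX eY z]; split=> //; apply: sub_on_edges oN => U W; exact: ES_Ed.
split.
- exact: md_A H.
- exact: md_B H.
- by move=> U W /EdA0 e; apply: (md_pd H e).
- exact: md_touch H.
- exact: md_simple H.
- exact: md_vertex H.
- exact: md_end H.
- exact: md_endpt H.
- exact: md_disj H.
- by move=> U W U' W' M N /EdA0 e /EdA0 e'; exact: (md_gen2 H e e').
- move=> D N eD oN; apply: (above_end H eD); apply: sub_on_edges oN; exact: EdA0.
- move=> M N P oM oN oP; apply: (md_gen3 H); [move: oM|move: oN|move: oP];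
    by apply: sub_on_edges; exact: EdA0.
- move=> N [U [W [e s]]] zN _ na.
  have [h _] := col (ES_Ed e) s.
  have [N' /(up _ _ (ltW zN)) /na //|k L] := h _.
  by exists k; apply: Lim_sub L; exact: ES_Ed.
- move=> U W N N' e [s nU nW] zN _ /down ab.
  have [_ h] := col (ES_Ed e) s.
  have [v [w [k [Lv Lw Lk vw]]]] := h N' nU nW ab.
  by exists v, w, k; split=> //; apply: Lim_sub Lk; exact: ES_Ed.
- move=> D /end_Lim [k L]; exists k; apply: Lim_sub L; exact: ES_Ed.
Qed.

Variable a : R -> R -> V.
Local Notation aP := (fun P => a (X P) (Y P)).
Hypothesis a_rule : forall y1 y2, T y1 y2 -> rule F E0 c y1 y2 a.
Hypothesis a_end : forall D k, D = A \/ D = B -> Lim Ed c D k ->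
  nb (X D) (Y D) (fun z1 z2 =>
    T z1 z2 -> a z1 z2 = a (X D) (Y D) \/ a z1 z2 = k + k - a (X D) (Y D)).
Hypothesis a_start : Lim ES c A (a 0 0).

Lemma germ_a M U (P : R -> R -> Prop) :
  nb (X M) (Y M) (fun z1 z2 => T z1 z2 -> P z1 z2) ->
  germ M U (fun N => T (X N) (Y N)) -> germ M U (fun N => P (X N) (Y N)).
Proof.
move=> /(germ_nb U) h h'; apply: germ_sub (germ_and h h') => N [k]; exact: k.
Qed.

(** The strand crosses the segment transversally in projection, so [U] and [W] are on opposite sides
    and exactly one of the two limits is reflected. *)
Lemma shadow_cross U W t U' W' N k (M := segment_pt U W t) :
  0 < t < 1 -> T (X M) (Y M) -> Ed U' W' -> interior U' W' N ->
  strand F E0 (X M) (Y M) N -> (forall N', strand F E0 (X M) (Y M) N' -> N' = N) ->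
  Lim Ed c N k -> cross F U W U' W' <> 0 ->
  germ M U (fun N => T (X N) (Y N)) -> germ M W (fun N => T (X N) (Y N)) ->
  exists v w, [/\ lim aP M U v, lim aP M W w & v + w = k + k].
Proof.
move=> /andP[t0 t1] TM e' i' sN uN L cr gU gW.
have [_ r2] := a_rule TM; have {r2} r := r2 U' W' N k e' i' sN uN L.
have pd := md_pd H (EdA0 e'); have [_ XN YN _] := sN.
have [t' _ eN] := interiorP pd i'.
have [l0 _] : lform F U' W' (X M) (Y M) = 0 /\ t' = ecoord F U' W' (X M) (Y M).
  by apply: lform_segment => //; rewrite -eN.
pose l P := lform F U' W' (X P) (Y P).
have al : affine_pt l by move=> P Q s; rewrite /l affX affY /lform; ring.
have lWU : l W - l U = - cross F U W U' W' by rewrite /l /lform /cross; ring.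
have lM : (1 - t) * l U + t * l W = 0 by rewrite -al.
have eW : l W = l U - cross F U W U' W' by lra.
have lU : l U = t * cross F U W U' W' by rewrite eW in lM; lra.
have lW : l W = - (1 - t) * cross F U W U' W' by lra.
have sgn D : l D <> 0 -> germ M D (fun N => T (X N) (Y N)) ->
    lim aP M D (if (0 < l D) == side F U' W' (X M) (Y M) then aP M else k + k - aP M).
  move=> lD gD; have := germ_a r gD; move=> g1'.
  have : germ M D (fun P => side F U' W' (X P) (Y P) = (0 < l D)).
    exists 1 => // s s0 s1; rewrite /side -/(l _) al (_ : l M = 0) // mulr0 add0r.
    by rewrite pmulr_rgt0 // mulf_eq0 (gt_eqF s0) (negbTE (introN eqP lD)) /= orbF.
  move=> g2'; case: (germ_and g1' g2') => t1' t10 h; exists t1' => // s s0 s1.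
  by case: (h s s0 s1) => -> ->.
have nlU : l U <> 0 by rewrite lU => /eqP; rewrite mulf_eq0 (gt_eqF t0) => /eqP.
have nlW : l W <> 0.
  by rewrite lW => /eqP; rewrite mulf_eq0 oppr_eq0 subr_eq0 (gt_eqF t1) => /eqP.
have opp : (0 < l W) = ~~ (0 < l U).
  have e1 : t * l W = - (1 - t) * l U by lra.
  have n : - (1 - t) < 0 by lra.
  rewrite -(pmulr_rgt0 _ t0) e1 (nmulr_rgt0 _ n).
  by rewrite lt_neqAle (introN eqP nlU) /= leNgt.
exists (if (0 < l U) == side F U' W' (X M) (Y M) then aP M else k + k - aP M).
exists (if (0 < l W) == side F U' W' (X M) (Y M) then aP M else k + k - aP M).
split; [exact: sgn|exact: sgn|].
by rewrite opp; case: (0 < l U); case: (side _ _ _ _ _) => //=; ring.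
Qed.

Lemma gam_T P Q (r : R) : EG P Q -> 0 <= r <= 1 ->
  [/\ Z (segment_pt P Q r) = 0, T (X (segment_pt P Q r)) (Y (segment_pt P Q r)) &
      on_edges EG (segment_pt P Q r)].
Proof.
move=> e r01; have o : on_edges EG (segment_pt P Q r).
  by exists P, Q; split=> //; exists r.
by have [] := gam_pt o.
Qed.

Lemma germ_gam P Q (r : R) D : EG P Q -> 0 <= r <= 1 -> D = P \/ D = Q ->
  germ (segment_pt P Q r) D (fun N => T (X N) (Y N) /\ Z N = 0).
Proof.
move=> e /andP[r0 r1] eD; exists 1 => // s s0 s1.
case: eD => ->; rewrite ?segment_ptA ?segment_ptB.
  have [|? ? _] := @gam_T P Q (r - s * r) e; last by split.
  by apply/andP; split; nra.
have [|? ? _] := @gam_T P Q (r + s * (1 - r)) e; last by split.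
by apply/andP; split; nra.
Qed.

Lemma strand_above y1 y2 N M : X M = y1 -> Y M = y2 -> Z M <= 0 ->
  strand F E0 y1 y2 N -> above F ES M N.
Proof.
move=> <- <- z [o eX eY zN]; split=> //; last exact: le_lt_trans z zN.
apply: sub_on_edges o => U W; exact: ES_Ed.
Qed.

(** Under a strand both functions are reflected in the same colour, elsewhere both are constant:
    this is the hypothesis of [lim_match]. *)
Lemma two_sided P Q (r : R) (N := segment_pt P Q r) : EG P Q -> 0 < r < 1 ->
  exists v w v' w', [/\ lim c N P v, lim c N Q w, lim aP N P v', lim aP N Q w' &
    v = v' <-> w = w'].
Proof.
move=> e r01; have /andP[r0 r1] := r01.
have eA := EdAg (gam_sides e); have pd := md_pd H eA.
have iN : interior P Q N by apply: (interior_pt pd).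
have [nA nB _] := side_interior (gam_sides e) iN.
have r01' : 0 <= r <= 1 by rewrite !ltW.
have [zN TN oN] := gam_T e r01'.
have [sN nP nQ] := iN.
have [yA yB] := planar_not_end nA nB zN.
have [c1 c2] := col (ES_EG e) sN.
have gT D : D = P \/ D = Q -> germ N D (fun N => T (X N) (Y N)).
  by move=> /(germ_gam e r01'); apply: germ_sub => M [].
have [[N' sN']|none] := pselect (exists N', strand F E0 (X N) (Y N) N').
  have ab : above F ES N N' by apply: strand_above sN' => //; rewrite zN.
  have [v [w [k [Lv Lw Lk vw]]]] := c2 N' nP nQ ab.
  have [[U' [W' [e' s']]] XN' YN' zN'] := sN'.
  have nNN : N' <> N by move=> h; rewrite h zN ltxx in zN'.
  have [n1 n2 _] := md_gen2 H (EdA0 e') eA s' sN XN' YN' nNN.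
  have [_ _ cr] := md_gen2 H eA (EdA0 e') sN s' (esym XN') (esym YN') (nesym nNN).
  have uN N'' : strand F E0 (X N) (Y N) N'' -> N'' = N'.
    move=> [o'' X'' Y'' z''].
    have oA : on_edges EdA N by exists P, Q.
    have oA' : on_edges EdA N' by exists U', W'; split=> //; exact: EdA0.
    have oA'' : on_edges EdA N'' by apply: sub_on_edges o''; exact: EdA0.
    have [h|//] := md_gen3 H oA oA' oA'' (esym XN') (esym YN') (esym X'') (esym Y'') (nesym nNN).
    by rewrite h zN ltxx in z''.
  have L : Lim Ed c N' k by apply: Lim_sub Lk; exact: ES_Ed.
  have [||v' [w' [Lv' Lw' vw']]] := shadow_cross r01 TN e' (And3 s' n1 n2) sN' uN L cr.
  - by apply: gT; left.
  - by apply: gT; right.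
  exists v, w, v', w'; split=> //.
  have ew : w = k + k - v by rewrite -vw; ring.
  have ew' : w' = k + k - v' by rewrite -vw'; ring.
  by rewrite ew ew'; split=> [->//|/addrI /oppr_inj].
have {}none N' : ~ strand F E0 (X N) (Y N) N' by move=> s; apply: none; exists N'.
have [M ab|k L] := c1 _.
  have [[U [W [/in_edges_cat[e'|e'] s']]] eX eY z] := ab.
    have [z' _ _] := gam_pt (ex_intro _ U (ex_intro _ W (conj e' s'))).
    by rewrite z' zN ltxx in z.
  by apply: (none M); split=> //; [exists U, W|rewrite -zN].
have [r1' _] := a_rule TN.
have g := r1' yA yB none.
exists k, k, (aP N), (aP N); split=> //.
- exact: L (ES_EG e) sN (nesym nP).
- exact: L (in_edgesC (ES_EG e)) (segmentC sN) (nesym nQ).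
- by apply: (germ_a g); apply: gT; left.
- by apply: (germ_a g); apply: gT; right.
Qed.

Lemma match_edge P Q k (r : R) (N := segment_pt P Q r) : EG P Q ->
  lim c P Q k -> lim aP P Q k -> 0 < r < 1 ->
  exists v w, [/\ lim c N P v, lim aP N P v, lim c N Q w & lim aP N Q w].
Proof.
move=> e Lc La r01; have /andP[r0 r1] := r01.
have [v [w [v' [w' [cv cw av aw vw]]]]] := two_sided e r01.
have vv : v = v'.
  apply: (@lim_match _ _ c aP P N k) => // [m /andP[m0 m1]||].
  - have e1 : segment_pt P N m = segment_pt P Q (m * r).
      by rewrite /N /segment_pt; apply/rowP => i; rewrite !mxE; ring.
    have mr : m * r < 1 by nra.
    have [|v1 [w1 [v1' [w1' [h1 h2 h3 h4 h5]]]]] := @two_sided P Q (m * r) e.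
      by rewrite mulr_gt0.
    have eN : N = segment_pt (segment_pt P Q (m * r)) Q ((r - m * r) / (1 - m * r)).
      rewrite segment_ptA divfK; last by apply/eqP; lra.
      by congr segment_pt; ring.
    have rr : 0 < (r - m * r) / (1 - m * r) by rewrite divr_gt0 //; nra.
    exists v1, w1, v1', w1'; rewrite e1; split=> //.
      by rewrite eN; exact: lim_scale.
    by rewrite eN; exact: lim_scale.
  - exact: lim_scale.
  - exact: lim_scale.
have ww := proj1 vw vv.
by exists v, w; split=> //; [rewrite vv|rewrite ww].
Qed.

Lemma gam_neq P Q : EG P Q -> P <> Q.
Proof.
by move=> e h; case: (md_pd H (EdAg (gam_sides e))); rewrite h.
Qed.

(** Near [B] the shadow is [aP B] or its reflection in the end colour [kB], while along the path it
    equals [kB]. Both alternatives give [aP B = kB]. *)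
Lemma match_B P k : EG P B -> lim c P B k -> lim aP P B k -> Lim ES c B (aP B).
Proof.
move=> e Lc La; have [kB LB] := end_Lim (or_intror (erefl B)).
suff -> : aP B = kB by [].
have L1 : lim c B P kB.
  exact: LB (ES_EG e) (segment_end P B) (gam_neq e).
have L2 : Lim Ed c B kB by apply: Lim_sub LB; exact: ES_Ed.
have [] := @germ_gam P B 1 P e; rewrite ?ler01 ?lexx ?segment_pt1 //; first by left.
move=> t1 t10 gT; have gT' : germ B P (fun N => T (X N) (Y N)).
  by exists t1 => // s s0 s1; case: (gT s s0 s1).
have [t0 t00 Ht] := germ_and L1 (germ_a (a_end (or_intror (erefl B)) L2) gT').
pose s0 := Num.min t0 1 / 2.
have m0 : 0 < Num.min t0 1 by rewrite lt_min t00 ltr01.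
have m1 : Num.min t0 1 <= t0 by rewrite ge_min lexx.
have m2 : Num.min t0 1 <= 1 by rewrite ge_min lexx orbT.
have [|v [w [_ _ cw aw]]] := match_edge (r := 1 - s0) e Lc La.
  by rewrite /s0; apply/andP; split; lra.
have [s /andP[sp sm] [cN aN]] := germ_ex (germ_and cw aw).
rewrite /= -segment_ptC segment_ptB in cN aN.
have [||cN' aN'] := Ht (s0 - s * s0).
- by rewrite /s0; nra.
- by rewrite /s0; nra.
rewrite cN in cN'; rewrite aN cN' in aN'.
case: aN' => // e'; have : aP B = kB + kB - (kB + kB - aP B) by rewrite opprB addrC subrK.
by rewrite -e' addrK.
Qed.

(** Reflection in the end colour fixes that colour. *)
Lemma a_near_end D : D = A \/ D = B -> Lim ES c D (aP D) ->
  nb (X D) (Y D) (fun z1 z2 => T z1 z2 -> a z1 z2 = aP D).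
Proof.
move=> eD L; have L' : Lim Ed c D (aP D) by apply: Lim_sub L; exact: ES_Ed.
by apply: nb_sub (a_end eD L') => z1 z2 h /h [->|->] //; rewrite addrK.
Qed.

Definition agree M U := exists2 v, lim c M U v & lim aP M U v.

Lemma match_segment P Q M : EG P Q -> agree P Q -> agree Q P -> segment P Q M ->
  (P <> M -> agree M P) /\ (Q <> M -> agree M Q).
Proof.
move=> e [k Lc La] aQ [t /= /andP[t0 t1] <-].
move: t0; rewrite le_eqVlt => /orP[/eqP <-|t0].
  by rewrite segment_pt0; split=> // _; exists k.
move: t1; rewrite le_eqVlt => /orP[/eqP ->|t1].
  by rewrite segment_pt1; split.
have [|v [w [? ? ? ?]]] := match_edge (r := t) e Lc La; first by rewrite t0.
by split=> _; [exists v|exists w].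
Qed.

Lemma agree_end D U : D = A \/ D = B -> EG D U -> Lim ES c D (aP D) -> agree D U.
Proof.
move=> eD e L; exists (aP D).
  exact: L (ES_EG (in_edgesC e)) (segment_end U D) (nesym (gam_neq e)).
have := @germ_gam D U 0 U e; rewrite ?lexx ?ler01 ?segment_pt0 => /(_ isT (or_intror erefl)).
move=> h; apply: (germ_a (a_near_end eD L)).
by apply: germ_sub h => N [].
Qed.

(** The agreement is carried from [A], where the shadow was normalised, along the path to [B]; at
    the vertex [C], if the path has it, nothing passes above and both functions are locally
    constant. *)
Lemma match_all : (forall D, D = A \/ D = B -> Lim ES c D (aP D)) /\
  forall U W M, EG U W -> segment U W M -> U <> M -> agree M U.
Proof.
have [xA yA zA] := md_A H; have [xB yB zB] := md_B H; have [xC yC zC] := md_C H.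
have LA : Lim ES c A (aP A) by rewrite xA yA.
have [[sides e1]|[sides [eAC eCB]]] :
    ((forall U W, EG U W -> U = A /\ W = B \/ U = B /\ W = A) /\ EG A B) \/
    ((forall U W, EG U W -> (U = A /\ W = C \/ U = C /\ W = A) \/
       (U = C /\ W = B \/ U = B /\ W = C)) /\ (EG A C /\ EG C B)).
  case: hG => -[-> _]; [left|right]; split.
  - by move=> U W []; rewrite inE => /eqP[-> ->]; auto.
  - by left; rewrite mem_head.
  - by move=> U W []; rewrite !inE => /orP[] /eqP[-> ->]; auto.
  - by split; left; rewrite !inE eqxx ?orbT.
- have aA := agree_end (or_introl (erefl A)) e1 LA.
  have LB : Lim ES c B (aP B) by have [k Lc La] := aA; exact: match_B e1 Lc La.
  have aB := agree_end (or_intror (erefl B)) (in_edgesC e1) LB.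
  split=> [D [->|->] //|U W M /sides [] [-> ->] s].
    by have [h _] := match_segment e1 aA aB s.
  by have [_ h] := match_segment e1 aA aB (segmentC s).
- have aA := agree_end (or_introl (erefl A)) eAC LA.
  have [k1 Lc1 La1] := aA.
  have sC := segment_end A C.
  have oC N : on_edges EdA N -> X N = X C -> Y N = Y C -> N = C.
    move=> [U [W [e s]]] eX eY; have [//|n] := pselect (N = C).
    have [_ h _] := md_gen2 H (EdAg (gam_sides eAC)) e sC s (esym eX) (esym eY) (nesym n).
    by [].
  have [naC _] := col (ES_EG eAC) sC.
  have [N [/ES_on oN eX eY z]|kC LC] := naC _.
    by rewrite (oC N oN eX eY) ltxx in z.
  have cA : lim c C A kC := LC _ _ (ES_EG eAC) sC (gam_neq eAC).
  have cB : lim c C B kC.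
    exact: LC (in_edgesC (ES_EG eCB)) (segment_end B C) (nesym (gam_neq eCB)).
  have TC : T (X C) (Y C) by rewrite xC yC; split; lra.
  have [n1 n2] : (X C, Y C) <> (0, 0) /\ (X C, Y C) <> (1, 0).
    by rewrite xC yC; split=> -[]; lra.
  have [r1 _] := a_rule TC; have {r1} := r1 n1 n2.
  have none N : ~ strand F E0 (X C) (Y C) N.
    move=> [oN eX eY z]; have oN' : on_edges EdA N by apply: sub_on_edges oN; exact: EdA0.
    by rewrite (oC N oN' eX eY) zC ltxx in z.
  move=> /(_ none) r1.
  have aCA : lim aP C A (aP C).
    apply: (germ_a r1); have := @germ_gam A C 1 A eAC.
    rewrite ?lexx ?ler01 ?segment_pt1 => /(_ isT (or_introl erefl)).
    by apply: germ_sub => N [].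
  have aCB : lim aP C B (aP C).
    apply: (germ_a r1); have := @germ_gam C B 0 B eCB.
    rewrite ?lexx ?ler01 ?segment_pt0 => /(_ isT (or_intror erefl)).
    by apply: germ_sub => N [].
  have eC : kC = aP C.
    by apply: (@lim_match _ _ c aP A C k1 kC (aP C)) => // m m01; exact: two_sided.
  rewrite -eC in aCA aCB.
  have aC : agree C A by exists kC.
  have aC' : agree C B by exists kC.
  have LB := match_B eCB cB aCB.
  have aB := agree_end (or_intror (erefl B)) (in_edgesC eCB) LB.
  split=> [D [->|->] //|U W M /sides [] [] [-> ->] s].
  + by have [h _] := match_segment eAC aA aC s.
  + by have [_ h] := match_segment eAC aA aC (segmentC s).
  + by have [h _] := match_segment eCB aC' aB s.
  + by have [_ h] := match_segment eCB aC' aB (segmentC s).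
Qed.

End Matching.

(** * The colouring pushed across the triangle *)

Section NewColoring.
Variables (R : realType) (V : comNzRingType) (F : frame R).
Local Notation pt := 'rV[R]_3.
Local Notation X := (fX F).
Local Notation Y := (fY F).
Local Notation Z := (fZ F).
Local Notation T := (@std_triangle R).
Variables (A B C : pt) (E0 : seq (pt * pt)).
Local Notation Ed := (in_edges E0).
Local Notation g1 := [:: (A, B)].
Local Notation g2 := [:: (A, C); (C, B)].
Local Notation EdA := (in_edges (g1 ++ g2 ++ E0)).
Hypothesis H : move_data F A B C E0.
Let EdA0 U W : Ed U W -> EdA U W := @EdA0 R A B C E0 U W.
Let EdAg U W : in_edges (g1 ++ g2) U W -> EdA U W := @EdAg R A B C E0 U W.
Variables Gam Gam' : seq (pt * pt).
Hypothesis hG : (Gam = g1 /\ Gam' = g2) \/ (Gam = g2 /\ Gam' = g1).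
Local Notation EG := (in_edges Gam).
Local Notation EG' := (in_edges Gam').
Local Notation ES := (in_edges (Gam ++ E0)).
Local Notation ES' := (in_edges (Gam' ++ E0)).

Let hG' : (Gam' = g1 /\ Gam = g2) \/ (Gam' = g2 /\ Gam = g1).
Proof. by case: hG => -[-> ->]; [right|left]. Qed.

Variables (c : pt -> V) (a : R -> R -> V).
Local Notation aP := (fun P => a (X P) (Y P)).
Hypothesis col : coloring F ES c.
Hypothesis a_rule : forall y1 y2, T y1 y2 -> rule F E0 c y1 y2 a.
Hypothesis a_near : forall D, D = A \/ D = B ->
  nb (X D) (Y D) (fun z1 z2 => T z1 z2 -> a z1 z2 = aP D).
Hypothesis LD : forall D, D = A \/ D = B -> Lim ES c D (aP D).
Hypothesis agr : forall U W M, EG U W -> segment U W M -> U <> M -> agree F c a M U.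

(* Pulling the strand across the triangle reflects the colours of all strands
   passing under the triangle in the shadow colours. *)
Definition push (P : pt) : V :=
  if `[< in_T F P >] then aP P
  else if `[< below_T F P >] then aP P + aP P - c P else c P.

Definition off (P : pt) := ~ in_T F P /\ ~ below_T F P.

Lemma push_T P : in_T F P -> push P = aP P.
Proof. by rewrite /push => /asboolP ->. Qed.

Lemma push_below P : below_T F P -> push P = aP P + aP P - c P.
Proof.
move=> b; rewrite /push; case: asboolP => [[_ z]|_]; last by case: asboolP.
by case: b => _ _ _; rewrite z ltxx.
Qed.

Lemma push_off P : off P -> push P = c P.
Proof. by rewrite /push => -[h1 h2]; do 2 case: asboolP => //. Qed.

Lemma lim_off M U v : germ M U off -> lim c M U v <-> lim push M U v.
Proof.
move=> g; split=> L; apply: germ_sub (germ_and g L) => P [o <-]; by rewrite push_off.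
Qed.

Lemma lim_below M U v k : germ M U (below_T F) -> germ M U (fun P => aP P = k) ->
  lim c M U v -> lim push M U (k + k - v).
Proof.
move=> g gk L; apply: germ_sub (germ_and g (germ_and gk L)) => P [b [<- <-]].
by rewrite push_below.
Qed.

Lemma lim_T M U v : germ M U (in_T F) -> lim aP M U v -> lim push M U v.
Proof.
move=> g L; apply: germ_sub (germ_and g L) => P [h <-]; by rewrite push_T.
Qed.

Lemma off_dirs M U : ~ T (X M) (Y M) \/ 0 < Z M -> germ M U off.
Proof.
case=> [nT|z]; last first.
  by apply: germ_sub (germ_pos U (@affine_fZ R F) z) => P zP; split=> -[] *; lra.
have : X M < 0 \/ Y M < 0 \/ 1 - X M - Y M < 0.
  have [h1|h1] := ltP (X M) 0; first by left.
  have [h2|h2] := ltP (Y M) 0; first by right; left.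
  have [h3|h3] := ltP (1 - X M - Y M) 0; first by right; right.
  by case: nT; split; lra.
case=> [h|[h|h]].
- by apply: germ_sub (germ_neg U (@affine_fX R F) h) => P zP; split=> [[[]]|[]] *; lra.
- by apply: germ_sub (germ_neg U (@affine_fY R F) h) => P zP; split=> [[[]]|[]] *; lra.
- by apply: germ_sub (germ_neg U (@affine_f3 R F) h) => P zP; split=> [[[]]|[]] *; lra.
Qed.

Lemma below_dirs M U : below_T F M -> germ M U (below_T F).
Proof.
move=> [h1 h2 h3 h4].
apply: germ_sub (germ_and (germ_pos U (@affine_fX R F) h1) (germ_and
  (germ_pos U (@affine_fY R F) h2) (germ_and (germ_pos U (@affine_f3 R F) h3)
  (germ_neg U (@affine_fZ R F) h4)))) => P [? [? [? ?]]]; by split.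
Qed.

Lemma below_in P : below_T F P -> T (X P) (Y P).
Proof. by move=> [h1 h2 h3 h4]; split; lra. Qed.

Lemma gam'_in_T N : on_edges EG' N -> in_T F N.
Proof. by move=> o; have [z t _] := gam_pt H hG' o; split. Qed.

Lemma gam_in_T N : on_edges EG N -> in_T F N.
Proof. by move=> o; have [z t _] := gam_pt H hG o; split. Qed.

Lemma on_ES' N : on_edges ES' N -> on_edges EG' N \/ on_edges Ed N.
Proof. by move=> [U [W [/in_edges_cat[e|e] s]]]; [left|right]; exists U, W. Qed.

Lemma on_ES N : on_edges ES N -> on_edges EG N \/ on_edges Ed N.
Proof. by move=> [U [W [/in_edges_cat[e|e] s]]]; [left|right]; exists U, W. Qed.

Lemma in_T_end N : in_T F N -> on_edges Ed N -> N = A \/ N = B.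
Proof. by move=> [t z] [U [W [e s]]]; exact: (md_touch H e s t z). Qed.

Lemma Lim_off N v : ~ T (X N) (Y N) \/ 0 < Z N -> Lim ES c N v -> Lim ES' push N v.
Proof.
move=> h L U W /in_edges_cat[e|e] s n.
  have [t z] : in_T F N by apply: gam'_in_T; exists U, W.
  by case: h => [//|]; rewrite z ltxx.
by apply/lim_off; [exact: off_dirs|apply: L (ES_Ed _ e) s n].
Qed.

Lemma Lim_below N v k : below_T F N ->
  nb (X N) (Y N) (fun z1 z2 => T z1 z2 -> a z1 z2 = k) ->
  Lim ES c N v -> Lim ES' push N (k + k - v).
Proof.
move=> b hk L U W /in_edges_cat[e|e] s n.
  have [t z] : in_T F N by apply: gam'_in_T; exists U, W.
  by case: b => _ _ _; rewrite z ltxx.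
have g := below_dirs U b.
apply: lim_below => //; last by apply: L (ES_Ed _ e) s n.
by apply: (germ_a hk); apply: germ_sub g; exact: below_in.
Qed.

Lemma germ_side U W M : EG' U W -> segment U W M -> germ M U (in_T F).
Proof.
move=> e [t t01 <-]; have := germ_gam H hG' e t01 (or_introl erefl).
by apply: germ_sub => N [].
Qed.

Lemma near_none N : in_T F N -> (forall N', ~ strand F E0 (X N) (Y N) N') ->
  nb (X N) (Y N) (fun z1 z2 => T z1 z2 -> a z1 z2 = aP N).
Proof.
move=> [t z] none.
have [->|nA] := pselect (N = A); first by apply: a_near; left.
have [->|nB] := pselect (N = B); first by apply: a_near; right.
have [yA yB] := planar_not_end H nA nB z.
by have [r _] := a_rule t; apply: r.
Qed.

Lemma Lim_T N : in_T F N -> (forall N', ~ strand F E0 (X N) (Y N) N') ->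
  Lim ES' push N (aP N).
Proof.
move=> iT none U W /in_edges_cat[e|e] s n; have hk := near_none iT none.
  have g := germ_side e s.
  by apply: lim_T => //; apply: (germ_a hk); apply: germ_sub g => P [].
have eD : N = A \/ N = B by apply: in_T_end => //; exists U, W.
have L := LD eD (ES_Ed _ e) s n.
have [g|g] := germ_off_below H e s n; first exact/(lim_off _ g).
(* An edge that goes down from an end is reflected in its own colour, which changes nothing. *)
have -> : aP N = aP N + aP N - aP N by rewrite addrK.
by apply: lim_below => //; apply: (germ_a hk); apply: germ_sub g; exact: below_in.
Qed.

(** General position makes an edge that passes below a side of the triangle cross the wall of the
    prism transversally: it enters in one direction and leaves in the other. *)
Lemma side_dirs U W M x : Ed U W -> segment U W M -> on_edges (in_edges (g1 ++ g2)) x ->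
  X M = X x -> Y M = Y x -> Z M < 0 ->
  [/\ M <> U, M <> W, x <> A /\ x <> B &
    (germ M U (below_T F) /\ germ M W off) \/ (germ M U off /\ germ M W (below_T F))].
Proof.
have [xA yA zA] := md_A H; have [xB yB zB] := md_B H; have [xC yC zC] := md_C H.
move=> e s [P [Q [eP sP]]] eX eY z.
have [zx Tx _] := side_pt H eP sP.
have nMx : M <> x by move=> h; rewrite h zx ltxx in z.
have [nU nW cr] := md_gen2 H (EdA0 e) (EdAg eP) s sP eX eY nMx.
have [nP nQ _] := md_gen2 H (EdAg eP) (EdA0 e) sP s (esym eX) (esym eY) (nesym nMx).
have [xnA xnB xnC] := side_interior H eP (And3 sP nP nQ).
have [t /andP[t0 t1] eM] := interiorP (md_pd H (EdA0 e)) (And3 s nU nW).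
split=> //.
have dU := germ_off_below H e s (nesym nU).
have dW := germ_off_below H (in_edgesC e) (segmentC s) (nesym nW).
(* [f] is the affine function of the wall through [M]; [g] and [h] belong to the two other walls. *)
have main (f g h : pt -> R) : affine_pt f -> affine_pt g -> affine_pt h ->
    (forall N, below_T F N <-> [/\ 0 < f N, 0 < g N, 0 < h N & Z N < 0]) ->
    f M = 0 -> 0 < g M -> 0 < h M -> ~ (f U = 0 /\ f W = 0) ->
    (germ M U (below_T F) /\ germ M W off) \/ (germ M U off /\ germ M W (below_T F)).
  move=> af ag ah bel fM gM hM nf.
  have fMt : (1 - t) * f U + t * f W = 0 by rewrite -af -eM.
  have pos D : germ M D (below_T F) -> 0 < f D.
    move=> /germ_ex [r /andP[r0 r1] /bel []]; rewrite af fM mulr0 add0r.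
    by rewrite pmulr_rgt0.
  have npos D : germ M D off -> f D <= 0.
    move=> o; have [//|fD] := leP (f D) 0.
    have fp : germ M D (fun N => 0 < f N).
      by exists 1 => // r r0 r1; rewrite af fM mulr0 add0r mulr_gt0.
    have [r _ [[_ nb] k]] := germ_ex (germ_and o (germ_and fp (germ_and
      (germ_pos D ag gM) (germ_and (germ_pos D ah hM) (germ_neg D (@affine_fZ R F) z))))).
    by case: nb; apply/bel; case: k => ? [? [? ?]]; split.
  case: dU dW => [oU|bU] [oW|bW].
  - exfalso; apply: nf; have hU := npos _ oU; have hW := npos _ oW.
    by split; nra.
  - by right.
  - by left.
  - by exfalso; have hU := pos _ bU; have hW := pos _ bW; nra.
have aX := @affine_fX R F; have aY := @affine_fY R F; have a3 := @affine_f3 R F.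
have zM : Z M < 0 := z.
have Dx D : (X x, Y x) = (X D, Y D) -> Z D = 0 -> x = D.
  by move=> [? ?] zD; apply: (@frame_inj _ F) => //; rewrite zD.
have [h1 h2 h3] := Tx.
have caseP (P' Q' : pt) : (P', Q') \in g1 ++ g2 -> segment P' Q' x -> cross F U W P' Q' <> 0 ->
    (germ M U (below_T F) /\ germ M W off) \/ (germ M U off /\ germ M W (below_T F)).
  have strict (u v : R) : 0 <= u -> v <= 1 -> (u <> 0) -> (v <> 1) -> 0 < u /\ v < 1.
    by move=> ? ? /eqP ? /eqP ?; rewrite !lt_neqAle eq_sym; split; apply/andP.
  rewrite !inE => /or3P[] /eqP[-> ->] [r _ ex] cr'.
  - have y0 : Y x = 0 by rewrite -ex affY yA yB; ring.
    have [||p q] := strict (X x) (X x + Y x) h1 h3.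
    + by move=> x0; apply: xnA; apply: Dx; rewrite ?xA ?yA ?x0 ?y0.
    + by move=> x1; apply: xnB; apply: Dx; rewrite ?xB ?yB ?y0 // (_ : X x = 1) //; lra.
    apply: (main _ _ _ aY aX a3); rewrite ?eX ?eY //; first by move=> N; split=> -[].
      by lra.
    by move=> [yU yW]; apply: cr'; rewrite /cross xA xB yA yB yU yW; ring.
  - have x0 : X x = 0 by rewrite -ex affX xA xC; ring.
    have [||p q] := strict (Y x) (X x + Y x) h2 h3.
    + by move=> y0; apply: xnA; apply: Dx; rewrite ?xA ?yA ?x0 ?y0.
    + by move=> x1; apply: xnC; apply: Dx; rewrite ?xC ?yC ?x0 // (_ : Y x = 1) //; lra.
    apply: (main _ _ _ aX aY a3); rewrite ?eX ?eY //.
      by lra.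
    by move=> [yU yW]; apply: cr'; rewrite /cross xA xC yA yC yU yW; ring.
  - have e1 : X x + Y x = 1 by rewrite -ex affX affY xB xC yB yC; ring.
    have p : 0 < X x.
      rewrite lt_neqAle h1 andbT eq_sym; apply/eqP => x0; apply: xnC; apply: Dx => //.
      by rewrite xC yC x0 (_ : Y x = 1) //; lra.
    have q : 0 < Y x.
      rewrite lt_neqAle h2 andbT eq_sym; apply/eqP => y0; apply: xnB; apply: Dx => //.
      by rewrite xB yB y0 (_ : X x = 1) //; lra.
    apply: (main _ _ _ a3 aX aY); rewrite ?eX ?eY //; first by move=> N; split=> -[].
      by lra.
    by move=> [yU yW]; apply: cr'; rewrite /cross xB xC yB yC; lra.
case: eP => eP; first exact: caseP eP sP cr.
apply: caseP eP (segmentC sP) _ => h; apply: cr.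
by move: h; rewrite /cross; lra.
Qed.

Lemma sides_on_gam x : on_edges (in_edges (g1 ++ g2)) x -> on_edges EG x \/ on_edges EG' x.
Proof.
by move=> [U [W [/(sides_gam hG)[e|e] s]]]; [left|right]; exists U, W.
Qed.

Lemma gam_on_sides x : on_edges EG x -> on_edges (in_edges (g1 ++ g2)) x.
Proof. by move=> [U [W [/(gam_sides hG) e s]]]; exists U, W. Qed.

Lemma gam'_on_sides x : on_edges EG' x -> on_edges (in_edges (g1 ++ g2)) x.
Proof. by move=> [U [W [/(gam_sides hG') e s]]]; exists U, W. Qed.

Lemma on_sides_EdA x : on_edges (in_edges (g1 ++ g2)) x -> on_edges EdA x.
Proof. by apply: sub_on_edges => U W; exact: EdAg. Qed.

Lemma gam_meet x : on_edges EG x -> on_edges EG' x -> x = A \/ x = B.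
Proof.
have [xA yA zA] := md_A H; have [xB yB zB] := md_B H; have [xC yC zC] := md_C H.
have main : on_edges (in_edges g1) x -> on_edges (in_edges g2) x -> x = A \/ x = B.
  move=> [U [W [e s]]] [U' [W' [e' s']]].
  have y0 : Y x = 0.
    by case: e s; rewrite inE => /eqP[-> ->] [r _ <-]; rewrite affY yA yB; ring.
  have [zx _ _] := side_pt H (proj2 (in_edges_cat _ _ _ _) (or_introl e)) s.
  have : X x = 0 \/ X x + Y x = 1.
    case: e' s'; rewrite !inE => /orP[] /eqP[-> ->] [r _ <-];
      rewrite !affX ?affY ?xA ?xB ?xC ?yA ?yB ?yC; [left|right|left|right]; ring.
  case=> h; [left|right]; apply: (@frame_inj _ F); rewrite ?xA ?yA ?zA ?xB ?yB ?zB //; lra.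
by case: hG => -[-> ->] h h'; apply: main.
Qed.

Lemma interior_dirs M w v U W : Ed U W -> interior U W M ->
  lim push M U v -> lim push M W w ->
  forall U' W', ES' U' W' -> ~ in_T F M -> segment U' W' M -> U' <> M ->
  (U' = U /\ lim push M U' v) \/ (U' = W /\ lim push M U' w).
Proof.
move=> e i Lv Lw U' W' /in_edges_cat[e'|e'] nT s n.
  by case: nT; apply: gam'_in_T; exists U', W'.
case: (md_simple H e e' i s) => -[eU eW]; first by left; rewrite -eU.
by right; rewrite -eW.
Qed.

(** The position of the lower point [M] decides. In the walls of the prism a crossing with the old
    path disappears and a crossing with the new one appears; inside, the terms of a crossing
    relation are reflected; away from the triangle nothing changes. *)
Lemma push_coloring : coloring F ES' push.
Proof.
have [xA yA zA] := md_A H; have [xB yB zB] := md_B H.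
have endT D : D = A \/ D = B -> in_T F D.
  by case=> ->; split=> //; rewrite ?xA ?yA ?xB ?yB; split; lra.
have no_strand M : Z M <= 0 -> (forall N, ~ above F ES' M N) ->
    forall N, ~ strand F E0 (X M) (Y M) N.
  by move=> z na N sN; apply: (na N); apply: strand_above sN.
have above_Ed M N : above F ES M N -> Z M < 0 \/ on_edges Ed N.
  by move=> [/on_ES[/gam_in_T [_ z]|o] _ _ zM]; [left; rewrite -z|right].
have ES'_above M N : on_edges Ed N -> above F ES M N -> above F ES' M N.
  move=> o [_ eX eY z]; split=> //; apply: sub_on_edges o => P Q; exact: ES_Ed.
have ES_above M N : on_edges Ed N -> above F ES' M N -> above F ES M N.
  move=> o [_ eX eY z]; split=> //; apply: sub_on_edges o => P Q; exact: ES_Ed.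
move=> U W M eE s; split.
- move=> na.
  have [iT|nT] := pselect (in_T F M).
    exists (aP M); apply: Lim_T => //; apply: no_strand => //; by case: iT => _ ->.
  have eEd : Ed U W.
    by move: eE => /in_edges_cat[e|//]; case: nT; apply: gam'_in_T; exists U, W.
  have sub U0 W0 : ES U0 W0 -> on_edges Ed M by exists U, W.
  have [colM _] := col (ES_Ed Gam eEd) s.
  have [[TM zM]|out] := pselect (T (X M) (Y M) /\ Z M < 0); last first.
    have out' : ~ T (X M) (Y M) \/ 0 < Z M.
      have [t|] := pselect (T (X M) (Y M)); last by left.
      right; rewrite lt_neqAle leNgt eq_sym; apply/andP; split.
        by apply/eqP => z; apply: nT; split.
      by apply/negP => z; apply: out; split.
    have [N ab|v L] := colM _.
      have [oN eX eY zN] := ab.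
      case: (on_ES oN) => [/gam_in_T [t z]|o]; last exact: na (ES'_above _ _ o ab).
      apply: out; split; first by rewrite -eX -eY.
      by rewrite -z.
    by exists v; exact: Lim_off.
  have none := no_strand M (ltW zM) na.
  have [[x [ox [eX eY]]]|noside] := pselect (exists x, on_edges (in_edges (g1 ++ g2)) x /\
       X x = X M /\ Y x = Y M); last first.
    have b : below_T F M.
      have [h1 h2 h3] := TM; split=> //; last 1 first.
      - rewrite lt_neqAle eq_sym; apply/andP; split; last lra.
        apply/eqP => h; apply: noside; have [|x ox [eX eY]] := side_above H TM; last by exists x.
        by constructor 3; lra.
      - rewrite lt_neqAle eq_sym h1 andbT; apply/eqP => h; apply: noside.
        by have [|x ox [eX eY]] := side_above H TM; [constructor 1|exists x].
      - rewrite lt_neqAle eq_sym h2 andbT; apply/eqP => h; apply: noside.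
        by have [|x ox [eX eY]] := side_above H TM; [constructor 2|exists x].
    have [N ab|v L] := colM _.
      have [oN eX eY zN] := ab.
      case: (on_ES oN) => [o|o]; last exact: na (ES'_above _ _ o ab).
      by apply: noside; exists N; split; [exact: gam_on_sides|].
    have [r1 _] := a_rule TM.
    have {r1} hk : nb (X M) (Y M) (fun z1 z2 => T z1 z2 -> a z1 z2 = aP M).
      case: b => b1 b2 b3 _; apply: r1 => //; case; lra.
    by exists (aP M + aP M - v); exact: Lim_below.
  (* Under the new path, [x] would be above [M]. Under the old one a crossing is removed: the
     relation [v + w = k + k] says that the reflection on the prism side makes the two limits
     equal. *)
  case: (sides_on_gam ox) => ox'; last first.
    exfalso; apply: (na x); split=> //; last by have [_ ->] := gam'_in_T ox'.
    by apply: sub_on_edges ox' => P Q; exact: ES_EG.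
  have [nU nW [xnA xnB] dirs] := side_dirs eEd s ox (esym eX) (esym eY) zM.
  have [Tx zx] := gam_in_T ox'.
  have ab : above F ES M x.
    split=> //; last by rewrite zx.
    by apply: sub_on_edges ox' => P Q; exact: ES_EG.
  have [_ colM'] := col (ES_Ed Gam eEd) s.
  have [v [w [k [Lv Lw Lk vw]]]] := colM' x nU nW ab.
  have none' N : ~ strand F E0 (X x) (Y x) N by rewrite eX eY.
  have hk := near_none (conj Tx zx) none'; rewrite eX eY in hk.
  (* The colour of the old path at [x] is that of the shadow, by [agr]. *)
  have ek : aP x = k.
    have [P [Q [eP sP]]] := ox'.
    have pdP := md_pd H (EdAg (gam_sides hG eP)).
    have [P' [Q' [eP' sP' nP']]] : exists P' Q', [/\ EG P' Q', segment P' Q' x & P' <> x].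
      have [h|h] := pselect (P = x); last by exists P, Q.
      exists Q, P; split; [exact: in_edgesC|exact: segmentC|].
      by move=> h'; case: pdP; rewrite h h'.
    have [k' Lc La] := agr eP' sP' nP'.
    have := Lk _ _ (ES_EG E0 eP') sP' nP' => Lk'.
    rewrite (lim_uniq Lk' Lc); apply: lim_uniq La.
    have [P2 [Q2 [eP2 sP2 nP2]]] : exists P' Q', [/\ EG P' Q', segment P' Q' x & P' <> x] by exists P', Q'.
    have [t t01 ex] := sP'.
    have g := germ_gam H hG eP' t01 (or_introl erefl); rewrite ex in g.
    have hk' := near_none (conj Tx zx) none'.
    by apply: (germ_a hk'); apply: germ_sub g => N [].
  rewrite -ek in vw.
  have gT D : germ M D (below_T F) -> germ M D (fun P => aP P = aP x).
    by rewrite eX eY => g; apply: (germ_a hk); apply: germ_sub g; exact: below_in.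
  have [r [Lr1 Lr2]] : exists r, lim push M U r /\ lim push M W r.
    case: dirs => -[d1 d2].
      exists w; split; last exact/lim_off.
      have -> : w = aP x + aP x - v by rewrite -vw; ring.
      by apply: lim_below => //; exact: gT.
    exists v; split; first exact/lim_off.
    have -> : v = aP x + aP x - w by rewrite -vw; ring.
    by apply: lim_below => //; exact: gT.
  exists r => U' W' eE' s' n'.
  by case: (interior_dirs eEd (And3 s nU nW) Lr1 Lr2 eE' nT s' n') => -[_].
- move=> N nU nW ab.
  have [oN eX eY zN] := ab.
  have oM : on_edges EdA M by exists U, W; split=> //; exact: ES_EdA hG' _ _ eE.
  have oN' : on_edges EdA N by apply: sub_on_edges oN => P Q; exact: ES_EdA hG' _ _.
  have nNM : N <> M by move=> h; rewrite h ltxx in zN.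
  have third P : on_edges EdA P -> X P = X M -> Y P = Y M -> P = M \/ P = N.
    move=> oP pX pY; apply: (md_gen3 H oM oN' oP) => //; exact: nesym.
  have not_end D : D = A \/ D = B -> on_edges EdA D -> X D = X M -> Y D = Y M -> False.
    move=> eD oD dX dY.
    have := above_end H eD oM (esym dX) (esym dY) => eM.
    have := above_end H eD oN' (etrans eX (esym dX)) (etrans eY (esym dY)) => eN.
    by apply: nNM; rewrite eM eN.
  have [U' [W' [eN' sN']]] := oN.
  have [n1 n2 _] := md_gen2 H (ES_EdA hG' eN') (ES_EdA hG' eE) sN' s eX eY nNM.
  have [_ _ cr] := md_gen2 H (ES_EdA hG' eE) (ES_EdA hG' eN') s sN' (esym eX) (esym eY) (nesym nNM).
  have iN : interior U' W' N by split.
  have iM : interior U W M by split.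
  have [t t01 eM] := interiorP (md_pd H (ES_EdA hG' eE)) iM.
  have only_above y1 y2 : X M = y1 -> Y M = y2 -> Z M <= 0 -> forall N', strand F E0 y1 y2 N' -> N' = N.
    move=> <- <- z N' [o' X' Y' z'].
    have oA' : on_edges EdA N' by apply: sub_on_edges o'; exact: EdA0.
    case: (third _ oA' X' Y') => // h.
    by move: z'; rewrite h ltNge z.
  (* Covers a strand below the triangle as well as the new path itself. *)
  have upper : Ed U' W' -> 0 < Z N -> T (X M) (Y M) -> Z M <= 0 ->
      germ M U (fun P => T (X P) (Y P)) -> germ M W (fun P => T (X P) (Y P)) ->
      exists v w k, [/\ lim aP M U v, lim aP M W w, Lim ES c N k, Lim ES' push N k & v + w = k + k].
    move=> eEd zN0 TM zM gU gW.
    have sN : strand F E0 (X M) (Y M) N.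
      by split=> //; exists U', W'.
    have uN := only_above _ _ erefl erefl zM.
    have [colN _] := col (ES_Ed Gam eEd) sN'.
    have [N' [oN1 X1 Y1 z1]|k L] := colN _.
      have oA1 : on_edges EdA N' by apply: sub_on_edges oN1 => P Q; exact: (ES_EdA hG).
      case: (third _ oA1 (etrans X1 eX) (etrans Y1 eY)) => h; rewrite h in z1.
        by have := lt_trans z1 zN; rewrite ltxx.
      by rewrite ltxx in z1.
    have Lk : Lim Ed c N k by apply: Lim_sub L => P Q; exact: ES_Ed.
    have L' : Lim ES' push N k by apply: Lim_off => //; right.
    have := @shadow_cross R V F A B C E0 H c a a_rule U W t U' W' N k t01.
    rewrite -eM => /(_ TM eEd iN sN uN Lk cr gU gW) [v [w [Lv Lw vw]]].
    by exists v, w, k; split.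
  move: eE => /in_edges_cat[eG|eEd].
    have [TM zM] : in_T F M by apply: gam'_in_T; exists U, W.
    have eEd' : Ed U' W'.
      move: eN' => /in_edges_cat[eG'|//].
      have [_ z] : in_T F N by apply: gam'_in_T; exists U', W'.
      by rewrite z zM ltxx in zN.
    have gU := germ_side eG s; have gW := germ_side (in_edgesC eG) (segmentC s).
    have TT D : germ M D (in_T F) -> germ M D (fun P => T (X P) (Y P)).
      by apply: germ_sub => P [].
    have zN0 : 0 < Z N by rewrite -zM.
    have [|v [w [k [Lv Lw _ L' vw]]]] := upper eEd' zN0 TM _ (TT _ gU) (TT _ gW).
      by rewrite zM.
    by exists v, w, k; split=> //; exact: lim_T.
  have oMd : on_edges Ed M by exists U, W.
  have nT : ~ in_T F M.
    move=> iT; have eD := in_T_end iT oMd; exact: (not_end M).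
  have [_ colM'] := col (ES_Ed Gam eEd) s.
  have [[TM zM]|out] := pselect (T (X M) (Y M) /\ Z M < 0); last first.
    have out' : ~ T (X M) (Y M) \/ 0 < Z M.
      have [tM|] := pselect (T (X M) (Y M)); last by left.
      right; rewrite lt_neqAle leNgt eq_sym; apply/andP; split.
        by apply/eqP => z; apply: nT; split.
      by apply/negP => z; apply: out; split.
    have oNd : on_edges Ed N.
      case: (on_ES' oN) => // /gam'_in_T [tN z]; case: out'.
        by rewrite -eX -eY.
      by move=> zM0; have := lt_trans zM0 zN; rewrite z ltxx.
    have [v [w [k [Lv Lw Lk vw]]]] := colM' N nU nW (ES_above _ _ oNd ab).
    exists v, w, k; split=> //.
    + by apply/lim_off => //; exact: off_dirs.
    + by apply/lim_off => //; exact: off_dirs.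
    + apply: Lim_off => //; rewrite eX eY; case: out' => h; [by left|right; exact: lt_trans h zN].
  case: (on_ES' oN) => [oG|oNd].
    (* A crossing with the new path is created: the two lower colours are the old colour and its
       reflection in the shadow colour of the path. *)
    have [TN zN0] := gam'_in_T oG.
    have none N' : ~ strand F E0 (X N) (Y N) N'.
      rewrite eX eY => sN0; have h := only_above _ _ erefl erefl (ltW zM) _ sN0.
      by case: sN0; rewrite h zN0 ltxx.
    have [_ _ [xnA xnB] dirs] := side_dirs eEd s (gam'_on_sides oG) (esym eX) (esym eY) zM.
    have [colM _] := col (ES_Ed Gam eEd) s.
    have [N' [oN1 X1 Y1 z1]|v L] := colM _.
      have oA1 : on_edges EdA N' by apply: sub_on_edges oN1 => P Q; exact: (ES_EdA hG).
      case: (third _ oA1 X1 Y1) => h; rewrite h in oN1 z1; first by rewrite ltxx in z1.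
      case: (on_ES oN1) => [oG1|oNd]; first by case: (gam_meet oG1 oG).
      by case: (in_T_end (conj TN zN0) oNd).
    have Lv := L _ _ (ES_Ed Gam eEd) s (nesym nU).
    have Lw := L _ _ (in_edgesC (ES_Ed Gam eEd)) (segmentC s) (nesym nW).
    have hk := near_none (conj TN zN0) none; rewrite eX eY in hk.
    have gT D : germ M D (below_T F) -> germ M D (fun P => aP P = aP N).
      by rewrite eX eY => g; apply: (germ_a hk); apply: germ_sub g; exact: below_in.
    have LN := Lim_T (conj TN zN0) none.
    case: dirs => -[d1 d2].
      exists (aP N + aP N - v), v, (aP N); split=> //; last by ring.
        by apply: lim_below => //; exact: gT.
      exact/lim_off.
    exists v, (aP N + aP N - v), (aP N); split=> //; last by ring.
      exact/lim_off.
    by apply: lim_below => //; exact: gT.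
  have noside x : on_edges (in_edges (g1 ++ g2)) x -> X x = X M -> Y x = Y M -> False.
    move=> ox xX xY; have [_ zx] : in_T F x.
      by case: (sides_on_gam ox) => [/gam_in_T|/gam'_in_T].
    case: (third _ (on_sides_EdA ox) xX xY) => h; first by rewrite -h zx ltxx in zM.
    have iT : in_T F N by rewrite -h; split=> //; rewrite h eX eY.
    by have := in_T_end iT oNd => eD; exact: (not_end N).
  have b : below_T F M.
    have [h1 h2 h3] := TM; split=> //; last 1 first.
    - rewrite lt_neqAle eq_sym; apply/andP; split; last lra.
      apply/eqP => h; have [|x ox [eX' eY']] := side_above H TM; last exact: noside ox eX' eY'.
      by constructor 3; lra.
    - rewrite lt_neqAle eq_sym h1 andbT; apply/eqP => h.
      by have [|x ox [eX' eY']] := side_above H TM; [constructor 1|exact: noside ox eX' eY'].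
    - rewrite lt_neqAle eq_sym h2 andbT; apply/eqP => h.
      by have [|x ox [eX' eY']] := side_above H TM; [constructor 2|exact: noside ox eX' eY'].
  have [v [w [k [Lv Lw Lk vw]]]] := colM' N nU nW (ES_above _ _ oNd ab).
  have gU := below_dirs U b; have gW := below_dirs W b.
  have TT D : germ M D (below_T F) -> germ M D (fun P => T (X P) (Y P)).
    by apply: germ_sub => P; exact: below_in.
  have eEd' : Ed U' W'.
    move: eN' => /in_edges_cat[eG'|//]; exfalso; apply: (noside N) => //.
    by apply: gam'_on_sides; exists U', W'.
  have [zN0|zN0|zN0] := ltgtP (Z N) 0; last first.
  + exfalso; have iT : in_T F N by split=> //; rewrite eX eY.
    have := in_T_end iT oNd => eD; exact: (not_end N).
  (* Here [N] is above the triangle, and the shadow jumps from [v'] to [w'] with [v' + w' = k + k].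
     Twice this relation minus [v + w = k + k] is the new relation. *)
  + have [v' [w' [k' [Lv' Lw' Lk1 Lk' vw']]]] := upper eEd' zN0 TM (ltW zM) (TT _ gU) (TT _ gW).
    have ek : k' = k.
      apply: lim_uniq (Lk1 _ _ (ES_Ed Gam eEd') sN' (nesym n1)) _.
      exact: Lk (ES_Ed Gam eEd') sN' (nesym n1).
    subst k'.
    exists (v' + v' - v), (w' + w' - w), k; split=> //.
    * by apply: lim_below => //.
    * by apply: lim_below => //.
    * have -> : w' = k + k - v' by rewrite -vw'; ring.
      have -> : w = k + k - v by rewrite -vw; ring.
      ring.
  (* Here [N] is in the prism too: all three colours are reflected in one shadow colour, and a
     reflection is affine. *)
  + have none N' : ~ strand F E0 (X M) (Y M) N'.
      move=> sN0; have h := only_above _ _ erefl erefl (ltW zM) _ sN0.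
      by case: sN0 => _ _ _; rewrite h ltNge (ltW zN0).
    have [r1 _] := a_rule TM.
    have {r1} hk : nb (X M) (Y M) (fun z1 z2 => T z1 z2 -> a z1 z2 = aP M).
      case: (b) => b1 b2 b3 _; apply: r1 => //; case; lra.
    have bN : below_T F N by case: (b) => b1 b2 b3 _; split; rewrite ?eX ?eY.
    exists (aP M + aP M - v), (aP M + aP M - w), (aP M + aP M - k); split.
    * by apply: lim_below => //; exact: germ_a hk (TT _ gU).
    * by apply: lim_below => //; exact: germ_a hk (TT _ gW).
    * by apply: Lim_below => //; rewrite eX eY.
    * have -> : w = k + k - v by rewrite -vw; ring.
      ring.
Qed.

Hypothesis a_const : forall v0, (forall U W N v, Ed U W -> segment U W N -> U <> N ->
   0 <= Z N -> T (X N) (Y N) -> lim c N U v -> v = v0) -> aP A = v0 ->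
   forall y1 y2, T y1 y2 -> a y1 y2 = v0.

(** A constant pushed colouring gives the ends and all strands above the triangle the colour [v0],
    so the shadow is [v0] everywhere; undoing the reflections in [v0] shows that [c] was
    constant. *)
Lemma push_monochromatic v0 : monochromatic ES' push v0 -> monochromatic ES c v0.
Proof.
have [xA yA zA] := md_A H; have [xB yB zB] := md_B H.
have endT D : D = A \/ D = B -> in_T F D.
  by case=> ->; split=> //; rewrite ?xA ?yA ?xB ?yB; split; lra.
move=> cst.
have end0 D : D = A \/ D = B -> aP D = v0.
  move=> eD; have [U eU] := end_edge hG' eD.
  have nU : U <> D by exact: nesym (gam_neq H hG' eU).
  have sD := segment_start D U.
  have g := germ_side (in_edgesC eU) (segmentC sD).
  apply: (cst U D D) => //; [exact: in_edgesC (ES_EG _ eU)|exact: segmentC|].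
  apply: lim_T => //; apply: (germ_a (a_near eD)).
  by apply: germ_sub g => P [].
have up0 U W N v : Ed U W -> segment U W N -> U <> N -> 0 <= Z N -> T (X N) (Y N) ->
    lim c N U v -> v = v0.
  move=> e s n; rewrite le_eqVlt => /orP[/eqP z|z] t L.
    have eD : N = A \/ N = B by apply: (md_touch H e s t).
    by rewrite -(end0 N eD); apply: lim_uniq L (LD eD (ES_Ed Gam e) s n).
  apply: (cst U W N) => //; first exact: ES_Ed.
  by apply/lim_off => //; apply: off_dirs; right.
have a0 : forall y1 y2, T y1 y2 -> a y1 y2 = v0.
  by apply: a_const => //; apply: end0; left.
move=> U W M v /in_edges_cat[e|e] s n L.
  have [w Lc La] := agr e s n; rewrite (lim_uniq L Lc).
  have [t t01 eM] := s.
  have g := germ_gam H hG e t01 (or_introl erefl); rewrite eM in g.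
  have [r _ [<- [Tr _]]] := germ_ex (germ_and La g).
  exact: a0.
case: (germ_off_below H e s n) => g.
  by apply: (cst U W M) => //; [exact: ES_Ed|exact/lim_off].
have ga : germ M U (fun P => aP P = v0).
  by apply: germ_sub g => P /below_in; exact: a0.
have := cst U W M (v0 + v0 - v) (ES_Ed _ e) s n (lim_below g ga L).
move/(congr1 (fun z => v0 + v0 - z)); rewrite opprB addrC subrK => ->.
by rewrite addrK.
Qed.

End NewColoring.

(** * Adapted coordinates and general position *)

Section Colorable.
Variables (R : realType) (V : comNzRingType).
Local Notation pt := 'rV[R]_3.

Lemma move_colorable (F : frame R) (A B C : pt) E0 Gam Gam' :
  move_data F A B C E0 ->
  (Gam = [:: (A, B)] /\ Gam' = [:: (A, C); (C, B)]) \/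
  (Gam = [:: (A, C); (C, B)] /\ Gam' = [:: (A, B)]) ->
  colorable V F (in_edges (Gam ++ E0)) -> colorable V F (in_edges (Gam' ++ E0)).
Proof.
move=> H hG [c col nc].
have sd := shadow_of_coloring H hG col.
have [xA yA zA] := md_A H.
have [k Lk] := end_Lim H hG col (or_introl (erefl A)).
have [a [a0 ar ae ac]] := shadow_exists sd k.
have a_start : Lim (in_edges (Gam ++ E0)) c A (a 0 0) by rewrite a0.
have [LD agr] := match_all H hG col ar ae a_start.
have near D (eD : D = A \/ D = B) := a_near_end ae eD (LD D eD).
exists (push F c a); first exact: (push_coloring H hG col ar near LD agr).
move=> v cst; apply: (nc v); apply: (push_monochromatic H hG near LD agr _ cst).
by move=> v0 h e; apply: ac => //; rewrite -e xA yA.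
Qed.

(** The vertical lines and the order on them are all that a colouring sees of a frame. *)
Definition frame_equiv (F F' : frame R) := forall M N,
  (fX F N = fX F M /\ fY F N = fY F M <-> fX F' N = fX F' M /\ fY F' N = fY F' M) /\
  (fX F N = fX F M -> fY F N = fY F M -> (fZ F M < fZ F N) = (fZ F' M < fZ F' N)).

Lemma above_equiv F F' E M N : frame_equiv F F' -> above F E M N <-> above F' E M N.
Proof.
move=> h; have [[h1 h2] h3] := h M N.
split=> -[o eX eY z].
  by have [eX' eY'] := h1 (conj eX eY); split=> //; rewrite -h3.
by have [eX' eY'] := h2 (conj eX eY); split=> //; rewrite h3.
Qed.

Lemma coloring_equiv F F' E (c : pt -> V) : frame_equiv F F' -> coloring F E c -> coloring F' E c.
Proof.
move=> h col U W M e s; have [c1 c2] := col U W M e s; split=> [na|N nU nW ab].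
  by apply: c1 => N /(above_equiv _ _ _ h); exact: na.
by apply: (c2 N) => //; apply/(above_equiv _ _ _ h).
Qed.

Lemma frame_equivC F F' : frame_equiv F F' -> frame_equiv F' F.
Proof.
move=> h M N; have [[h1 h2] h3] := h M N; split=> // eX eY.
by have [eX' eY'] := h2 (conj eX eY); rewrite h3.
Qed.

Lemma colorable_frame F F' E : frame_equiv F F' -> colorable V F E -> colorable V F' E.
Proof. by move=> h [c col nc]; exists c => //; exact: coloring_equiv col. Qed.

Section Normal.
Variables (F : frame R) (A B C : pt).
Local Notation X := (fX F).
Local Notation Y := (fY F).
Local Notation Z := (fZ F).
Hypothesis d0 : cross F A B A C != 0.
Local Notation d := (cross F A B A C).

(** Cramer's rule: the barycentric coordinates of the projected point with respect to [B] and [C].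
    The third coordinate below is the height over the plane [ABC] along the old vertical, so the
    direction of projection is kept. *)
Let X' (P : pt) := ((X P - X A) * (Y C - Y A) - (Y P - Y A) * (X C - X A)) / d.
Let Y' (P : pt) := ((X B - X A) * (Y P - Y A) - (Y B - Y A) * (X P - X A)) / d.
Let Z' (P : pt) := Z P - Z A - X' P * (Z B - Z A) - Y' P * (Z C - Z A).

Let invX P : X P = X A + X' P * (X B - X A) + Y' P * (X C - X A).
Proof. by rewrite /X' /Y'; have n0 := d0; rewrite /cross in n0 *; field. Qed.

Let invY P : Y P = Y A + X' P * (Y B - Y A) + Y' P * (Y C - Y A).
Proof. by rewrite /X' /Y'; have n0 := d0; rewrite /cross in n0 *; field. Qed.

Let aX' P Q t : X' (segment_pt P Q t) = (1 - t) * X' P + t * X' Q.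
Proof. by rewrite /X' affX affY; ring. Qed.

Let aY' P Q t : Y' (segment_pt P Q t) = (1 - t) * Y' P + t * Y' Q.
Proof. by rewrite /Y' affX affY; ring. Qed.

Let aZ' P Q t : Z' (segment_pt P Q t) = (1 - t) * Z' P + t * Z' Q.
Proof. by rewrite /Z' affZ aX' aY'; ring. Qed.

Let inj' P Q : X' P = X' Q -> Y' P = Y' Q -> Z' P = Z' Q -> P = Q.
Proof.
move=> eX eY; rewrite /Z' eX eY => eZ; apply: (@frame_inj _ F).
- by rewrite invX [RHS]invX eX eY.
- by rewrite invY [RHS]invY eX eY.
- by lra.
Qed.

Definition normal_frame : frame R := Frame aX' aY' aZ' inj'.

Lemma normal_equiv : frame_equiv F normal_frame.
Proof.
move=> M N; split; [split=> -[eX eY]|move=> eX eY] => /=.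
- by rewrite /X' /Y' eX eY.
- move: eX eY => /= eX eY.
  by split; [rewrite (invX N) (invX M) eX eY|rewrite (invY N) (invY M) eX eY].
- by rewrite /Z' /X' /Y' eX eY; apply/idP/idP; lra.
Qed.

Lemma normal_A : [/\ fX normal_frame A = 0, fY normal_frame A = 0 & fZ normal_frame A = 0].
Proof. by rewrite /= /Z' /X' /Y'; split; ring. Qed.

Lemma normal_B : [/\ fX normal_frame B = 1, fY normal_frame B = 0 & fZ normal_frame B = 0].
Proof. by rewrite /= /Z' /X' /Y'; have n0 := d0; rewrite /cross in n0 *; split; field. Qed.

Lemma normal_C : [/\ fX normal_frame C = 0, fY normal_frame C = 1 & fZ normal_frame C = 0].
Proof. by rewrite /= /Z' /X' /Y'; have n0 := d0; rewrite /cross in n0 *; split; field. Qed.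

Lemma normal_cross P Q P' Q' : cross normal_frame P Q P' Q' = cross F P Q P' Q' / d.
Proof. by have n0 := d0; rewrite {1}/cross /= /X' /Y'; rewrite /cross in n0 *; field. Qed.

End Normal.

(** Asked for all segments between points of [Om], not only for the edges of one knot: the sides of
    the triangles of all moves of an isotopy are then included. *)
Definition generic (F : frame R) (Om : seq pt) : Prop :=
  [/\ {in Om &, forall u v, u <> v -> planar_neq F u v},
      {in Om & &, forall u v w, u <> v -> cross F u v u w = 0 -> exists t, w = segment_pt u v t} &
      forall u1 w1 u2 w2 u3 w3 N1 N2 N3,
        u1 \in Om -> w1 \in Om -> u2 \in Om -> w2 \in Om -> u3 \in Om -> w3 \in Om ->
        u1 <> w1 -> u2 <> w2 -> u3 <> w3 ->
        segment u1 w1 N1 -> segment u2 w2 N2 -> segment u3 w3 N3 ->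
        fX F N1 = fX F N2 -> fY F N1 = fY F N2 -> fX F N1 = fX F N3 -> fY F N1 = fY F N3 ->
        N1 <> N2 -> N3 = N1 \/ N3 = N2].

Lemma generic_normal F A B C (d0 : cross F A B A C != 0) Om :
  generic F Om -> generic (normal_frame d0) Om.
Proof.
have eqv := normal_equiv d0.
move=> [h0 h1 h3]; split.
- move=> u v uO vO uv; have pn := h0 u v uO vO uv.
  have [[_ e] _] := eqv v u.
  have [eX|/eqP nX] := eqVneq (fX (normal_frame d0) u) (fX (normal_frame d0) v); last by left.
  right=> eY; have [eX' eY'] := e (conj eX eY).
  by case: pn => h; apply: h.
- move=> u v w uO vO wO uv; rewrite normal_cross => /eqP.
  by rewrite mulf_eq0 invr_eq0 (negbTE d0) orbF => /eqP; exact: h1.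
- move=> u1 w1 u2 w2 u3 w3 N1 N2 N3 o1 p1 o2 p2 o3 p3 n1 n2 n3 s1 s2 s3 eX eY eX' eY' n.
  have [[_ e] _] := eqv N2 N1; have [a1 a2] := e (conj eX eY).
  have [[_ e'] _] := eqv N3 N1; have [b1 b2] := e' (conj eX' eY').
  exact: (h3 u1 w1 u2 w2 u3 w3).
Qed.

(** If an endpoint lay over the line of the other segment, or if the projected lines were parallel,
    the second clause of [generic] would put the points on one line in space. The projection is
    injective there, contrary to [M <> N]. *)
Lemma generic_meet (F : frame R) (Om : seq pt) (U W U' W' M N : pt) :
  {in Om &, forall u v, u <> v -> planar_neq F u v} ->
  {in Om & &, forall u v w, u <> v -> cross F u v u w = 0 -> exists t, w = segment_pt u v t} ->
  U \in Om -> W \in Om -> U' \in Om -> W' \in Om -> U <> W -> U' <> W' ->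
  segment U W M -> segment U' W' N -> fX F M = fX F N -> fY F M = fY F N -> M <> N ->
  [/\ M <> U, M <> W & cross F U W U' W' <> 0].
Proof.
move=> h0 h1 uO wO uO' wO' n n' [t t01 eM] [t' t01' eN] eX eY nMN.
have pd' := h0 _ _ uO' wO' n'.
have on_line D : D \in Om -> cross F U' W' U' D = 0 -> exists r, D = segment_pt U' W' r.
  by move=> dO; apply: h1.
have endpt D : D \in Om -> fX F D = fX F N -> fY F D = fY F N -> D = N.
  move=> dO dX dY; have [|r er] := on_line D dO.
    rewrite /cross dX dY -eN affX affY; ring.
  have [_ e1] := lform_segment pd' (congr1 (fX F) eN) (congr1 (fY F) eN).
  rewrite er in dX dY; have [_ e2] := lform_segment pd' dX dY.
  by rewrite er -eN e1 e2.
split.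
- by move=> eU; apply: nMN; rewrite eU; apply: endpt => //; rewrite -eU.
- by move=> eU; apply: nMN; rewrite eU; apply: endpt => //; rewrite -eU.
move=> cr; apply: nMN.
have [mX mY] : fX F M = (1 - t) * fX F U + t * fX F W /\ fY F M = (1 - t) * fY F U + t * fY F W.
  by rewrite -eM affX affY.
have [nX nY] : fX F N = (1 - t') * fX F U' + t' * fX F W' /\
    fY F N = (1 - t') * fY F U' + t' * fY F W'.
  by rewrite -eN affX affY.
have eX2 : fX F U - fX F U' = t' * (fX F W' - fX F U') - t * (fX F W - fX F U) by lra.
have eY2 : fY F U - fY F U' = t' * (fY F W' - fY F U') - t * (fY F W - fY F U) by lra.
have cU : cross F U' W' U' U = 0.
  rewrite /cross eX2 eY2; transitivity (t * cross F U W U' W'); first by rewrite /cross; ring.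
  by rewrite cr mulr0.
have cW : cross F U' W' U' W = 0.
  transitivity (cross F U' W' U' U - cross F U W U' W'); first by rewrite /cross; ring.
  by rewrite cU cr subr0.
have [r1 e1] := on_line U uO cU; have [r2 e2] := on_line W wO cW.
have eM' : M = segment_pt U' W' ((1 - t) * r1 + t * r2).
  rewrite -eM e1 e2 /segment_pt; apply/rowP => k; rewrite !mxE; ring.
rewrite -eN eM' in eX eY *.
have [_ a1] := lform_segment pd' eX eY.
have [_ a2] := lform_segment pd' (erefl (fX F (segment_pt U' W' t'))) (erefl (fY F (segment_pt U' W' t'))).
by rewrite a1 [in RHS]a2.
Qed.

End Colorable.

(** * Invariance under isotopy *)

Section Polygons.
Variable R : realType.
Local Notation pt := 'rV[R]_3.
Implicit Types p q s : seq pt.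

(** A list of pairs rather than an indexed family: rotating the vertices rotates it, and reversing
    them swaps the pairs. *)
Definition edges p := zip p (rot 1 p).

Lemma zip_rot (S T : Type) n (s : seq S) (t : seq T) : size s = size t ->
  zip (rot n s) (rot n t) = rot n (zip s t).
Proof.
have zip_rot1 (u : seq S) (v : seq T) : size u = size v -> zip (rot 1 u) (rot 1 v) = rot 1 (zip u v).
  by case: u v => [|x u] [|y v] //= [e]; rewrite !rot1_cons zip_rcons.
move=> e; elim: n => [|n IH]; first by rewrite !rot0.
have [h|h] := ltnP n (size s).
  have ht : (n < size t)%N by rewrite -e.
  have hz : (n < size (zip s t))%N by rewrite size_zip -e minnn.
  by rewrite (rotS h) (rotS ht) (rotS hz) zip_rot1 ?size_rot // IH.
have h' := leqW h.
by rewrite !rot_oversize ?size_zip -?e ?minnn.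
Qed.

Lemma edges_rot k p : edges (rot k p) = rot k (edges p).
Proof. by rewrite /edges rot_rot zip_rot // size_rot. Qed.

Lemma mem_edges_rev p U W : ((U, W) \in edges (rev p)) = ((W, U) \in edges p).
Proof.
have swap (s t : seq pt) : size s = size t -> ((U, W) \in zip s t) = ((W, U) \in zip t s).
  elim: s t => [|x s IH] [|y t] //= [e]; rewrite !inE IH //; congr (_ || _).
  by rewrite !xpair_eqE andbC.
have -> : edges (rev p) = rev (zip p (rotr 1 p)).
  by rewrite rev_zip ?size_rotr // rev_rotr.
rewrite mem_rev swap ?size_rotr //.
by rewrite -[p in RHS](rotrK 1) edges_rot mem_rot /edges rotrK.
Qed.

Lemma same_polygon_edges p q U W : same_polygon p q ->
  in_edges (edges p) U W <-> in_edges (edges q) U W.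
Proof.
move=> [k [->|->]]; rewrite /in_edges edges_rot !mem_rot //.
by rewrite !mem_edges_rev; split=> -[]; auto.
Qed.

Lemma edgesP p U W :
  reflect (exists2 i, (i < size p)%N & U = p`_i /\ W = p`_(i.+1 %% size p)) ((U, W) \in edges p).
Proof.
have nr i : (i < size p)%N -> (rot 1 p)`_i = p`_(i.+1 %% size p).
  case: p => // x p /= ip; rewrite rot1_cons nth_rcons.
  move: ip; rewrite ltnS leq_eqVlt => /orP[/eqP ->|ip].
    by rewrite ltnn eqxx modnn.
  by rewrite ip modn_small.
have sz : size p = size (rot 1 p) by rewrite size_rot.
apply: (iffP idP) => [|[i ip [-> ->]]].
  move=> /(nthP (0, 0)) [i]; rewrite size_zip -sz minnn => ip.
  by rewrite nth_zip // => -[<- <-]; exists i; rewrite // nr.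
rewrite -nr //; have <- : nth (0, 0) (edges p) i = (p`_i, (rot 1 p)`_i) by rewrite nth_zip.
by rewrite mem_nth // size_zip -sz minnn.
Qed.

(** The half-open edges of [is_knot] depend on the orientation of the vertex list; this form with
    closed edges survives rotation and reversal. *)
Definition simple_edges p : Prop :=
  [/\ uniq p, (forall U W, (U, W) \in edges p -> U <> W) &
    forall U W U' W' N, (U, W) \in edges p -> (U', W') \in edges p ->
      segment U W N -> segment U' W' N ->
      [\/ (U, W) = (U', W'), N = W /\ N = U' | N = U /\ N = W']].

Lemma knot_simple p : is_knot p -> simple_edges p.
Proof.
move=> [p2 inj].
have e0 i : edge_pt p i 0 = p`_i by rewrite /edge_pt segment_pt0.
have z : 0 <= (0 : R) < 1 by rewrite lexx ltr01.
have inj0 i j : (i < size p)%N -> (j < size p)%N -> p`_i = p`_j -> i = j.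
  by move=> ip jp; rewrite -!e0 => /(inj _ _ _ _ ip jp z z) [].
have mp i : (i.+1 %% size p < size p)%N by rewrite ltn_mod (leq_trans _ p2).
have neqS i : (i < size p)%N -> i <> (i.+1 %% size p)%N.
  move=> ip; move: (ip); rewrite -ltnS ltnS leq_eqVlt => /orP[/eqP e|h].
    by rewrite e modnn => i0; rewrite -e i0 in p2.
  by rewrite modn_small // => /eqP; rewrite ltn_eqF.
split.
- by apply/(uniqP 0) => i j; rewrite !inE; exact: inj0.
- move=> U W /edgesP [i ip [-> ->]] h.
  by apply: (neqS i ip); apply: inj0.
- move=> U W U' W' N /edgesP [i ip [-> ->]] /edgesP [j jp [-> ->]].
  move=> [t /= /andP[t0 t1] et] [u /= /andP[u0 u1] eu].
  (* The far end of a closed edge is the parameter 0 of the next one, to which injectivity on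
     half-open edges applies. *)
  have norm k r : 0 <= r -> r <= 1 -> edge_pt p k r = N ->
      (r < 1) \/ N = edge_pt p (k.+1 %% size p) 0.
    move=> r0; rewrite le_eqVlt => /orP[/eqP -> <-|]; last by left.
    by right; rewrite e0 /edge_pt segment_pt1.
  have ti : edge_pt p i t = N by [].
  have uj : edge_pt p j u = N by [].
  have [t1'|tN] := norm _ _ t0 t1 ti; have [u1'|uN] := norm _ _ u0 u1 uj.
  + have [] := inj i j t u ip jp; rewrite ?t0 ?u0 ?ti ?uj //.
    by move=> -> _; constructor 1.
  + have [] := inj i (j.+1 %% size p)%N t 0 ip (mp j); rewrite ?t0 ?ti //.
    move=> eij tz; constructor 3.
    by rewrite eij; split; rewrite -e0.
  + have [] := inj (i.+1 %% size p)%N j 0 u (mp i) jp; rewrite ?u0 ?uj //.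
    move=> eij tz; constructor 2.
    by rewrite -eij; split; rewrite -e0.
  + have [] := inj (i.+1 %% size p)%N (j.+1 %% size p)%N 0 0 (mp i) (mp j); rewrite -?tN //.
    move=> h _; have : (i + 1 == j + 1 %[mod size p])%N by rewrite !addn1 h.
    rewrite eqn_modDr (modn_small ip) (modn_small jp) => /eqP ->.
    by constructor 1.
Qed.

Lemma same_polygon_simple p q : same_polygon p q -> simple_edges p -> simple_edges q.
Proof.
move=> [k [->|->]] [u n s]; split.
- by move: u; rewrite rot_uniq.
- by move=> U W h; apply: n; rewrite edges_rot mem_rot.
- move=> U W U' W' N h h'; apply: s; by rewrite edges_rot mem_rot.
- by move: u; rewrite rot_uniq rev_uniq.
- by move=> U W h e; apply: (n W U) => //; rewrite edges_rot mem_rot mem_edges_rev.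
- move=> U W U' W' N h h' g g'.
  have [||||[-> ->]|[-> ->]|[-> ->]] := s W U W' U' N; rewrite ?edges_rot ?mem_rot ?mem_edges_rev //;
    try exact: segmentC; by [constructor 1|constructor 3|constructor 2].
Qed.

Lemma polygon_setP p N : polygon_set p N <-> on_edges (in_edges (edges p)) N.
Proof.
split=> [[i ip s]|[U [W [[e|e] s]]]].
- by exists p`_i, p`_(i.+1 %% size p); split=> //; left; apply/edgesP; exists i.
- by move/edgesP: e => [i ip [eU eW]]; exists i => //; rewrite -eU -eW.
- by move/edgesP: e => [i ip [eU eW]]; exists i => //; rewrite -eU -eW; exact: segmentC.
Qed.

Lemma edges_cons (A B : pt) s : edges (A :: B :: s) = (A, B) :: zip (B :: s) (rcons s A).
Proof. by rewrite /edges rot1_cons. Qed.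

Lemma edges_cons2 (A C B : pt) s :
  edges [:: A, C, B & s] = [:: (A, C), (C, B) & zip (B :: s) (rcons s A)].
Proof. by rewrite /edges rot1_cons. Qed.

Lemma mem_zip (S T : eqType) (s : seq S) (t : seq T) x y :
  (x, y) \in zip s t -> x \in s /\ y \in t.
Proof.
elim: s t => [|a s IH] [|b t] //=; rewrite !inE xpair_eqE.
by move=> /orP[/andP[-> ->] //|/IH [-> ->]]; rewrite !orbT.
Qed.

Lemma zip_mem1 (S T : eqType) (s : seq S) (t : seq T) x :
  size s = size t -> x \in s -> exists y, (x, y) \in zip s t.
Proof.
elim: s t => [|a s IH] [|b t] //= [e]; rewrite inE => /orP[/eqP ->|/(IH _ e) [y h]].
  by exists b; rewrite mem_head.
by exists y; rewrite inE h orbT.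
Qed.

Lemma zip_mem2 (S T : eqType) (s : seq S) (t : seq T) y :
  size s = size t -> y \in t -> exists x, (x, y) \in zip s t.
Proof.
elim: s t => [|a s IH] [|b t] //= [e]; rewrite inE => /orP[/eqP ->|/(IH _ e) [x h]].
  by exists a; rewrite mem_head.
by exists x; rewrite inE h orbT.
Qed.

Lemma frame_triangle (F : frame R) (A B C N : pt) :
  [/\ fX F A = 0, fY F A = 0 & fZ F A = 0] ->
  [/\ fX F B = 1, fY F B = 0 & fZ F B = 0] ->
  [/\ fX F C = 0, fY F C = 1 & fZ F C = 0] ->
  std_triangle (fX F N) (fY F N) -> fZ F N = 0 -> triangle A B C N.
Proof.
move=> [xA yA zA] [xB yB zB] [xC yC zC] [h1 h2 h3] z.
exists (1 - fX F N - fY F N), (fX F N), (fY F N); split=> //; first lra.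
  by ring.
set x := fX F N in h1 h3 *; set y := fY F N in h2 h3 *.
have [s0|s0] := eqVneq (x + y) 0.
  have x0 : x = 0 by lra.
  have y0 : y = 0 by lra.
  rewrite x0 y0 !subr0 scale1r !scale0r !addr0.
  by apply: (@frame_inj _ F); rewrite ?xA ?yA ?zA.
(* Frames are known to be affine on segments only, so the barycentric combination is written as two
   nested segments. *)
have -> : (1 - x - y) *: A + x *: B + y *: C = segment_pt A (segment_pt B C (y / (x + y))) (x + y).
  by rewrite /segment_pt; apply/rowP => k; rewrite !mxE; field.
apply: (@frame_inj _ F); rewrite ?affX ?affY ?affZ ?xA ?yA ?zA ?xB ?yB ?zB ?xC ?yC ?zC -/x -/y.
- by field.
- by field.
- by rewrite z; ring.
Qed.

End Polygons.

(** * Degenerate triangles: subdivision of an edge *)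

Section Subdivision.
Variables (R : realType) (V : comNzRingType) (F : frame R).
Local Notation pt := 'rV[R]_3.
Variables (A B : pt) (t : R) (E0 : seq (pt * pt)).
Local Notation P m := (segment_pt A B m).
Local Notation C := (P t).
Local Notation E1 := (in_edges [:: (A, C), (C, B) & E0]).
Local Notation E2 := (in_edges ((A, B) :: E0)).
Hypothesis t01 : 0 < t < 1.
Hypothesis pd : planar_neq F A B.
(** Under a strand the colour may jump, which the law of a colouring permits in the interior of an
    edge but does not control at a vertex. *)
Hypothesis C_free : forall M N, on_edges E2 N -> above F E2 M N -> M <> C.

Lemma P_lt (c : pt -> V) m d v : 0 <= d < m -> lim c (P m) A v <-> lim c (P m) (P d) v.
Proof.
move=> /andP[d0 dm]; have m0 : 0 < m by exact: le_lt_trans d0 dm.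
have -> : P d = segment_pt (P m) A ((m - d) / m).
  by rewrite segment_ptB divfK ?gt_eqF //; congr segment_pt; ring.
by apply: (@germ_scale R (P m) A _ (fun N => c N = v)); rewrite divr_gt0 // subr_gt0.
Qed.

Lemma P_gt (c : pt -> V) m d v : m < d <= 1 -> lim c (P m) B v <-> lim c (P m) (P d) v.
Proof.
move=> /andP[md d1]; have m1 : 0 < 1 - m by lra.
have -> : P d = segment_pt (P m) B ((d - m) / (1 - m)).
  by rewrite segment_ptA divfK ?gt_eqF //; congr segment_pt; ring.
by apply: (@germ_scale R (P m) B _ (fun N => c N = v)); rewrite divr_gt0 // subr_gt0.
Qed.

Lemma P_sub (r s m : R) : r < s -> segment (P r) (P s) (P m) <-> r <= m <= s.
Proof.
move=> rs; have e (u : R) : segment_pt (P r) (P s) u = P (r + u * (s - r)).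
  by rewrite /segment_pt; apply/rowP => k; rewrite !mxE; ring.
split=> [[u /= /andP[u0 u1]]|/andP[rm ms]].
  by rewrite e => /(segment_pt_inj pd) <-; apply/andP; split; nra.
exists ((m - r) / (s - r)); last by rewrite e divfK ?gt_eqF ?subr_gt0 //; congr segment_pt; ring.
by rewrite /= divr_ge0 ?ler_pdivrMr ?subr_gt0 ?subr_ge0 ?(ltW rs) //= mul1r lerB.
Qed.

Lemma P_sub' (r s : R) N : r < s -> segment (P r) (P s) N ->
  exists2 m, r <= m <= s & N = P m.
Proof.
move=> rs [u /= /andP[u0 u1] <-]; exists (r + u * (s - r)).
  by apply/andP; split; nra.
by rewrite /segment_pt; apply/rowP => k; rewrite !mxE; ring.
Qed.

Let t0 : 0 < t. Proof. by case/andP: t01. Qed.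
Let t1 : t < 1. Proof. by case/andP: t01. Qed.

Let subA N : segment A C N -> exists2 m, 0 <= m <= t & N = P m.
Proof. by have := @P_sub' 0 t N t0; rewrite segment_pt0. Qed.

Let subB N : segment C B N -> exists2 m, t <= m <= 1 & N = P m.
Proof. by have := @P_sub' t 1 N t1; rewrite segment_pt1. Qed.

Let segA m : 0 <= m <= t -> segment A C (P m).
Proof. by have := @P_sub 0 t m t0; rewrite segment_pt0 => -[]. Qed.

Let segB m : t <= m <= 1 -> segment C B (P m).
Proof. by have := @P_sub t 1 m t1; rewrite segment_pt1 => -[]. Qed.

Let P_neA m : P m = A -> m = 0.
Proof. by move=> e; apply: (segment_pt_inj pd); rewrite segment_pt0. Qed.

Let P_neB m : P m = B -> m = 1.
Proof. by move=> e; apply: (segment_pt_inj pd); rewrite segment_pt1. Qed.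

Lemma E1P U W : E1 U W <-> [\/ U = A /\ W = C \/ U = C /\ W = A,
  U = C /\ W = B \/ U = B /\ W = C | in_edges E0 U W].
Proof.
rewrite /in_edges !inE !xpair_eqE; split.
  by case=> /or3P[/andP[/eqP-> /eqP->]|/andP[/eqP-> /eqP->]|h];
   [constructor 1|constructor 2|constructor 3|constructor 1|constructor 2|constructor 3]; auto.
by case=> [[[-> ->]|[-> ->]]|[[-> ->]|[-> ->]]|[h|h]]; rewrite ?eqxx ?h ?orbT; auto.
Qed.

Lemma E2P U W : E2 U W <-> (U = A /\ W = B \/ U = B /\ W = A) \/ in_edges E0 U W.
Proof.
rewrite /in_edges !inE !xpair_eqE; split.
  by case=> /orP[/andP[/eqP-> /eqP->]|h]; auto.
by case=> [[[-> ->]|[-> ->]]|[h|h]]; rewrite ?eqxx ?h ?orbT; auto.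
Qed.

(** A half-edge at [M], named by the vertex it leads to. Subdivision changes these names but not the
    germs, so the same function colours both polygons. *)
Definition direction (E : pt -> pt -> Prop) (M U : pt) :=
  exists W, [/\ E U W, segment U W M & U <> M].

Lemma dir12 (c : pt -> V) M U : direction E1 M U ->
  exists2 U', direction E2 M U' & forall v, lim c M U v <-> lim c M U' v.
Proof.
have e2 : E2 A B by apply/E2P; auto.
have e2' : E2 B A by apply/E2P; auto.
have seg m : 0 <= m -> m <= 1 -> segment A B (P m) by move=> h h'; exists m; rewrite //= h.
move=> [W [/E1P [[[-> ->]|[-> ->]]|[[-> ->]|[-> ->]]|e] s n]].
- have [m /andP[m0 mt] eM] := subA s; subst M.
  by exists A => //; exists B; split=> //; apply: seg => //; have := t0; have := t1; lra.
- have [m /andP[m0 mt] eM] := subA (segmentC s); subst M.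
  have mt' : m < t by rewrite lt_neqAle mt andbT; apply/eqP => h; apply: n; rewrite h.
  exists B; last by move=> v; symmetry; apply: P_gt; rewrite mt' ltW.
  exists A; split=> //; first by apply: segmentC; apply: seg => //; have := t0; have := t1; lra.
  by move=> /esym/P_neB; have := t0; have := t1; lra.
- have [m /andP[mt m1] eM] := subB s; subst M.
  have mt' : t < m by rewrite lt_neqAle mt andbT; apply/eqP => h; apply: n; rewrite h.
  exists A; last by move=> v; symmetry; apply: P_lt; rewrite mt' ltW.
  exists B; split=> //; first by apply: seg => //; have := t0; have := t1; lra.
  by move=> /esym/P_neA; have := t0; have := t1; lra.
- have [m /andP[mt m1] eM] := subB (segmentC s); subst M.
  by exists B => //; exists A; split=> //; apply: segmentC; apply: seg => //; have := t0; have := t1; lra.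
- by exists U => //; exists W; split=> //; apply/E2P; auto.
Qed.

Lemma dir21 (c : pt -> V) M U : direction E2 M U ->
  exists2 U', direction E1 M U' & forall v, lim c M U v <-> lim c M U' v.
Proof.
have e1 : E1 A C by apply/E1P; constructor 1; auto.
have e1' : E1 B C by apply/E1P; constructor 2; auto.
have e2 : E1 C A by apply/E1P; constructor 1; auto.
have e2' : E1 C B by apply/E1P; constructor 2; auto.
move=> [W [/E2P [[[-> ->]|[-> ->]]|e] s n]].
- have [m /andP[m0 m1] eM] := s; subst M.
  have [mt|mt] := leP m t; first by exists A => //; exists C; split=> //; apply: segA; rewrite m0.
  exists C; last by move=> v; apply: P_lt; rewrite mt ltW.
  exists B; split=> //; first by apply: segB; rewrite ltW.
  by move=> /(segment_pt_inj pd); have := t0; have := t1; lra.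
- have [m /andP[m0 m1] eM] := segmentC s; subst M.
  have [mt|mt] := leP t m.
    by exists B => //; exists C; split=> //; apply: segmentC; apply: segB; rewrite mt.
  exists C; last by move=> v; apply: P_gt; rewrite mt ltW.
  exists A; split=> //; first by apply: segmentC; apply: segA; rewrite m0 ltW.
  by move=> /(segment_pt_inj pd); have := t0; have := t1; lra.
- by exists U => //; exists W; split=> //; apply/E1P; constructor 3.
Qed.

Lemma Lim12 (c : pt -> V) M v : Lim E1 c M v <-> Lim E2 c M v.
Proof.
split=> L U W e s n.
  have [|U' [W' [e' s' n']] h] := @dir21 c M U; first by exists W.
  by apply/h; apply: L e' s' n'.
have [|U' [W' [e' s' n']] h] := @dir12 c M U; first by exists W.
by apply/h; apply: L e' s' n'.
Qed.

Lemma mono12 (c : pt -> V) v : monochromatic E1 c v <-> monochromatic E2 c v.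
Proof.
split=> L U W M w e s n l.
  have [|U' [W' [e' s' n']] h] := @dir21 c M U; first by exists W.
  by apply: (L U' W' M) => //; apply/h.
have [|U' [W' [e' s' n']] h] := @dir12 c M U; first by exists W.
by apply: (L U' W' M) => //; apply/h.
Qed.

Lemma on_edges12 N : on_edges E1 N <-> on_edges E2 N.
Proof.
split=> -[U [W [e s]]].
  have [h|n] := pselect (U = N); last first.
    have [|U' [W' [e' s' n']] h] := @dir12 (fun _ => 0) N U; first by exists W.
    by exists U', W'.
  have e' : E1 W U by case: e => ?; [right|left].
  have [h'|n] := pselect (W = N); last first.
    have [|U' [W' [e'' s' n']] _] := @dir12 (fun _ => 0) N W.
      by exists U; split=> //; exact: segmentC.
    by exists U', W'.
  move: e; rewrite h' h => /E1P [[[eN _]|[_ eN]]|[[_ eN]|[eN _]]|e0].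
  - by exists A, B; split; [apply/E2P; auto|rewrite eN; exact: segment_start].
  - by exists A, B; split; [apply/E2P; auto|rewrite eN; exact: segment_start].
  - by exists A, B; split; [apply/E2P; auto|rewrite eN; exact: segment_end].
  - by exists A, B; split; [apply/E2P; auto|rewrite eN; exact: segment_end].
  - by exists N, N; split; [apply/E2P; auto|exact: segment_end].
have [h|n] := pselect (U = N); last first.
  have [|U' [W' [e' s' n']] h] := @dir21 (fun _ => 0) N U; first by exists W.
  by exists U', W'.
move: e; rewrite h => /E2P [[[eN _]|[eN _]]|e0].
- by exists A, C; split; [apply/E1P; constructor 1; auto|rewrite eN; exact: segment_start].
- by exists C, B; split; [apply/E1P; constructor 2; auto|rewrite eN; exact: segment_end].
- by exists N, W; split; [apply/E1P; constructor 3|exact: segment_start].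
Qed.

Lemma above12 M N : above F E1 M N <-> above F E2 M N.
Proof. by split=> -[/on_edges12 o eX eY z]. Qed.

Lemma subdivision_colorable : colorable V F E1 <-> colorable V F E2.
Proof.
split=> -[c col nm]; exists c; try (by move=> v /mono12; exact: nm).
- move=> U W M /E2P e s.
  have main m : 0 <= m <= 1 -> M = P m ->
      ((forall N, ~ above F E2 M N) -> exists v, Lim E2 c M v) /\
      (forall N, M <> A -> M <> B -> above F E2 M N -> exists v w k,
         [/\ lim c M A v, lim c M B w, Lim E2 c N k & v + w = k + k]).
    move=> /andP[m0 m1] eM.
    have [D [D' [e1 s1]]] : on_edges E1 M.
      by apply/on_edges12; exists A, B; split; [apply/E2P; auto|exists m; rewrite //= m0].
    split.
      move=> na; have [c1 _] := col D D' M e1 s1.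
      have [N /above12 /na //|v L] := c1 _; exists v; exact/Lim12.
    move=> N nA nB ab; have oN : on_edges E2 N by case: ab.
    have nC := C_free oN ab.
    have [mt|mt|h] := ltgtP m t; last by case: nC; rewrite eM h.
      have sM : segment A C M by rewrite eM; apply: segA; rewrite m0 ltW.
      have [_ c2] := col A C M (proj2 (E1P _ _) (Or31 _ _ (or_introl (conj erefl erefl)))) sM.
      have [v [w [k [Lv Lw Lk vw]]]] := c2 N nA nC (proj2 (above12 _ _) ab).
      exists v, w, k; split=> //; last exact/Lim12.
      by rewrite eM in Lw *; apply/(@P_gt c m t) => //; rewrite mt ltW.
    have sM : segment C B M by rewrite eM; apply: segB; rewrite m1 ltW.
    have [_ c2] := col C B M (proj2 (E1P _ _) (Or32 _ _ (or_introl (conj erefl erefl)))) sM.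
    have [v [w [k [Lv Lw Lk vw]]]] := c2 N nC nB (proj2 (above12 _ _) ab).
    exists v, w, k; split=> //; last exact/Lim12.
    by rewrite eM in Lv *; apply/(@P_lt c m t) => //; rewrite mt ltW.
  case: e s => [[[-> ->]|[-> ->]]|e] s.
  + by have [m m01 eM] := s; apply: (main m).
  + have [m m01 eM] := segmentC s; have [h1 h2] := main m m01 (esym eM).
    split=> // N nB nA ab; have [v [w [k [Lv Lw Lk vw]]]] := h2 N nA nB ab.
    by exists w, v, k; split=> //; rewrite addrC.
  + have [c1 c2] := col U W M (proj2 (E1P _ _) (Or33 _ _ e)) s; split.
      move=> na; have [N /above12 /na //|v L] := c1 _; exists v; exact/Lim12.
    move=> N nU nW /above12 ab; have [v [w [k [Lv Lw Lk vw]]]] := c2 N nU nW ab.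
    by exists v, w, k; split=> //; exact/Lim12.
- move=> U W M e s.
  have o2 : on_edges E2 M by apply/on_edges12; exists U, W.
  have [D [D' [e2 s2]]] := o2.
  have [c1 _] := col D D' M e2 s2.
  split.
    move=> na; have [N /above12 /na //|v L] := c1 _; exists v; exact/Lim12.
  have cAB m : 0 <= m <= 1 -> M = P m -> forall N, M <> A -> M <> B -> above F E1 M N ->
      exists v w k, [/\ lim c M A v, lim c M B w, Lim E1 c N k & v + w = k + k].
    move=> m01 eM N nA nB /above12 ab.
    have sM : segment A B M by exists m.
    have [_ c2] := col A B M (proj2 (E2P _ _) (or_introl (or_introl (conj erefl erefl)))) sM.
    have [v [w [k [Lv Lw Lk vw]]]] := c2 N nA nB ab.
    by exists v, w, k; split=> //; exact/Lim12.
  have AC : segment A C M -> M <> A -> M <> C -> forall N, above F E1 M N ->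
      exists v w k, [/\ lim c M A v, lim c M C w, Lim E1 c N k & v + w = k + k].
    move=> sM nA nC N ab; have [m /andP[m0 mt] eM] := subA sM.
    have mt' : m < t by rewrite lt_neqAle mt andbT; apply/eqP => h; apply: nC; rewrite eM h.
    have nB : M <> B by rewrite eM => /P_neB; have := t0; have := t1; lra.
    have [|v [w [k [Lv Lw Lk vw]]]] := cAB m _ eM N nA nB ab; first by apply/andP; split; have := t0; have := t1; lra.
    exists v, w, k; split=> //.
    by rewrite eM in Lw *; apply/(@P_gt c m t) => //; rewrite mt' ltW.
  have CB : segment C B M -> M <> C -> M <> B -> forall N, above F E1 M N ->
      exists v w k, [/\ lim c M C v, lim c M B w, Lim E1 c N k & v + w = k + k].
    move=> sM nC nB N ab; have [m /andP[mt m1] eM] := subB sM.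
    have mt' : t < m by rewrite lt_neqAle mt andbT; apply/eqP => h; apply: nC; rewrite eM h.
    have nA : M <> A by rewrite eM => /P_neA; have := t0; have := t1; lra.
    have [|v [w [k [Lv Lw Lk vw]]]] := cAB m _ eM N nA nB ab; first by apply/andP; split; have := t0; have := t1; lra.
    exists v, w, k; split=> //.
    by rewrite eM in Lv *; apply/(@P_lt c m t) => //; rewrite mt' ltW.
  move=> N nU nW ab.
  have flip (U' W' : pt) : (exists v w k, [/\ lim c M U' v, lim c M W' w, Lim E1 c N k & v + w = k + k]) ->
      exists v w k, [/\ lim c M W' v, lim c M U' w, Lim E1 c N k & v + w = k + k].
    by move=> [v [w [k [Lv Lw Lk vw]]]]; exists w, v, k; split=> //; rewrite addrC.
  case/E1P: e s nU nW => [[[-> ->]|[-> ->]]|[[-> ->]|[-> ->]]|e] s nU nW.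
  + exact: AC.
  + by apply/flip/AC => //; exact: segmentC.
  + exact: CB.
  + by apply/flip/CB => //; exact: segmentC.
  + have [_ c2] := col U W M (proj2 (E2P _ _) (or_intror e)) s.
    have [v [w [k [Lv Lw Lk vw]]]] := c2 N nU nW (proj1 (above12 _ _) ab).
    by exists v, w, k; split=> //; exact/Lim12.
Qed.

End Subdivision.

(** * Elementary moves and isotopies *)

Section Reduction.
Variables (R : realType).
Local Notation pt := 'rV[R]_3.

Section Move.
Variables (F : frame R) (Om : seq pt) (A C B : pt) (s : seq pt).
Local Notation p := [:: A, C, B & s].
Local Notation E0 := (zip (B :: s) (rcons s A)).
Local Notation Ed := (in_edges E0).
Hypothesis gen : generic F Om.
Hypothesis sub : {subset p <= Om}.
Hypothesis simp : simple_edges p.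
Hypothesis tri : forall N, on_edges (in_edges (edges p)) N -> triangle A B C N ->
  segment A C N \/ segment C B N.

Let memE U W : (U, W) \in edges p = [|| (U, W) == (A, C), (U, W) == (C, B) | (U, W) \in E0].
Proof. by rewrite edges_cons2 !inE. Qed.

Let eAC : (A, C) \in edges p. Proof. by rewrite memE eqxx. Qed.
Let eCB : (C, B) \in edges p. Proof. by rewrite memE eqxx orbT. Qed.
Let e0 U W : (U, W) \in E0 -> (U, W) \in edges p. Proof. by rewrite memE => ->; rewrite !orbT. Qed.

Let uniqp : [/\ A \notin B :: s, C \notin B :: s, C \notin rcons s A, B \notin rcons s A & A <> B].
Proof.
have [u _ _] := simp; move: u => /=; rewrite !inE !negb_or mem_rcons.
move=> /andP[/and3P[AC AB As] /andP[/andP[CB Cs] /andP[Bs _]]].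
rewrite !inE !negb_or AB As CB Cs eq_sym AC mem_rcons inE negb_or Bs eq_sym AB.
by split=> //; exact/eqP.
Qed.

Let srcE U W : (U, W) \in E0 -> [/\ U <> A, U <> C, W <> B & W <> C].
Proof.
move=> /mem_zip [h1 h2]; have [nA nC nC' nB _] := uniqp.
by split=> h; [move: nA|move: nC|move: nB|move: nC']; rewrite -h ?h1 ?h2.
Qed.

Lemma neqE U W : (U, W) \in edges p -> U <> W.
Proof. by have [_ n _] := simp; exact: n. Qed.

Lemma omE U W : (U, W) \in edges p -> U \in Om /\ W \in Om.
Proof.
move=> /mem_zip [h1 h2]; split; first exact: sub.
by apply: sub; move: h2; rewrite mem_rot.
Qed.

Let unordered U W U' W' N : Ed U W -> Ed U' W' -> segment U W N -> segment U' W' N ->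
  (U = U' /\ W = W') \/ (U = W' /\ W = U') \/ (N = U \/ N = W).
Proof.
have [_ _ h] := simp.
case=> e [] e' g g'.
- by have [[-> ->]|[-> _]|[-> _]] := h _ _ _ _ N (e0 e) (e0 e') g g'; auto.
- by have [[-> ->]|[-> _]|[-> _]] := h _ _ _ _ N (e0 e) (e0 e') g (segmentC g'); auto.
- by have [[-> ->]|[-> _]|[-> _]] := h _ _ _ _ N (e0 e) (e0 e') (segmentC g) g'; auto.
- by have [[-> ->]|[-> _]|[-> _]] := h _ _ _ _ N (e0 e) (e0 e') (segmentC g) (segmentC g'); auto.
Qed.

Let next_uniq N U W : (N, U) \in E0 -> (N, W) \in E0 -> U = W.
Proof.
move=> e e'; have [_ n h] := simp.
have [[//]|[eN _]|[_ eN]] := h _ _ _ _ N (e0 e) (e0 e') (segment_start _ _) (segment_start _ _).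
  by case: (n _ _ (e0 e)).
by case: (n _ _ (e0 e')).
Qed.

Let prev_uniq N U W : (U, N) \in E0 -> (W, N) \in E0 -> U = W.
Proof.
move=> e e'; have [_ n h] := simp.
have [[//]|[_ eN]|[eN _]] := h _ _ _ _ N (e0 e) (e0 e') (segment_end _ _) (segment_end _ _).
  by case: (n _ _ (e0 e')).
by case: (n _ _ (e0 e)).
Qed.

Let no_back U W : (U, W) \in E0 -> (W, U) \in E0 -> False.
Proof.
move=> e e'; have [_ n h] := simp.
have nUW := n _ _ (e0 e).
(* The midpoint of two opposite edges would have to be a vertex. *)
have mid : segment U W (segment_pt U W 2^-1) by exists 2^-1 => //=; apply/andP; split; lra.
have [[//]|[eN _]|[eN _]] := h _ _ _ _ _ (e0 e) (e0 e') mid (segmentC mid).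
  apply: nUW; have : 2^-1 *: (U - W) = 0.
    by move/rowP: eN => eN; apply/rowP => k; move: (eN k); rewrite !mxE; lra.
  by move/eqP; rewrite scaler_eq0 invr_eq0 pnatr_eq0 /= subr_eq0 => /eqP.
apply: nUW; have : 2^-1 *: (U - W) = 0.
  by move/rowP: eN => eN; apply/rowP => k; move: (eN k); rewrite !mxE; lra.
by move/eqP; rewrite scaler_eq0 invr_eq0 pnatr_eq0 /= subr_eq0 => /eqP.
Qed.

(** Simplicity gives the incidence clauses, [tri] together with simplicity the clause on touching
    the triangle, and genericity the clauses on the projection. *)
Lemma reduction_data (d0 : cross F A B A C != 0) : move_data (normal_frame d0) A B C E0.
Proof.
have gen' := generic_normal d0 gen.
have [[_ nA nAC' nB AB] [g0 g1 g3]] := (uniqp, gen').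
have [_ n h] := simp.
have nAC := neqE eAC; have nCB := neqE eCB.
have [oA oC] := omE eAC; have [_ oB] := omE eCB.
have all_edges U W : in_edges ([:: (A, B)] ++ [:: (A, C); (C, B)] ++ E0) U W ->
    [/\ U \in Om, W \in Om & U <> W].
  have main U' W' : (U', W') \in [:: (A, B)] ++ [:: (A, C); (C, B)] ++ E0 ->
      [/\ U' \in Om, W' \in Om & U' <> W'].
    rewrite inE /= -/(E0) => /orP[/eqP[-> ->] //|e].
    have e' : (U', W') \in edges p by rewrite edges_cons2.
    by have [? ?] := omE e'; split=> //; exact: n.
  by move=> [/main //|/main [? ? ?]]; split=> //; exact: nesym.
have end_only D U W : D = A \/ D = B -> (U, W) \in E0 -> segment U W D -> D = U \/ D = W.
  move=> [->|->] e g.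
    by have [[eU eW]|[eN _]|[eN _]] := h _ _ _ _ _ (e0 e) eAC g (segment_start _ _); auto.
  by have [[eU eW]|[eN _]|[eN _]] := h _ _ _ _ _ (e0 e) eCB g (segment_end _ _); auto.
split.
- exact: normal_A.
- exact: normal_B.
- exact: normal_C.
- by move=> U W /all_edges [oU oW nUW]; apply: g0.
- have main U W N : (U, W) \in E0 -> segment U W N -> triangle A B C N -> N = A \/ N = B.
    move=> e g t; have [a1 a2 a3 a4] := srcE e.
    have oN : on_edges (in_edges (edges p)) N by exists U, W; split=> //; left; exact: e0.
    case: (tri oN t) => g'.
      have [[eU eW]|[eN eN']|[eN eN']] := h _ _ _ _ _ (e0 e) eAC g g'.
      + by case: a1.
      + by left.
      + by case: a2; rewrite -eN'.
    have [[eU eW]|[eN eN']|[eN eN']] := h _ _ _ _ _ (e0 e) eCB g g'.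
    + by case: a2.
    + by case: a4; rewrite -eN.
    + by right.
  move=> U W N e g t z.
  have t' : triangle A B C N.
    exact: frame_triangle (normal_A d0) (normal_B d0) (normal_C d0) t z.
  case: e => e; first exact: main e g t'.
  exact: main e (segmentC g) t'.
- move=> U W U' W' N e e' [g nU nW] g'.
  by case: (unordered e e' g g') => [//|[[-> ->]|[/nU|/nW]]]; auto.
- have nextE N : N \in B :: s -> exists W, (N, W) \in E0 by apply: zip_mem1; rewrite size_rcons.
  have prevE N : N \in rcons s A -> exists W, (W, N) \in E0 by apply: zip_mem2; rewrite size_rcons.
  move=> N U NA NB e.
  have Ns : N \in s.
    case: e => /mem_zip []; rewrite mem_rcons !inE.
      by move=> /orP[/eqP //|].
    by move=> _ /orP[/eqP //|].
  have [W eW] : exists W, (N, W) \in E0 by apply: nextE; rewrite inE Ns orbT.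
  have [W' eW'] : exists W, (W, N) \in E0 by apply: prevE; rewrite mem_rcons inE Ns orbT.
  have nWW : W <> W' by move=> eWW; apply: (no_back eW); rewrite eWW.
  have all Q : Ed N Q -> Q = W \/ Q = W'.
    by case=> eQ; [left; apply: next_uniq eQ eW|right; apply: prev_uniq eQ eW'].
  case: (all _ e) => ->.
    by exists W'; split; [exact: nesym|right|].
  by exists W; split; [|left|move=> Q /all []; auto].
- move=> D U U' eD e e'.
  case: eD => eD; subst D.
    have f Q : Ed A Q -> (Q, A) \in E0 by case=> // /srcE [].
    by apply: (@prev_uniq A); exact: f.
  have f Q : Ed B Q -> (B, Q) \in E0 by case=> // /srcE [].
  by apply: (@next_uniq B); exact: f.
- move=> D U W eD [e|e] g; first exact: (end_only D U W).
  by have [|] := end_only D W U eD e (segmentC g); auto.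
- move=> N U W M e e' nUW g g'.
  case: (unordered e e' g g') => [[_ /nUW //]|[[eN eU]|]].
    by case: nUW; rewrite eU.
  case=> // eM; case: (unordered e' e g' g) => [[_ /esym /nUW //]|[[eN eU]|]].
    by case: nUW; rewrite eU.
  by case=> // eM'; case: nUW; rewrite -eM.
- move=> U W U' W' M N /all_edges [oU oW nUW] /all_edges [oU' oW' nUW'] g g' eX eY nMN.
  exact: generic_meet g0 g1 oU oW oU' oW' nUW nUW' g g' eX eY nMN.
- move=> M N P [U1 [W1 [/all_edges [a1 b1 c1] d1]]] [U2 [W2 [/all_edges [a2 b2 c2] d2]]].
  move=> [U3 [W3 [/all_edges [a3 b3 c3] d3]]] eX eY eX' eY' nMN.
  exact: (g3 U1 W1 U2 W2 U3 W3).
Qed.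

Lemma reduction_colorable (V : comNzRingType) :
  colorable V F (in_edges (edges p)) <-> colorable V F (in_edges (edges [:: A, B & s])).
Proof.
rewrite edges_cons2 (edges_cons A B s).
have [d0|d0] := boolP (cross F A B A C != 0).
  have md := reduction_data d0.
  have eqv := normal_equiv d0.
  split=> /(colorable_frame eqv) c; apply: (colorable_frame (frame_equivC eqv)).
    by apply: (move_colorable (Gam := [:: (A, C); (C, B)]) (Gam' := [:: (A, B)]) md _ c); right.
  by apply: (move_colorable (Gam := [:: (A, B)]) (Gam' := [:: (A, C); (C, B)]) md _ c); left.
(* The triangle projects into a line, so by genericity [C] is on the line [AB]; simplicity places it
   strictly between [A] and [B], and the move is a subdivision. *)
move/negbNE/eqP: d0 => d0.
have [_ _ _ _ AB] := uniqp.
have [oA oC] := omE eAC; have [_ oB] := omE eCB.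
have nAC := neqE eAC; have nCB := neqE eCB.
have [g0 g1 _] := gen.
have [t eC] := g1 A B C oA oB oC AB d0.
have pd := g0 _ _ oA oB AB.
have [_ _ h] := simp.
have n0 : t <> 0 by move=> t0; apply: nAC; rewrite eC t0 segment_pt0.
have n1 : t <> 1 by move=> t1; apply: nCB; rewrite eC t1 segment_pt1.
have t0 : 0 < t.
  rewrite lt_neqAle eq_sym (introN eqP n0) leNgt; apply/negP => tn.
  have sA : segment C B A.
    exists (- t / (1 - t)).
      by rewrite /= divr_ge0 ?ler_pdivrMr /=; lra.
    by rewrite {1}eC segment_ptA divfK; [rewrite addrN segment_pt0|apply/eqP; lra].
  by have [[/nAC]|[/nAC]|[_ /AB]] := h _ _ _ _ A eAC eCB (segment_start _ _) sA.
have t1 : t < 1.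
  rewrite lt_neqAle (introN eqP n1) leNgt; apply/negP => tn.
  have sB : segment A C B.
    exists t^-1.
      by rewrite /= invr_ge0 (ltW t0) invf_le1 // ltW.
    rewrite eC; have -> : segment_pt A (segment_pt A B t) t^-1 = segment_pt A B (t^-1 * t).
      by rewrite /segment_pt; apply/rowP => k; rewrite !mxE; ring.
    by rewrite mulVf ?gt_eqF // segment_pt1.
  by have [[/nAC]|[/esym/nCB]|[/esym/AB]] := h _ _ _ _ B eAC eCB sB (segment_end _ _).
have t01 : 0 < t < 1 by rewrite t0 t1.
have := @subdivision_colorable R V F A B t E0 t01 pd; rewrite -eC; apply.
move=> M N oN [_ eX eY z] eM; subst M.
have [U [W [e g]]] := oN.
have [oU oW nUW] : [/\ U \in Om, W \in Om & U <> W].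
  have main U' W' : (U', W') \in (A, B) :: E0 -> [/\ U' \in Om, W' \in Om & U' <> W'].
    rewrite inE => /orP[/eqP[-> ->] //|/e0 e'].
    by have [? ?] := omE e'; split=> //; exact: neqE.
  by case: e => /main [] //; split=> //; exact: nesym.
have nCN : C <> N by move=> eCN; rewrite eCN ltxx in z.
by have [_ []] := generic_meet g0 g1 oA oC oU oW nAC nUW (segment_end A C) g (esym eX) (esym eY) nCN.
Qed.

End Move.

Lemma eq_colorable (V : comNzRingType) (F : frame R) (E E' : pt -> pt -> Prop) :
  (forall U W, E U W <-> E' U W) -> colorable V F E -> colorable V F E'.
Proof.
move=> h; suff -> : E = E' by [].
by apply/funext => U; apply/funext => W; apply/propext.
Qed.

Definition knot_colorable (V : comNzRingType) (F : frame R) (p : seq pt) :=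
  colorable V F (in_edges (edges p)).

Lemma same_polygon_colorable V F p q : same_polygon p q ->
  knot_colorable V F p <-> knot_colorable V F q.
Proof.
by move=> pq; split; apply: eq_colorable => U W; rewrite (same_polygon_edges _ _ pq).
Qed.

Lemma same_polygon_mem p q (x : pt) : same_polygon p q -> (x \in p) = (x \in q).
Proof. by move=> [k [->|->]]; rewrite mem_rot ?mem_rev. Qed.

Lemma elementary_reduction_colorable V F Om (K L : knot R) : generic F Om ->
  {subset (K : seq pt) <= Om} -> elementary_reduction K L ->
  knot_colorable V F K <-> knot_colorable V F L.
Proof.
move=> gen sub [A [C [B [s [sK sL tri]]]]].
rewrite (same_polygon_colorable V F sK) (same_polygon_colorable V F sL).
apply: reduction_colorable gen _ _ _ _.
- by move=> x; rewrite -(same_polygon_mem _ sK); exact: sub.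
- exact: same_polygon_simple sK (knot_simple (knotP K)).
- move=> N [U [W [e g]]] t.
  have pN : polygon_set K N.
    by apply/polygon_setP; exists U, W; split=> //; apply/(same_polygon_edges _ _ sK).
  have : (polygon_set K `&` triangle A B C) N by [].
  by rewrite tri.
Qed.

(** [Om] collects the vertices of all intermediate knots. The frame is quantified after it, so that
    a direction can be chosen later, close to a given one. *)
Lemma isotopic_colorable (K L : knot R) : isotopic K L -> exists Om : seq pt,
  forall V F, generic F Om -> knot_colorable V F K <-> knot_colorable V F L.
Proof.
move=> [n [Ks [sK sL moves]]].
exists (flatten [seq vertices (Ks j) | j <- iota 0 n.+1]) => V F gen.
have sub j : (j <= n)%N -> {subset (Ks j : seq pt) <= flatten [seq vertices (Ks j) | j <- iota 0 n.+1]}.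
  move=> jn x xj; apply/flattenP; exists (vertices (Ks j)) => //.
  by apply/mapP; exists j => //; rewrite mem_iota.
rewrite (same_polygon_colorable V F sK) -(same_polygon_colorable V F sL).
have : forall j, (j <= n)%N -> knot_colorable V F (Ks 0%N) <-> knot_colorable V F (Ks j).
  elim=> [//|j IH] jn; rewrite (IH (ltnW jn)).
  case: (moves j jn) => red.
    exact: elementary_reduction_colorable gen (sub _ (ltnW jn)) red.
  by rewrite (elementary_reduction_colorable V gen (sub _ jn) red).
exact.
Qed.

End Reduction.

(** * Generic directions of projection *)

Section Shear.
Variable R : realType.
Local Notation pt := 'rV[R]_3.

Definition px (P : pt) : R := P 0 0.
Definition py (P : pt) : R := P 0 1.
Definition pz (P : pt) : R := P 0 (inord 2).

Lemma pt_ext (P Q : pt) : px P = px Q -> py P = py Q -> pz P = pz Q -> P = Q.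
Proof.
rewrite /px /py /pz => ex ey ez; apply/rowP => k.
have : [\/ k = 0, k = 1 | k = inord 2].
  case: k => -[|[|[|//]]] i; [constructor 1|constructor 2|constructor 3]; apply/val_inj => //=.
  by rewrite inordK.
by case=> ->.
Qed.

Section Frame.
Variables al be : R.
Let X P := px P + al * pz P.
Let Y P := py P + be * pz P.
Let aX P Q t : X (segment_pt P Q t) = (1 - t) * X P + t * X Q.
Proof. by rewrite /X /px /pz /segment_pt !mxE; ring. Qed.
Let aY P Q t : Y (segment_pt P Q t) = (1 - t) * Y P + t * Y Q.
Proof. by rewrite /Y /py /pz /segment_pt !mxE; ring. Qed.
Let aZ P Q t : pz (segment_pt P Q t) = (1 - t) * pz P + t * pz Q.
Proof. by rewrite /pz /segment_pt !mxE; ring. Qed.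
Let inj P Q : X P = X Q -> Y P = Y Q -> pz P = pz Q -> P = Q.
Proof. by rewrite /X /Y => eX eY eZ; apply: pt_ext; rewrite // eZ in eX eY *; lra. Qed.
(** Projection along the vector [(- al, - be, 1)]. *)
Definition shear : frame R := Frame aX aY aZ inj.
End Frame.

(** Being polynomial on every line is enough for avoiding zeros and spares polynomials in several
    variables. *)
Definition polylike (f : R -> R -> R -> R) := forall d1 d2 d3 e1 e2 e3, exists q : {poly R},
  forall t, f (d1 + t * e1) (d2 + t * e2) (d3 + t * e3) = q.[t].

Lemma polylike_cst (k : R) : polylike (fun _ _ _ => k).
Proof. by move=> *; exists k%:P => t; rewrite hornerC. Qed.

Lemma polylike_1 : polylike (fun d _ _ => d).
Proof. by move=> d1 d2 d3 e1 e2 e3; exists (d1%:P + e1 *: 'X) => t; rewrite !hornerE; ring. Qed.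

Lemma polylike_2 : polylike (fun _ d _ => d).
Proof. by move=> d1 d2 d3 e1 e2 e3; exists (d2%:P + e2 *: 'X) => t; rewrite !hornerE; ring. Qed.

Lemma polylike_3 : polylike (fun _ _ d => d).
Proof. by move=> d1 d2 d3 e1 e2 e3; exists (d3%:P + e3 *: 'X) => t; rewrite !hornerE; ring. Qed.

Lemma polylikeD f g : polylike f -> polylike g -> polylike (fun x y z => f x y z + g x y z).
Proof.
move=> hf hg d1 d2 d3 e1 e2 e3; have [p ep] := hf d1 d2 d3 e1 e2 e3.
by have [q eq] := hg d1 d2 d3 e1 e2 e3; exists (p + q) => t; rewrite hornerD ep eq.
Qed.

Lemma polylikeM f g : polylike f -> polylike g -> polylike (fun x y z => f x y z * g x y z).
Proof.
move=> hf hg d1 d2 d3 e1 e2 e3; have [p ep] := hf d1 d2 d3 e1 e2 e3.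
by have [q eq] := hg d1 d2 d3 e1 e2 e3; exists (p * q) => t; rewrite hornerM ep eq.
Qed.

Lemma polylikeN f : polylike f -> polylike (fun x y z => - f x y z).
Proof.
move=> hf d1 d2 d3 e1 e2 e3; have [p ep] := hf d1 d2 d3 e1 e2 e3.
by exists (- p) => t; rewrite hornerN ep.
Qed.

Lemma poly_nonroot (q : {poly R}) (e : R) : q != 0 -> 0 < e ->
  exists2 t, 0 < t < e & q.[t] != 0.
Proof.
move=> q0 e0; pose f (k : nat) : R := e / k.+2%:R.
have f0 k : 0 < f k < e.
  by rewrite divr_gt0 ?ltr0n //= ltr_pdivrMr ?ltr0n // ltr_pMr // ltr1n.
pose rs := [seq f k | k <- iota 0 (size q)].
have [rt|] := boolP (all (root q) rs); last first.
  by case/allPn => t /mapP [k _ ->] nr; exists (f k).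
have ur : uniq rs.
  rewrite map_inj_uniq ?iota_uniq // => i j; rewrite /f => /(mulfI (lt0r_neq0 e0)) /invr_inj /eqP.
  by rewrite eqr_nat => /eqP [].
by have := max_poly_roots q0 rt ur; rewrite size_map size_iota ltnn.
Qed.

(** From a point that suits the functions already treated, a small step is made towards a witness
    for the next one: on that line none of the polynomials is zero, and a nonzero polynomial has
    finitely many roots. *)
Lemma avoid (I : eqType) (s : seq I) (f : I -> R -> R -> R -> R) (x y z e : R) :
  (forall i, i \in s -> polylike (f i) /\ exists a b c, f i a b c != 0) -> 0 < e ->
  exists a b c, [/\ `|a - x| < e, `|b - y| < e, `|c - z| < e &
     forall i, i \in s -> f i a b c != 0].
Proof.
elim: s e => [|i s IH] e h e0.
  by exists x, y, z; rewrite !subrr normr0.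
have e2 : 0 < e / 2 by lra.
have [j js|a [b [c [ha hb hc hs]]]] := IH _ _ e2.
  by apply: h; rewrite inE js orbT.
have [pi [a' [b' [c' w]]]] := h i (mem_head _ _).
have line j : polylike (f j) -> exists q : {poly R}, forall t,
    f j (a + t * (a' - a)) (b + t * (b' - b)) (c + t * (c' - c)) = q.[t] by move=> p; exact: p.
have prod : exists2 q : {poly R}, q != 0 & forall t, q.[t] != 0 -> forall j, j \in s ->
    f j (a + t * (a' - a)) (b + t * (b' - b)) (c + t * (c' - c)) != 0.
  have hp j : j \in s -> polylike (f j) by move=> js; have [] := h j; rewrite // inE js orbT.
  elim: (s) hs hp => [|j r IHr] hs hp; first by exists 1; rewrite ?oner_eq0.
  have [|k kr|q q0 hq] := IHr; first by move=> k kr; apply: hs; rewrite inE kr orbT.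
    by apply: hp; rewrite inE kr orbT.
  have [qj ej] := line j (hp j (mem_head _ _)).
  exists (q * qj).
    rewrite mulf_neq0 //; apply/eqP => qj0.
    have := hs j (mem_head _ _); have := ej 0; rewrite !mul0r !addr0 qj0 horner0 => ->.
    by rewrite eqxx.
  move=> t; rewrite hornerM mulf_eq0 negb_or => /andP[qt qjt] k; rewrite inE => /orP[/eqP ->|kr].
    by rewrite ej.
  exact: hq.
have [q q0 hq] := prod; have [qi ei] := line i pi.
have qi0 : qi != 0.
  apply/eqP => qi0; have := ei 1; rewrite !mul1r !subrKC qi0 horner0 => w0.
  by rewrite w0 eqxx in w.
pose m := 1 + `|a' - a| + `|b' - b| + `|c' - c|.
have na := normr_ge0 (a' - a); have nb := normr_ge0 (b' - b); have nc := normr_ge0 (c' - c).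
have m0 : 0 < m by rewrite /m; lra.
have em : 0 < e / 2 / m by rewrite divr_gt0.
have [t /andP[t0 te] nz] := poly_nonroot (mulf_neq0 q0 qi0) em.
move: nz; rewrite hornerM mulf_eq0 negb_or => /andP[qt qit].
rewrite ltr_pdivlMr // in te.
have bound (u u' u0 : R) : `|u - u0| < e / 2 -> `|u' - u| <= m -> `|u + t * (u' - u) - u0| < e.
  move=> h1 h2; have -> : u + t * (u' - u) - u0 = (u - u0) + t * (u' - u) by ring.
  apply: le_lt_trans (ler_normD _ _) _; rewrite normrM (gtr0_norm t0).
  have : t * `|u' - u| <= t * m by rewrite ler_pM2l.
  lra.
exists (a + t * (a' - a)), (b + t * (b' - b)), (c + t * (c' - c)); split.
- by apply: bound => //; rewrite /m; lra.
- by apply: bound => //; rewrite /m; lra.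
- by apply: bound => //; rewrite /m; lra.
- by move=> j; rewrite inE => /orP[/eqP ->|js]; [rewrite ei|exact: hq].
Qed.

Definition det3 (a b d : R * R * R) : R :=
  a.1.1 * (b.1.2 * d.2 - b.2 * d.1.2) - a.1.2 * (b.1.1 * d.2 - b.2 * d.1.1)
  + a.2 * (b.1.1 * d.1.2 - b.1.2 * d.1.1).

Definition vec (U W : pt) : R * R * R := (px W - px U, py W - py U, pz W - pz U).

(* The degeneracies to be avoided, as polynomials in the direction of projection:
   two points, three points, or three lines with a common projection. *)
Definition degeneracy (l : seq pt) (x y z : R) : R :=
  let d := (x, y, z) in
  match l with
  | [:: u; v] => let a := vec u v in
      (z * a.1.1 - x * a.2) * (z * a.1.1 - x * a.2) +
      (z * a.1.2 - y * a.2) * (z * a.1.2 - y * a.2)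
  | [:: u; v; w] => det3 (vec u v) (vec u w) d
  | [:: u1; w1; u2; w2; u3; w3] =>
      let a := vec u1 w1 in let b := vec u2 w2 in let c := vec u3 w3 in
      det3 a b d * det3 (vec u3 u1) c d + det3 (vec u1 u2) b d * det3 a c d
  | _ => z
  end.

Ltac plike := repeat first [apply: polylikeD | apply: polylikeM | apply: polylikeN |
  apply: polylike_1 | apply: polylike_2 | apply: polylike_3 | apply: polylike_cst].

Lemma polylike_degeneracy l : polylike (degeneracy l).
Proof.
by case: l => [|? [|? [|? [|? [|? [|? [|? ?]]]]]]]; rewrite /degeneracy /det3 /=; plike.
Qed.

Fixpoint lists (Om : seq pt) n : seq (seq pt) :=
  if n is n'.+1 then [seq x :: l | x <- Om, l <- lists Om n'] else [:: [::]].

Lemma mem_lists Om l : {subset l <= Om} -> l \in lists Om (size l).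
Proof.
elim: l => [|x l IH] h; first exact: mem_head.
apply/allpairsP; exists (x, l); split=> //=; first by apply: h; rewrite mem_head.
by apply: IH => y yl; apply: h; rewrite inE yl orbT.
Qed.

(** The polynomial expresses concurrency of the projected lines: meeting the second line fixes the
    parameter [det3 (vec u1 u2) b d / det3 a b d] on the first, which is put into the equation of
    the third and cleared of its denominator. For the directions [dir s], from [u1] to points of the
    second line, one term vanishes and [g], affine in [s], decides. *)
Lemma skew_degeneracy (u1 w1 u2 w2 u3 w3 : pt) :
  let a := vec u1 w1 in let b := vec u2 w2 in let c := vec u3 w3 in
  det3 a b (vec u1 u2) <> 0 -> det3 a c (vec u1 u3) <> 0 -> det3 b c (vec u2 u3) <> 0 ->
  exists x y z, degeneracy [:: u1; w1; u2; w2; u3; w3] x y z != 0.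
Proof.
move=> a b c h12 h13 h23.
pose e := vec u1 u2.
pose dir (s : R) := (e.1.1 + s * b.1.1, e.1.2 + s * b.1.2, e.2 + s * b.2).
pose g s := det3 (vec u3 u1) c (dir s).
have gs s : degeneracy [:: u1; w1; u2; w2; u3; w3] (dir s).1.1 (dir s).1.2 (dir s).2 =
    det3 a b e * g s.
  by rewrite /degeneracy /g /dir /det3 /e -/a -/b -/c /=; ring.
suff [s hs] : exists s, g s <> 0.
  exists (dir s).1.1, (dir s).1.2, (dir s).2; rewrite gs mulf_neq0 //; exact/eqP.
have [|/eqP h1] := eqVneq (g 1) 0; last by exists 1.
have [|/eqP h0] := eqVneq (g 0) 0; last by exists 0.
move=> g0 g1; exfalso.
have c1 : det3 (vec u3 u1) c e = 0 by rewrite -g0 /g /dir /det3 /=; ring.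
have c2 : det3 (vec u3 u1) c b = 0.
  transitivity (g 1 - g 0); last by rewrite g0 g1 subrr.
  by rewrite /g /dir /det3 /=; ring.
(* [b], [u2 - u3] and [c] lie in the plane spanned by [u1 - u3] and [c] *)
have [k1|/eqP k1] := eqVneq (det3 a c (vec u3 u1)) 0.
  apply: h13; rewrite -[RHS]oppr0 -k1 /det3 /vec /=; ring.
apply: h23; apply: (mulfI (introN eqP k1)); rewrite mulr0.
pose w := vec u3 u1.
(* After multiplication by the nonzero [det3 a c w], a Plücker relation gives every term a factor
   [det3 w c b] or [det3 w c e]. *)
transitivity (det3 a c w * det3 w c b - det3 a c b * det3 w c e + det3 a c e * det3 w c b).
  rewrite /w /e /det3 /vec /=; ring.
by rewrite c1 c2 !mulr0 subrr addr0.
Qed.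

Lemma shear_degenerate (x y z : R) (U W : pt) : z != 0 ->
  fX (shear (- x / z) (- y / z)) U = fX (shear (- x / z) (- y / z)) W ->
  fY (shear (- x / z) (- y / z)) U = fY (shear (- x / z) (- y / z)) W ->
  exists k, [/\ px W = px U + k * x, py W = py U + k * y & pz W = pz U + k * z].
Proof.
move=> z0 /= eX eY; exists ((pz W - pz U) / z); split; last by rewrite divfK // subrKC.
- transitivity (px U + (- x / z) * pz U - (- x / z) * pz W); last by field.
  by rewrite eX addrK.
- transitivity (py U + (- y / z) * pz U - (- y / z) * pz W); last by field.
  by rewrite eY addrK.
Qed.

Lemma cross_shear (x y z : R) (U W U' W' : pt) : z != 0 ->
  det3 (vec U W) (vec U' W') (x, y, z) =
  z * cross (shear (- x / z) (- y / z)) U W U' W'.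
Proof. by move=> z0; rewrite /det3 /vec /cross /=; field. Qed.

(** A degeneracy polynomial that vanishes identically has a cause in space: equal or collinear
    points. For six points there is no such case, since three segments with distinct points on one
    vertical line are pairwise skew. *)
Lemma generic_shear (Om : seq pt) (x y z : R) : z != 0 ->
  (forall l, {subset l <= Om} -> size l = 2 \/ size l = 3 \/ size l = 6 ->
     (exists a b c, degeneracy l a b c != 0) -> degeneracy l x y z != 0) ->
  generic (shear (- x / z) (- y / z)) Om.
Proof.
move=> z0 h; set F := shear _ _.
have sub l : all (mem Om) l -> {subset l <= Om} by move=> /allP.
have g0 : {in Om &, forall u v, u <> v -> planar_neq F u v}.
  move=> u v uO vO uv.
  have d0 : degeneracy [:: u; v] x y z != 0.
    apply: h; [by apply: sub; rewrite /= uO vO|by left|].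
    have sq (r s : R) : r * r + s * s = 0 -> r = 0 /\ s = 0.
      move=> /eqP; rewrite -!expr2 paddr_eq0 ?sqr_ge0 // !sqrf_eq0 => /andP[/eqP -> /eqP ->].
      by [].
    (* The directions [(0, 0, 1)] and [(1, 0, 0)] together detect all three coordinates of
       [v - u]. *)
    have [k0|k0] := eqVneq (degeneracy [:: u; v] 0 0 1) 0; last by exists 0, 0, 1.
    have [k1|k1] := eqVneq (degeneracy [:: u; v] 1 0 0) 0; last by exists 1, 0, 0.
    have [/= e1 e2] := sq _ _ k0; have [/= e3 _] := sq _ _ k1.
    by case: uv; apply: pt_ext; lra.
  have [eX|/eqP nX] := eqVneq (fX F u) (fX F v); last by left.
  right=> eY; have [k [ex ey ez]] := shear_degenerate z0 eX eY.
  by case/eqP: d0; rewrite /degeneracy /vec /= ex ey ez; ring.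
have g1 : {in Om & &, forall u v w, u <> v -> cross F u v u w = 0 -> exists t, w = segment_pt u v t}.
  move=> u v w uO vO wO uv cr.
  have deg : degeneracy [:: u; v; w] x y z = 0 by rewrite /degeneracy cross_shear // cr mulr0.
  have [[a [b [c nz]]]|nz] := pselect (exists a b c, degeneracy [:: u; v; w] a b c != 0).
    have n1 : degeneracy [:: u; v; w] x y z != 0.
      by apply: h; [apply: sub; rewrite /= uO vO wO|right; left|exists a, b, c].
    by rewrite deg eqxx in n1.
  have dz a b c : degeneracy [:: u; v; w] a b c = 0.
    by apply/eqP; apply: contraT => n; case: nz; exists a, b, c.
  (* In the coordinate directions the polynomial gives the components of the cross product of the
     two vectors. *)
  have := (dz 1 0 0, dz 0 1 0, dz 0 0 1).
  rewrite /degeneracy /det3 /vec /= => -[[e1 e2] e3].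
  have ratio (r s r' s' : R) : r != 0 -> r * s' = r' * s -> s' = s / r * r'.
    by move=> r0 e; apply: (mulfI r0); rewrite e; field.
  have on_line r : px w - px u = r * (px v - px u) -> py w - py u = r * (py v - py u) ->
      pz w - pz u = r * (pz v - pz u) -> exists t, w = segment_pt u v t.
    move=> fx fy fz; exists r; move: fx fy fz; rewrite /px /py /pz => fx fy fz.
    by apply: pt_ext; rewrite /px /py /pz /segment_pt !mxE; lra.
  have [ax|ax] := eqVneq (px v - px u) 0; last first.
    by apply: (on_line ((px w - px u) / (px v - px u))); apply: ratio => //; lra.
  have [ay|ay] := eqVneq (py v - py u) 0; last first.
    by apply: (on_line ((py w - py u) / (py v - py u))); apply: ratio => //; lra.
  have [az|az] := eqVneq (pz v - pz u) 0; last first.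
    by apply: (on_line ((pz w - pz u) / (pz v - pz u))); apply: ratio => //; lra.
  by case: uv; apply: pt_ext; lra.
split=> // u1 w1 u2 w2 u3 w3 N1 N2 N3 o1 p1 o2 p2 o3 p3 n1 n2 n3 s1 s2 s3 eX eY eX' eY' n12.
have [n31|n31] := pselect (N3 = N1); first by left.
have [n32|n32] := pselect (N3 = N2); first by right.
exfalso.
have meet := @generic_meet _ F Om.
have n13 : N1 <> N3 by move=> e; exact: n31.
have n23 : N2 <> N3 by move=> e; exact: n32.
have eX'' : fX F N2 = fX F N3 by rewrite -eX.
have eY'' : fY F N2 = fY F N3 by rewrite -eY.
have [_ _ c12] := meet _ _ _ _ _ _ g0 g1 o1 p1 o2 p2 n1 n2 s1 s2 eX eY n12.
have [_ _ c13] := meet _ _ _ _ _ _ g0 g1 o1 p1 o3 p3 n1 n3 s1 s3 eX' eY' n13.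
have [_ _ c23] := meet _ _ _ _ _ _ g0 g1 o2 p2 o3 p3 n2 n3 s2 s3 eX'' eY'' n23.
have pos (U W N : pt) : segment U W N -> exists t, [/\ px N = px U + t * (vec U W).1.1,
    py N = py U + t * (vec U W).1.2 & pz N = pz U + t * (vec U W).2].
  by move=> [t _ <-]; exists t; rewrite /vec /px /py /pz /segment_pt !mxE /=; split; ring.
have skew (U W U' W' N N' : pt) : segment U W N -> segment U' W' N' ->
    fX F N = fX F N' -> fY F N = fY F N' -> N <> N' -> cross F U W U' W' <> 0 ->
    det3 (vec U W) (vec U' W') (vec U U') <> 0.
  move=> /pos [t [ax ay az]] /pos [t' [ax' ay' az']] aX aY nN cr.
  have [k [bx by_ bz]] := shear_degenerate z0 aX aY.
  have -> : det3 (vec U W) (vec U' W') (vec U U') = k * det3 (vec U W) (vec U' W') (x, y, z).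
    have fx : px U' = px U + k * x + t * (vec U W).1.1 - t' * (vec U' W').1.1 by lra.
    have fy : py U' = py U + k * y + t * (vec U W).1.2 - t' * (vec U' W').1.2 by lra.
    have fz : pz U' = pz U + k * z + t * (vec U W).2 - t' * (vec U' W').2 by lra.
    move: (vec U W) (vec U' W') fx fy fz => a b fx fy fz.
    by rewrite /det3 /vec /= fx fy fz; ring.
  rewrite cross_shear // => /eqP; rewrite !mulf_eq0 (negbTE z0) (introF eqP cr) !orbF => /eqP k0.
  by apply: nN; apply: pt_ext; rewrite ?bx ?by_ ?bz k0 mul0r addr0.
have wit := @skew_degeneracy u1 w1 u2 w2 u3 w3
  (skew _ _ _ _ _ _ s1 s2 eX eY n12 c12) (skew _ _ _ _ _ _ s1 s3 eX' eY' n13 c13)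
  (skew _ _ _ _ _ _ s2 s3 eX'' eY'' n23 c23).
have nz : degeneracy [:: u1; w1; u2; w2; u3; w3] x y z != 0.
  by apply: h => //; [apply: sub; rewrite /= o1 p1 o2 p2 o3 p3|right; right].
case/eqP: nz.
have [t1 [ax1 ay1 az1]] := pos _ _ _ s1.
have [t2 [ax2 ay2 az2]] := pos _ _ _ s2.
have [t3 [ax3 ay3 az3]] := pos _ _ _ s3.
have [k [bx by_ bz]] := shear_degenerate z0 eX eY.
have [k' [bx' by' bz']] := shear_degenerate z0 eX' eY'.
rewrite /degeneracy.
move: ax1 ay1 az1 ax2 ay2 az2 ax3 ay3 az3.
move: (vec u1 w1) (vec u2 w2) (vec u3 w3) => a b c ax1 ay1 az1 ax2 ay2 az2 ax3 ay3 az3.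
have gx : px u2 = px u1 + k * x + t1 * a.1.1 - t2 * b.1.1 by lra.
have gy : py u2 = py u1 + k * y + t1 * a.1.2 - t2 * b.1.2 by lra.
have gz : pz u2 = pz u1 + k * z + t1 * a.2 - t2 * b.2 by lra.
have gx' : px u3 = px u1 + k' * x + t1 * a.1.1 - t3 * c.1.1 by lra.
have gy' : py u3 = py u1 + k' * y + t1 * a.1.2 - t3 * c.1.2 by lra.
have gz' : pz u3 = pz u1 + k' * z + t1 * a.2 - t3 * c.2 by lra.
by rewrite /det3 /vec /= gx gy gz gx' gy' gz'; ring.
Qed.

(** The direction is sought as [(x, y, z)] near [(- al0, - be0, 1)] and then normalised by [z]; the
    tolerance [e / m] leaves room for this division. *)
Lemma exists_generic_shear (Om : seq pt) (al0 be0 e : R) : 0 < e ->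
  exists al be, [/\ `|al - al0| < e, `|be - be0| < e & generic (shear al be) Om].
Proof.
move=> e0.
have na := normr_ge0 al0; have nb := normr_ge0 be0.
pose m := 4 * (1 + `|al0| + `|be0| + e).
have m0 : 0 < m by rewrite /m; lra.
have em : 0 < e / m by rewrite divr_gt0.
(* The empty list is there because its degeneracy is [z], which must not vanish. *)
pose s := [seq l <- [::] :: lists Om 2 ++ lists Om 3 ++ lists Om 6 |
           `[< exists a b c, degeneracy l a b c != 0 >]].
have hs i : i \in s -> polylike (degeneracy i) /\ exists a b c, degeneracy i a b c != 0.
  by rewrite mem_filter => /andP[/asboolP h _]; split=> //; exact: polylike_degeneracy.
have [x [y [z [hx hy hz nz]]]] := avoid (- al0) (- be0) 1 hs em.
have z0 : z != 0.
  apply: (nz [::]); rewrite mem_filter mem_head andbT; apply/asboolP.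
  by exists 0, 0, 1; exact: oner_neq0.
have mE : e / m * m = e by rewrite divfK // gt_eqF.
have em4 : e / m < 1 / 4.
  by rewrite ltr_pdivrMr // /m; lra.
have z2 : 1 / 2 < z by move: hz; rewrite ltr_norml; lra.
have bound (w w0 : R) : `|w - - w0| < e / m -> `|w0| <= `|al0| + `|be0| -> `|- w / z - w0| < e.
  move=> h1 h2; have -> : - w / z - w0 = - ((w - - w0) + w0 * (z - 1)) / z by field.
  rewrite normrM normrN normfV (gtr0_norm (_ : 0 < z)); last by lra.
  rewrite ltr_pdivrMr; last by lra.
  apply: le_lt_trans (ler_normD _ _) _; rewrite normrM.
  have h3 : `|w0| * `|z - 1| <= (`|al0| + `|be0|) * (e / m).
    by rewrite ler_pM // ltW.
  have h4 : (1 + `|al0| + `|be0| + e) * (e / m) = e / 4.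
    have -> : 1 + `|al0| + `|be0| + e = m / 4 by rewrite /m; lra.
    by rewrite -[in RHS]mE; ring.
  have h5 : e * (e / m) > 0 by rewrite mulr_gt0.
  have h6 : e * (1 / 2) < e * z by rewrite ltr_pM2l.
  by lra.
exists (- x / z), (- y / z); split.
- by apply: bound => //; lra.
- by apply: bound => //; lra.
apply: generic_shear => // l lO sl wit; apply: nz; rewrite mem_filter; apply/andP; split.
  exact/asboolP.
rewrite inE !mem_cat; have := mem_lists lO.
by case: sl => [|[|]] -> ->; rewrite ?orbT.
Qed.

End Shear.

(** * Colourings of a diagram *)

Section Comb.
Variables (R : realType) (V : comNzRingType) (F : frame R) (p : seq 'rV[R]_3).
Local Notation pt := 'rV[R]_3.
Local Notation n := (size p).
Local Notation next i := (i.+1 %% n)%N.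
Variable o : nat -> option nat.

(* [o i = Some j] when the [i]-th edge passes under the [j]-th one. *)
Record crossing_table : Prop := CrossingTable {
  ct_knot : is_knot p;
  ct_above : forall i j t u, (i < n)%N -> (j < n)%N -> 0 <= t <= 1 -> 0 <= u <= 1 ->
    fX F (edge_pt p i t) = fX F (edge_pt p j u) -> fY F (edge_pt p i t) = fY F (edge_pt p j u) ->
    fZ F (edge_pt p i t) < fZ F (edge_pt p j u) -> o i = Some j;
  ct_cross : forall i j, (i < n)%N -> o i = Some j -> [/\ (j < n)%N, o j = None &
    exists t u, [/\ 0 < t < 1, 0 <= u <= 1,
      [/\ fX F (edge_pt p i t) = fX F (edge_pt p j u), fY F (edge_pt p i t) = fY F (edge_pt p j u) &
          fZ F (edge_pt p i t) < fZ F (edge_pt p j u)] &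
      forall t' u', 0 <= t' <= 1 -> 0 <= u' <= 1 ->
        fX F (edge_pt p i t') = fX F (edge_pt p j u') ->
        fY F (edge_pt p i t') = fY F (edge_pt p j u') -> t' = t]] }.

(** [s i] is the colour at the start of edge [i] and [s (next i)] the colour at its end, an edge
    having at most one undercrossing. The upper edge of a crossing has none, hence the single colour
    [s j]. *)
Definition arc_coloring (s : nat -> V) : Prop := forall i, (i < n)%N ->
  if o i is Some j then s i + s (next i) = s j + s j else s (next i) = s i.

Hypothesis T : crossing_table.
Local Notation Ed := (in_edges (edges p)).
Local Notation e := (edge_pt p).

Let next_lt i : (next i < n)%N.
Proof. by rewrite ltn_mod; have [h _] := ct_knot T; exact: leq_trans h. Qed.

Let next_neq i : (i < n)%N -> next i <> i.
Proof.
move=> ip; have [n2 _] := ct_knot T.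
rewrite -[i in RHS](modn_small ip) -addn1 => /eqP.
by rewrite -[X in _ == X %[mod _]]addn0 eqn_modDl mod0n modn_small // (leq_trans _ n2).
Qed.

Let e0 i : e i 0 = p`_i. Proof. by rewrite /edge_pt segment_pt0. Qed.
Let e1 i : e i 1 = e (next i) 0. Proof. by rewrite e0 /edge_pt segment_pt1. Qed.

Let inj i j t u : (i < n)%N -> (j < n)%N -> 0 <= t < 1 -> 0 <= u < 1 ->
  e i t = e j u -> i = j /\ t = u.
Proof. by have [_] := ct_knot T; exact. Qed.

Let EdP U W M : Ed U W -> segment U W M -> exists i t,
  [/\ (i < n)%N, 0 <= t <= 1, M = e i t & (U = e i 0 /\ W = e i 1) \/ (U = e i 1 /\ W = e i 0)].
Proof.
move=> [/edgesP|/edgesP] [i ip [-> ->]] [t /andP[t0 t1] <-].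
  by exists i, t; rewrite t0 t1 e1 !e0; split=> //; left.
exists i, (1 - t); rewrite e1 !e0; split=> //; [lra| |by right].
by rewrite /edge_pt segment_ptC.
Qed.

Let Ed_edge i : (i < n)%N -> Ed (e i 0) (e i 1).
Proof. by move=> ip; left; apply/edgesP; exists i; rewrite // e1 !e0. Qed.

Let half_open i t : (i < n)%N -> 0 <= t <= 1 ->
  exists j u, [/\ (j < n)%N, 0 <= u < 1 & e i t = e j u].
Proof.
move=> ip /andP[t0]; rewrite le_eqVlt => /orP[/eqP ->|t1].
  by exists (next i), 0; rewrite e1 lexx ltr01.
by exists i, t; rewrite t0 t1.
Qed.

Let on_e i t : (i < n)%N -> 0 <= t <= 1 -> on_edges Ed (e i t).
Proof. by move=> ip ht; exists (e i 0), (e i 1); split; [exact: Ed_edge|rewrite e1 !e0; exists t]. Qed.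

Let aboveP M N : above F Ed M N <-> exists j u,
  [/\ (j < n)%N, 0 <= u <= 1, N = e j u & [/\ fX F N = fX F M, fY F N = fY F M & fZ F M < fZ F N]].
Proof.
split=> [[[U [W [h s]]] eX eY z]|[j [u [jp hu -> [eX eY z]]]]].
  by have [j [u [jp hu eN _]]] := EdP h s; exists j, u.
by split=> //; exact: on_e.
Qed.

Let choose_under : exists tau : nat -> R, forall i, (i < n)%N -> 0 < tau i < 1 /\
  forall t, 0 <= t <= 1 -> (exists N, above F Ed (e i t) N) <-> o i <> None /\ t = tau i.
Proof.
suff ch : forall i, exists s : R, (i < n)%N -> 0 < s < 1 /\
    forall t, 0 <= t <= 1 -> (exists N, above F Ed (e i t) N) <-> o i <> None /\ t = s.
  by have [tau h] := boolp.choice ch; exists tau.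
move=> i; case oi: (o i) => [j|]; last first.
  (* An edge without undercrossing gets an arbitrary interior parameter. *)
  exists (1 / 2) => ip; split; first lra.
  move=> t ht; split=> [[N /aboveP [j [u [jp hu -> [eX eY z]]]]]|[]//].
  by have := ct_above T ip jp ht hu (esym eX) (esym eY) z; rewrite oi.
have [ip|] := boolP (i < n)%N; last by exists 0.
have [jp _ [s [u [hs hu [eX eY z] un]]]] := ct_cross T ip oi.
exists s => _; split=> // t ht; split=> [[N /aboveP [j' [u' [jp' hu' -> [eX' eY' z']]]]]|[_ ->]].
  split=> //; have := ct_above T ip jp' ht hu' (esym eX') (esym eY') z'.
  by rewrite oi => -[ej]; apply: (un t u') => //; rewrite ?ej.
by exists (e j u); apply/aboveP; exists j, u.
Qed.

Section FromArcs.
Variables (tau : nat -> R) (s : nat -> V).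
Hypothesis tau_under : forall i, (i < n)%N -> 0 < tau i < 1 /\
  forall t, 0 <= t <= 1 -> (exists N, above F Ed (e i t) N) <-> o i <> None /\ t = tau i.
Hypothesis arc : arc_coloring s.

Let val i t := if t <= tau i then s i else s (next i).
Variable c : pt -> V.
Hypothesis cE : forall i t, (i < n)%N -> 0 <= t < 1 -> c (e i t) = val i t.

Let limR i t : (i < n)%N -> 0 <= t < 1 ->
  lim c (e i t) (e i 1) (if t < tau i then s i else s (next i)).
Proof.
move=> ip /andP[t0 t1]; have [/andP[h0 h1] _] := tau_under ip.
rewrite [e i 1]e1 e0 /edge_pt; case: ifP => ht.
  apply: (@right_lim _ _ _ _ _ _ (tau i - t)) => [//||r tr rt]; first lra.
  rewrite -/(e i r) cE // /val; last by lra.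
  by rewrite ifT //; lra.
apply: (@right_lim _ _ _ _ _ _ (1 - t)) => [//||r tr rt]; first lra.
rewrite -/(e i r) cE // /val; last by lra.
by rewrite ifF //; move: ht; lra.
Qed.

Let limL i t : (i < n)%N -> 0 < t <= 1 -> lim c (e i t) (e i 0) (val i t).
Proof.
move=> ip /andP[t0 t1]; have [/andP[h0 h1] _] := tau_under ip.
rewrite [e i 0]e0 /edge_pt /val; case: ifP => ht.
  apply: (@left_lim _ _ _ _ _ _ t) => // r tr rt.
  rewrite -/(e i r) cE // /val; last by lra.
  by rewrite ifT //; lra.
apply: (@left_lim _ _ _ _ _ _ (t - tau i)) => // [|r tr rt]; first by move: ht; lra.
rewrite -/(e i r) cE // /val; last by move: ht; lra.
by rewrite ifF //; lra.
Qed.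

Let Lim_val i t : (i < n)%N -> 0 <= t < 1 -> o i = None \/ t <> tau i -> Lim Ed c (e i t) (val i t).
Proof.
move=> ip ht no U W /EdP h /h {h} [k [t' [kp ht' eM UW]]] nU.
have [h _] := tau_under ip.
have [t1|t1] := eqVneq t' 1.
  have [ei et] : i = next k /\ t = 0.
    by apply: inj => //; [rewrite lexx ltr01|rewrite eM t1 e1].
  case: UW => -[eU _]; last by case: nU; rewrite eU eM t1.
  have := @limL k 1 kp; rewrite ltr01 lexx => /(_ isT).
  rewrite eU eM t1; have [h' _] := tau_under kp.
  have -> : val k 1 = s (next k) by rewrite /val leNgt ifF //; case/andP: h' => _ ->.
  have -> : val i t = s (next k) by rewrite /val et -ei ltW //; case/andP: h.
  by [].
have ht'' : 0 <= t' < 1 by move/eqP: t1; lra.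
have [ei et] := inj ip kp ht ht'' eM; rewrite -ei in UW.
case: UW => -[eU _].
  have t0 : 0 < t <= 1.
    suff : t <> 0 by lra.
    by move=> z; apply: nU; rewrite eU z.
  by rewrite eU; apply: limL.
have := limR ip ht; rewrite eU /val.
case: no => [oi|nt]; last by have -> : (t < tau i) = (t <= tau i) by apply/idP/idP; lra.
by have := arc ip; rewrite oi => ->; rewrite !if_same.
Qed.

Let Lim_over i t : (i < n)%N -> 0 <= t <= 1 -> o i = None -> Lim Ed c (e i t) (s i).
Proof.
move=> ip /andP[t0]; rewrite le_eqVlt => /orP[/eqP ->|t1] oi; have := arc ip; rewrite oi => es.
  have [h _] := tau_under (next_lt i).
  have := @Lim_val (next i) 0 (next_lt i); rewrite lexx ltr01 => /(_ isT).
  rewrite e1 /val ifT; last by lra.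
  by rewrite es; apply; right; lra.
have := @Lim_val i t ip; rewrite t0 t1 => /(_ isT (or_introl oi)).
by rewrite /val es if_same.
Qed.

Let coloring_arcs : coloring F Ed c.
Proof.
move=> U W M h s0; have [i [t [ip ht eM UW]]] := EdP h s0; split.
  move=> na; have [j [u [jp hu eM']]] := half_open ip ht.
  exists (val j u); rewrite eM eM'; apply: Lim_val => //.
  have [|oj] := pselect (o j = None); first by left.
  right=> eu; have [_ h'] := tau_under jp.
  have [|_ /(_ (conj oj eu)) [N aN]] := h' u; first by lra.
  by apply: (na N); rewrite eM eM'.
move=> N nU nW ab.
have t0 : t <> 0 by move=> z; case: UW nU nW eM => -[-> ->]; rewrite z.
have t1 : t <> 1 by move=> z; case: UW nU nW eM => -[-> ->]; rewrite z.
have [_ h'] := tau_under ip.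
have [oi et] : o i <> None /\ t = tau i by apply/(h' t ht); exists N; rewrite -eM.
have /aboveP [j [u [jp hu eN [eX eY z]]]] := ab.
have oij : o i = Some j.
  by apply: (ct_above T ip jp ht hu); rewrite -?eM -?eN.
have [_ oj _] := ct_cross T ip oij.
have LN : Lim Ed c N (s j) by rewrite eN; exact: Lim_over.
have := arc ip; rewrite oij => es.
have l0 : lim c M (e i 0) (s i).
  have t01 : 0 < t <= 1 by lra.
  by have := limL ip t01; rewrite -eM /val -et lexx.
have l1 : lim c M (e i 1) (s (next i)).
  have t01 : 0 <= t < 1 by lra.
  by have := limR ip t01; rewrite -eM -et ltxx.
case: UW => -[-> ->]; first by exists (s i), (s (next i)), (s j).
by exists (s (next i)), (s i), (s j); split=> //; rewrite addrC.
Qed.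

Lemma colorable_of_arcs i : (i < n)%N -> s i <> s 0 -> knot_colorable V F p.
Proof.
move=> ip ns; exists c; first exact: coloring_arcs.
have n0 : (0 < n)%N by exact: leq_ltn_trans ip.
move=> v mono; apply: ns.
suff H k : (k < n)%N -> s k = v by rewrite !H.
move=> kp; have [h _] := tau_under kp.
have z : 0 <= (0 : R) < 1 by rewrite lexx ltr01.
have neq : e k 1 <> e k 0.
  rewrite e1 => /(inj (next_lt k) kp z z) [ek _].
  exact: next_neq ek.
apply: (mono (e k 1) (e k 0) (e k 0)) => //.
- by right; case: (Ed_edge kp) => // /edgesP [m mp [em em']]; apply/edgesP; exists k; rewrite // e1 !e0.
- exact: segment_end.
- by have := limR kp z; rewrite ifT //; lra.
Qed.

End FromArcs.

Lemma arc_colorable (s : nat -> V) i : arc_coloring s -> (i < n)%N -> s i <> s 0 ->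
  knot_colorable V F p.
Proof.
move=> arc ip ns; have [tau ht] := choose_under.
pose val i t := if t <= tau i then s i else s (next i).
(* Half-open edges parametrise the knot injectively, so values prescribed edge by edge define a
   function on space. *)
have ch P : exists v, forall i t, (i < n)%N -> 0 <= t < 1 -> e i t = P -> v = val i t.
  have [[k [t [kp t01 <-]]]|no] := pselect (exists k t, [/\ (k < n)%N, 0 <= t < 1 & e k t = P]).
    by exists (val k t) => k' t' kp' t01' /(inj kp' kp t01' t01) [-> ->].
  by exists 0 => k t kp t01 eP; case: no; exists k, t.
have [c hc] := boolp.choice ch.
by apply: (@colorable_of_arcs tau s ht arc c _ i) => // k t kp t01; exact: hc.
Qed.

Let edgeE i t : e i t = segment_pt (e i 0) (e i 1) t.
Proof. by rewrite e1 !e0. Qed.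

Let lim_sub (c : pt -> V) i t r v : 0 < r ->
  lim c (e i t) (e i 1) v <-> lim c (e i t) (segment_pt (e i t) (e i 1) r) v.
Proof. by move=> r0; exact: germ_scale. Qed.

Let lim_subC (c : pt -> V) i t r v : 0 < r ->
  lim c (e i t) (e i 0) v <-> lim c (e i t) (segment_pt (e i t) (e i 0) r) v.
Proof. by move=> r0; exact: germ_scale. Qed.

Section ToArcs.
Variables (tau : nat -> R) (c : pt -> V).
Hypothesis tau_under : forall i, (i < n)%N -> 0 < tau i < 1 /\
  forall t, 0 <= t <= 1 -> (exists N, above F Ed (e i t) N) <-> o i <> None /\ t = tau i.
Hypothesis col : coloring F Ed c.

Let Ed_edgeC i : (i < n)%N -> Ed (e i 1) (e i 0).
Proof. by move=> /Ed_edge [h|h]; [right|left]. Qed.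

Let seg i t : 0 <= t <= 1 -> segment (e i 0) (e i 1) (e i t).
Proof. by move=> ht; exists t; rewrite // -edgeE. Qed.

Let neq i t u : (i < n)%N -> 0 <= t < 1 -> t < u -> u <= 1 -> e i t <> e i u.
Proof.
move=> ip ht tu; rewrite le_eqVlt => /orP[/eqP ->|u1]; last first.
  by move=> /(inj ip ip ht) h; have [|_ h'] := h _; lra.
have z : 0 <= (0 : R) < 1 by rewrite lexx ltr01.
rewrite e1 => /(inj ip (next_lt i) ht z) [ei _].
by apply: (next_neq ip).
Qed.

Let LimP i t : (i < n)%N -> 0 <= t <= 1 -> o i = None \/ t <> tau i -> exists v, Lim Ed c (e i t) v.
Proof.
move=> ip ht no; have [h _] := col (Ed_edge ip) (seg i ht); apply: h => N ab.
have [_ h] := tau_under ip.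
have [|oi et] := proj1 (h t ht); first by exists N.
by case: no.
Qed.

Let LimR i t v : (i < n)%N -> 0 <= t < 1 -> Lim Ed c (e i t) v -> lim c (e i t) (e i 1) v.
Proof.
move=> ip /andP[t0 t1]; apply; first exact: Ed_edgeC.
  by apply/segmentC/seg; rewrite t0 ltW.
by apply/nesym/neq => //; rewrite t0.
Qed.

Let LimL i t v : (i < n)%N -> 0 < t <= 1 -> Lim Ed c (e i t) v -> lim c (e i t) (e i 0) v.
Proof.
move=> ip /andP[t0 t1]; apply; first exact: Ed_edge.
  by apply: seg; rewrite t1 ltW.
by apply: neq => //; rewrite lexx ltr01.
Qed.

(** Between undercrossings the two limits at each point agree, so comparison with a constant
    function by [lim_match] carries the colour from one end to the other. *)
Let along i a b v w : (i < n)%N -> 0 <= a -> a < b -> b <= 1 ->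
  (forall t, a < t -> t < b -> o i = None \/ t <> tau i) ->
  lim c (e i a) (e i 1) v -> lim c (e i b) (e i 0) w -> v = w.
Proof.
move=> ip a0 ab b1 no lv lw.
have sE m : segment_pt (e i a) (e i b) m = e i (a + m * (b - a)).
  by rewrite /edge_pt /segment_pt; apply/rowP => k; rewrite !mxE; ring.
have toR r : 0 <= r -> r < b -> exists2 x, 0 < x & e i b = segment_pt (e i r) (e i 1) x.
  move=> r0 rb; exists ((b - r) / (1 - r)); first by rewrite divr_gt0 //; lra.
  rewrite (edgeE i r) segment_ptA divfK; last by rewrite gt_eqF //; lra.
  by rewrite subrKC -edgeE.
have toL r : a < r -> r <= 1 -> exists2 x, 0 < x & e i a = segment_pt (e i r) (e i 0) x.
  move=> ar r1; exists ((r - a) / r); first by rewrite divr_gt0 //; lra.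
  rewrite (edgeE i r) segment_ptB divfK; last by rewrite gt_eqF //; lra.
  by rewrite subKr -edgeE.
have cst P Q : lim (fun _ => v) P Q v by exists 1.
suff : w = v by [].
apply: (@lim_match R V c (fun _ => v) (e i a) (e i b) v w v _ _ _ _) => //.
- move=> m /andP[m0 m1]; rewrite sE; set t := a + _.
  have h1 : 0 < m * (b - a) by rewrite mulr_gt0 //; lra.
  have h2 : 0 < (1 - m) * (b - a) by rewrite mulr_gt0 //; lra.
  have ta : a < t by rewrite /t; lra.
  have tb : t < b by rewrite /t; lra.
  have ht : 0 <= t <= 1 by lra.
  have [k Lk] := LimP ip ht (no t ta tb).
  exists k, k, v, v; split=> //.
  + have [||x x0 ->] := toL t; [by []|lra|].
    by apply/lim_subC => //; apply: LimL => //; lra.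
  + have [||x x0 ->] := toR t; [lra|by []|].
    by apply/lim_sub => //; apply: LimR => //; lra.
- by have [||x x0 ->] := toR a; rewrite // -lim_sub.
- by have [||x x0 ->] := toL b; rewrite // -lim_subC.
Qed.

Variable s : nat -> V.
Hypothesis sE : forall i, (i < n)%N -> Lim Ed c (e i 0) (s i).

Let s_start i : (i < n)%N -> lim c (e i 0) (e i 1) (s i).
Proof. by move=> ip; apply: LimR; rewrite ?lexx ?ltr01 //; exact: sE. Qed.

Let s_end i : (i < n)%N -> lim c (e i 1) (e i 0) (s (next i)).
Proof. by move=> ip; apply: LimL; rewrite ?lexx ?ltr01 // e1; exact: sE. Qed.

Let before i t v : (i < n)%N -> 0 < t <= 1 -> o i = None \/ t <= tau i ->
  lim c (e i t) (e i 0) v -> v = s i.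
Proof.
move=> ip /andP[t0 t1] no l; apply/esym; apply: (along ip _ t0 t1 _ (s_start ip) l) => // r r0 rt.
by case: no => [oi|h]; [left|right; lra].
Qed.

Let after i t v : (i < n)%N -> 0 <= t < 1 -> o i = None \/ tau i <= t ->
  lim c (e i t) (e i 1) v -> v = s (next i).
Proof.
move=> ip /andP[t0 t1] no l; apply: (along ip t0 t1 _ _ l (s_end ip)) => // r r0 rt.
by case: no => [oi|h]; [left|right; lra].
Qed.

Let Lim_over_s i t v : (i < n)%N -> o i = None -> 0 <= t <= 1 -> Lim Ed c (e i t) v -> v = s i.
Proof.
move=> ip oi /andP[t0 t1] L; have [t00|t00] := eqVneq t 0.
  have z : 0 <= (0 : R) < 1 by rewrite lexx ltr01.
  apply: (lim_uniq (c := c) (M := e i 0) (U := e i 1)); last exact: s_start.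
  by rewrite t00 in L; apply: LimR.
have tp : 0 < t <= 1 by rewrite t1 andbT lt_neqAle eq_sym t00.
by apply: (before ip tp); [left|apply: LimL].
Qed.

Let arcs : arc_coloring s.
Proof.
move=> i ip; have [h hu] := tau_under ip.
have z1 : 0 < (1 : R) <= 1 by rewrite lexx ltr01.
case oi: (o i) => [j|]; last by apply: (before ip z1 (or_introl oi)); exact: s_end.
have ht : 0 <= tau i <= 1 by lra.
have [N ab] : exists N, above F Ed (e i (tau i)) N by apply/(hu _ ht); rewrite oi.
have [_ r] := col (Ed_edge ip) (seg i ht).
have [||v [w [k [l0 l1 Lk eq]]]] := r N _ _ ab.
- by apply/nesym/neq; rewrite ?lexx ?ltr01 //; lra.
- by apply: neq; rewrite ?lexx //; lra.
rewrite -(before ip _ _ l0) -?(after ip _ _ l1); [|by lra|by right|by lra|by right].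
have /aboveP [j' [u [jp hu' eN [eX eY z]]]] := ab.
have oij : o i = Some j'.
  by apply: (ct_above T ip jp ht hu'); rewrite -?eN.
have [_ oj _] := ct_cross T ip oij.
move: oij; rewrite oi => -[->].
by rewrite -(Lim_over_s jp oj hu' (v := k)) // -eN.
Qed.

Let sides i t : (i < n)%N -> 0 < t < 1 -> exists v0 v1, lim c (e i t) (e i 0) v0 /\ lim c (e i t) (e i 1) v1.
Proof.
move=> ip ht01; have ht : 0 <= t <= 1 by lra.
have [no|no] := pselect (o i = None \/ t <> tau i).
  have [k Lk] := LimP ip ht no.
  by exists k, k; split; [apply: LimL|apply: LimR] => //; lra.
have [_ r] := col (Ed_edge ip) (seg i ht).
have [N ab] : exists N, above F Ed (e i t) N.
  have [_ hu] := tau_under ip; apply/(hu _ ht).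
  by split; [move=> oi; apply: no; left|apply: contrapT => nt; apply: no; right].
have [||v0 [v1 [k [l0 l1 _ _]]]] := r N _ _ ab.
  - by apply/nesym/neq; rewrite ?lexx ?ltr01 //; lra.
  - by apply: neq; rewrite ?lexx //; lra.
by exists v0, v1.
Qed.

Let monochromatic_arcs v : (forall i, (i < n)%N -> s i = v) -> monochromatic Ed c v.
Proof.
move=> cst U W M w h sM nU lw.
have [i [t [ip ht eM UW]]] := EdP h sM.
have [h' _] := tau_under ip.
rewrite eM in lw nU.
case: UW => -[eU _]; rewrite eU in lw nU.
  have t0 : 0 < t <= 1.
    suff : t <> 0 by lra.
    by move=> t0; apply: nU; rewrite t0.
  have [no|no] := pselect (o i = None \/ t <= tau i).
    by rewrite (before ip t0 no lw) cst.
  have ti : tau i < t.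
    by rewrite ltNge; apply/negP => hn; apply: no; right.
  have [v0 [v1 [_ l1]]] := sides ip h'.
  rewrite -(along ip _ ti _ _ l1 lw); [|lra..|by move=> r r0 _; right; lra].
  by rewrite (after ip _ _ l1) ?cst //; [lra|right].
have t1 : 0 <= t < 1.
  suff : t <> 1 by lra.
  by move=> t1; apply: nU; rewrite t1.
have [no|no] := pselect (o i = None \/ tau i <= t).
  by rewrite (after ip t1 no lw) cst.
have ti : t < tau i.
  by rewrite ltNge; apply/negP => hn; apply: no; right.
have [v0 [v1 [l0 _]]] := sides ip h'.
rewrite (along ip _ ti _ _ lw l0); [|lra..|by move=> r _ r0; right; lra].
by rewrite (before ip _ _ l0) ?cst //; [lra|right].
Qed.

Lemma arcs_of_coloring : ~ monochromatic Ed c (s 0) ->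
  arc_coloring s /\ exists2 i, (i < n)%N & s i <> s 0.
Proof.
move=> nc; split; first exact: arcs.
apply: contrapT => no; apply: nc; apply: monochromatic_arcs => i ip.
by apply: contrapT => h; apply: no; exists i.
Qed.


End ToArcs.

Lemma colorable_arc : knot_colorable V F p ->
  exists s : nat -> V, arc_coloring s /\ exists2 i, (i < n)%N & s i <> s 0.
Proof.
move=> [c col nc]; have [tau ht] := choose_under.
have ch i : exists v, (i < n)%N -> Lim Ed c (e i 0) v.
  have [ip|] := boolP (i < n)%N; last by exists 0.
  have [h hu] := ht i ip.
  suff [v Lv] : exists v, Lim Ed c (e i 0) v by exists v.
  have z : 0 <= (0 : R) <= 1 by rewrite lexx ler01.
  have [k _] := col _ _ (e i 0) (Ed_edge ip) (segment_start _ _).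
  apply: k => N ab; have [|_ t0] := proj1 (hu 0 z); first by exists N.
  by lra.
have [s hs] := boolp.choice ch.
by exists s; apply: (arcs_of_coloring ht col hs); exact: nc.
Qed.

End Comb.

(** * Diagrams that persist under small changes of direction *)

Section Diagram.
Variable R : realType.
Local Notation pt := 'rV[R]_3.

Definition apart (F : frame R) (U W U' W' : pt) : Prop :=
  exists a b : R, let f P := a * fX F P + b * fY F P in
    [/\ f U < f U', f U < f W', f W < f U' & f W < f W'].

(* Up to the common sign [k], the first four inequalities say that each of the
   projected segments separates the ends of the other one; the last one compares
   the heights at their common point. *)
Definition under (F : frame R) (U W U' W' : pt) : Prop :=
  exists k : R, [/\ k * cross F U W U U' < 0, 0 < k * cross F U W U W',
    k * cross F U' W' U' W < 0, 0 < k * cross F U' W' U' U &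
    0 < k * det3 (vec U W) (vec U' W') (vec U U')].

Definition pair_ok (F : frame R) (p : seq pt) (o : nat -> option nat) (i j : nat) : Prop :=
  [\/ apart F p`_i p`_(i.+1 %% size p) p`_j p`_(j.+1 %% size p),
      o i = Some j \/ o j = Some i | j = (i.+1 %% size p)%N \/ i = (j.+1 %% size p)%N].

(** The geometric conditions are strict inequalities, so the notion is open in the direction.
    Adjacent edges are exempt: they always meet at their common vertex, and general position
    excludes the rest. *)
Definition diagram (F : frame R) (p : seq pt) (o : nat -> option nat) : Prop :=
  (forall i, (i < size p)%N -> forall j, o i = Some j -> [/\ (j < size p)%N, o j = None &
    under F p`_i p`_(i.+1 %% size p) p`_j p`_(j.+1 %% size p)]) /\
  (forall i, (i < size p)%N -> forall j, (j < size p)%N -> (i < j)%N -> pair_ok F p o i j).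

Lemma apartC F U W U' W' : apart F U W U' W' -> apart F U' W' U W.
Proof. by move=> [a [b [h1 h2 h3 h4]]]; exists (- a), (- b); split; lra. Qed.

Lemma affine_combination (a b t v : R) : a < v -> b < v -> 0 <= t <= 1 -> (1 - t) * a + t * b < v.
Proof.
move=> av bv /andP[t0 t1]; have h1 : 0 <= t * (v - b) by rewrite mulr_ge0 //; lra.
have h2 : 0 <= (1 - t) * (v - a) by rewrite mulr_ge0 //; lra.
have [t2|t2] := ltP t (1 / 2).
  have : 0 < (1 - t) * (v - a) by rewrite mulr_gt0 //; lra.
  lra.
have : 0 < t * (v - b) by rewrite mulr_gt0 //; lra.
lra.
Qed.

Lemma apart_neq F U W U' W' t u : apart F U W U' W' -> 0 <= t <= 1 -> 0 <= u <= 1 ->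
  fX F (segment_pt U W t) = fX F (segment_pt U' W' u) ->
  fY F (segment_pt U W t) = fY F (segment_pt U' W' u) -> False.
Proof.
move=> [a [b [h1 h2 h3 h4]]] ht hu eX eY; pose f P := a * fX F P + b * fY F P.
have fE P Q r : f (segment_pt P Q r) = (1 - r) * f P + r * f Q.
  by rewrite /f affX affY; ring.
have : f (segment_pt U W t) = f (segment_pt U' W' u) by rewrite /f eX eY.
have k1 := affine_combination h1 h3 ht; have k2 := affine_combination h2 h4 ht.
have := @affine_combination (- f U') (- f W') u (- f (segment_pt U W t)).
rewrite !ltrN2 !fE => /(_ k1 k2 hu); rewrite -/(f U') -/(f W') -/(f U) -/(f W); lra.
Qed.

Section Under.
Variables (al be : R) (U W U' W' : pt).
Local Notation F := (shear al be).
Hypothesis un : under F U W U' W'.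
Let c := cross F U W U' W'.

Lemma under_cross : c != 0.
Proof.
have [k [h1 h2 h3 h4 _]] := un; have : 0 < k * c.
  by move: h1 h2; rewrite /c /cross; lra.
by move=> kc; apply/eqP => c0; move: kc; rewrite c0 mulr0 ltxx.
Qed.

Lemma under_unique t u :
  fX F (segment_pt U W t) = fX F (segment_pt U' W' u) ->
  fY F (segment_pt U W t) = fY F (segment_pt U' W' u) ->
  t = cross F U' W' U' U / c.
Proof.
rewrite !affX !affY => eX eY; apply: (mulIf under_cross); rewrite (divfK under_cross).
rewrite /c /cross; move: eX eY.
move: (fX F U) (fX F W) (fX F U') (fX F W') (fY F U) (fY F W) (fY F U') (fY F W').
move=> x y x' y' z w z' w' eX eY.
have -> : t * ((y - x) * (w' - z') - (w - z) * (y' - x')) =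
  ((1 - t) * x + t * y - x) * (w' - z') - ((1 - t) * z + t * w - z) * (y' - x') by ring.
by rewrite eX eY; ring.
Qed.

(** Over the common projected point, the difference of heights times [c] is the determinant in
    [under]: the volume spanned by the two edges and a vector joining them. *)
Lemma under_height t u :
  fX F (segment_pt U W t) = fX F (segment_pt U' W' u) ->
  fY F (segment_pt U W t) = fY F (segment_pt U' W' u) ->
  fZ F (segment_pt U W t) < fZ F (segment_pt U' W' u).
Proof.
have [k [h1 h2 h3 h4 h5]] := un; have kc : 0 < k * c by move: h1 h2; rewrite /c /cross; lra.
move=> eX eY; rewrite -subr_gt0 -(pmulr_rgt0 _ kc).
suff -> : k * c * (fZ F (segment_pt U' W' u) - fZ F (segment_pt U W t)) =
    k * det3 (vec U W) (vec U' W') (vec U U') by [].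
rewrite -mulrA; congr (_ * _); move: eX eY; rewrite !affX !affY !affZ /c /cross /= /det3 /vec /=.
move: (px U) (py U) (pz U) (px W) (py W) (pz W) => x y z a b d.
move: (px U') (py U') (pz U') (px W') (py W') (pz W') => x' y' z' a' b' d' eX eY.
pose h := (1 - u) * z' + u * d' - ((1 - t) * z + t * d).
have ex : x' = x + t * (a - x) - u * (a' - x') - al * h by rewrite /h; lra.
have ey : y' = y + t * (b - y) - u * (b' - y') - be * h by rewrite /h; lra.
have ez : z' = z + t * (d - z) - u * (d' - z') + h by rewrite /h; ring.
have fx : x' - x = t * (a - x) - u * (a' - x') - al * h by lra.
have fy : y' - y = t * (b - y) - u * (b' - y') - be * h by lra.
have fz : z' - z = t * (d - z) - u * (d' - z') + h by lra.
rewrite fx fy fz -/h; ring.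
Qed.

Lemma under_meet : exists t u, [/\ 0 < t < 1, 0 <= u <= 1,
  fX F (segment_pt U W t) = fX F (segment_pt U' W' u) &
  fY F (segment_pt U W t) = fY F (segment_pt U' W' u)].
Proof.
have [k [h1 h2 h3 h4 _]] := un; have kc : 0 < k * c by move: h1 h2; rewrite /c /cross; lra.
have k0 : k != 0 by apply: contraTneq kc => ->; rewrite mul0r ltxx.
have c0 := under_cross.
have quot x : x / c = k * x / (k * c) by field; rewrite k0 c0.
(* Cramer's rule for the intersection of the two projected lines. *)
exists (cross F U' W' U' U / c), (- cross F U W U U' / c); split.
- rewrite quot divr_gt0 //= ltr_pdivrMr // mul1r.
  by move: h3; rewrite /c /cross; lra.
- rewrite quot divr_ge0 ?(ltW kc) //=; last lra.
  by rewrite ler_pdivrMr // mul1r; move: h2; rewrite /c /cross; lra.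
- by rewrite !affX; move: c0; rewrite /c /cross => c0; field.
- by rewrite !affY; move: c0; rewrite /c /cross => c0; field.
Qed.

End Under.

Lemma nb_apart al0 be0 (U W U' W' : pt) : apart (shear al0 be0) U W U' W' ->
  nb al0 be0 (fun al be => apart (shear al be) U W U' W').
Proof.
move=> [a [b [h1 h2 h3 h4]]].
pose f P (al be : R) : R := a * (px P + al * pz P) + b * (py P + be * pz P).
have near P Q : f P al0 be0 < f Q al0 be0 -> nb al0 be0 (fun al be => f P al be < f Q al be).
  move=> h; have : nb al0 be0 (fun al be => 0 < f Q al be - f P al be).
    apply: affine_pos; last by rewrite subr_gt0.
    exists (a * (pz Q - pz P)), (b * (pz Q - pz P)), (a * (px Q - px P) + b * (py Q - py P)).
    by move=> y1 y2; rewrite /f; ring.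
  by apply: nb_sub => y1 y2; rewrite subr_gt0.
have := nb_and (nb_and (near _ _ h1) (near _ _ h2)) (nb_and (near _ _ h3) (near _ _ h4)).
by apply: nb_sub => al be [[k1 k2] [k3 k4]]; exists a, b.
Qed.

Lemma nb_under al0 be0 (U W U' W' : pt) : under (shear al0 be0) U W U' W' ->
  nb al0 be0 (fun al be => under (shear al be) U W U' W').
Proof.
move=> [k [h1 h2 h3 h4 h5]].
have aff (m : R) (P Q S : pt) : affine (fun al be => m * cross (shear al be) P Q P S).
  exists (m * ((pz Q - pz P) * (py S - py P) - (py Q - py P) * (pz S - pz P))),
    (m * ((px Q - px P) * (pz S - pz P) - (pz Q - pz P) * (px S - px P))),
    (m * ((px Q - px P) * (py S - py P) - (py Q - py P) * (px S - px P))).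
  by move=> y1 y2; rewrite /cross /=; ring.
have neg P Q S : k * cross (shear al0 be0) P Q P S < 0 ->
    nb al0 be0 (fun al be => k * cross (shear al be) P Q P S < 0).
  exact: (affine_lt (aff k P Q S)).
have pos P Q S : 0 < k * cross (shear al0 be0) P Q P S ->
    nb al0 be0 (fun al be => 0 < k * cross (shear al be) P Q P S).
  exact: (affine_gt (aff k P Q S)).
have := nb_and (nb_and (neg _ _ _ h1) (pos _ _ _ h2)) (nb_and (neg _ _ _ h3) (pos _ _ _ h4)).
by apply: nb_sub => al be [[k1 k2] [k3 k4]]; exists k.
Qed.

Lemma nb_imp al0 be0 (Q : Prop) (P : R -> R -> Prop) : (Q -> nb al0 be0 P) ->
  nb al0 be0 (fun al be => Q -> P al be).
Proof.
move=> h; have [q|nq] := pselect Q; last by apply: nbT.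
by apply: nb_sub (h q).
Qed.

Lemma nb_diagram al0 be0 p o : diagram (shear al0 be0) p o ->
  nb al0 be0 (fun al be => diagram (shear al be) p o).
Proof.
move=> [d1 d2].
have all P : (forall i, (i < size p)%N -> nb al0 be0 (P i)) ->
    nb al0 be0 (fun al be => forall i, (i < size p)%N -> P i al be).
  move=> h; have := @nb_all R _ (iota 0 (size p)) al0 be0 P _.
  have h' i : i \in iota 0 (size p) -> nb al0 be0 (P i).
    by rewrite mem_iota => /andP[_]; exact: h.
  by move=> /(_ h'); apply: nb_sub => al be H i ip; apply: H; rewrite mem_iota.
apply: nb_and.
- apply: (all (fun i al be => forall j, o i = Some j -> [/\ (j < size p)%N, o j = None &
    under (shear al be) p`_i p`_(i.+1 %% size p) p`_j p`_(j.+1 %% size p)])) => i ip.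
  case oi: (o i) => [j|]; last by apply: nbT.
  have [jp oj u] := d1 i ip j oi.
  by apply: nb_sub (nb_under u) => al be h k [<-].
- apply: (all (fun i al be => forall j, (j < size p)%N -> (i < j)%N ->
    pair_ok (shear al be) p o i j)) => i ip.
  apply: (all (fun j al be => (i < j)%N -> pair_ok (shear al be) p o i j)) => j jp.
  apply: nb_imp => ij.
  have [/nb_apart h|h|h] := d2 i ip j jp ij.
  + by apply: nb_sub h => al be h; constructor 1.
  + by apply: nbT => al be; constructor 2.
  + by apply: nbT => al be; constructor 3.
Qed.

Lemma adjacent_meet (F : frame R) (U W Q : pt) t u : cross F U W W Q <> 0 ->
  fX F (segment_pt U W t) = fX F (segment_pt W Q u) ->
  fY F (segment_pt U W t) = fY F (segment_pt W Q u) -> t = 1 /\ u = 0.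
Proof.
move=> /eqP; rewrite !affX !affY /cross.
move: (fX F U) (fX F W) (fX F Q) (fY F U) (fY F W) (fY F Q) => x y z x' y' z' c0 eX eY.
split.
  apply: (mulIf c0); apply/eqP; rewrite -subr_eq0; apply/eqP.
  transitivity (((1 - t) * x + t * y - y) * (z' - y') - ((1 - t) * x' + t * y' - y') * (z - y)).
    by ring.
  by rewrite eX eY; ring.
apply: (mulIf c0); rewrite mul0r.
transitivity ((y - x) * ((1 - u) * y' + u * z' - y') - (y' - x') * ((1 - u) * y + u * z - y)).
  by ring.
by rewrite -eX -eY; ring.
Qed.

Section Table.
Variables (al be : R) (p : seq pt) (o : nat -> option nat).
Local Notation F := (shear al be).
Local Notation n := (size p).
Local Notation next i := (i.+1 %% n)%N.
Hypothesis D : diagram F p o.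

Lemma diagram_pair i j t u : (i < n)%N -> (j < n)%N -> i <> j -> 0 <= t <= 1 -> 0 <= u <= 1 ->
  fX F (edge_pt p i t) = fX F (edge_pt p j u) -> fY F (edge_pt p i t) = fY F (edge_pt p j u) ->
  [\/ o i = Some j /\ fZ F (edge_pt p i t) < fZ F (edge_pt p j u),
      o j = Some i /\ fZ F (edge_pt p j u) < fZ F (edge_pt p i t) |
      j = next i \/ i = next j].
Proof.
have [d1 d2] := D.
wlog : i j t u / (i < j)%N => [H ip jp ij ht hu eX eY|ij ip jp _ ht hu eX eY].
  have [h|h|h] := ltngtP i j; last by case: ij.
    exact: H.
  have [h1|h1|[e|e]] := H j i u t h jp ip (nesym ij) hu ht (esym eX) (esym eY).
  - by constructor 2.
  - by constructor 1.
  - by constructor 3; right.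
  - by constructor 3; left.
have [h|[oi|oj]|h] := d2 i ip j jp ij; last by constructor 3.
- by case: (apart_neq h ht hu eX eY).
- by constructor 1; split=> //; have [_ _ un] := d1 i ip j oi; exact: under_height un _ _ eX eY.
- constructor 2; split=> //; have [_ _ un] := d1 j jp i oj.
  exact: (under_height un (esym eX) (esym eY)).
Qed.

(** Away from the crossings the projection is already injective, and at a crossing the heights
    differ. *)
Lemma diagram_knot : (2 < n)%N ->
  (forall i, (i < n)%N -> planar_neq F p`_i p`_(next i)) ->
  (forall i, (i < n)%N -> cross F p`_i p`_(next i) p`_(next i) p`_(next (next i)) <> 0) ->
  is_knot p.
Proof.
move=> n2 pn cr; split=> // i j t u ip jp ht hu e.
have [ij|ij] := pselect (i = j).
  by split=> //; rewrite -ij in e; exact: (segment_pt_inj (pn i ip) e).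
have [||[_]|[_]|[h|h]] := diagram_pair ip jp ij _ _ (congr1 (fX F) e) (congr1 (fY F) e).
- lra.
- lra.
- by rewrite e ltxx.
- by rewrite e ltxx.
- have [] := @adjacent_meet F p`_i p`_(next i) p`_(next (next i)) t u (cr i ip).
  + by have := congr1 (fX F) e; rewrite /edge_pt h.
  + by have := congr1 (fY F) e; rewrite /edge_pt h.
  by lra.
- have [] := @adjacent_meet F p`_j p`_(next j) p`_(next (next j)) u t (cr j jp).
  + by have := congr1 (fX F) (esym e); rewrite /edge_pt h.
  + by have := congr1 (fY F) (esym e); rewrite /edge_pt h.
  by lra.
Qed.

Variable Om : seq pt.
Hypothesis gen : generic F Om.

(** If the projections are not parallel they share only that of [W]; if they are, genericity puts
    both edges on one line in space, where the projection is injective. *)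
Lemma generic_adjacent (U W Q : pt) t u : U \in Om -> W \in Om -> Q \in Om -> U <> W ->
  fX F (segment_pt U W t) = fX F (segment_pt W Q u) ->
  fY F (segment_pt U W t) = fY F (segment_pt W Q u) ->
  segment_pt U W t = segment_pt W Q u.
Proof.
have [g0 g1 _] := gen; move=> uO wO qO uw eX eY.
have [/eqP c0|/eqP c0] := boolP (cross F U W W Q == 0); last first.
  by have [-> ->] := adjacent_meet c0 eX eY; rewrite segment_pt0 segment_pt1.
have [|r eQ] := g1 U W Q uO wO qO uw.
  by rewrite -c0 /cross; ring.
have eN : segment_pt W Q u = segment_pt U W ((1 - u) + u * r).
  by rewrite eQ /segment_pt; apply/rowP => k; rewrite !mxE; ring.
rewrite eN in eX eY *.
have [_ e1] := lform_segment (g0 U W uO wO uw) eX eY.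
have [_ e2] := lform_segment (g0 U W uO wO uw)
  (erefl (fX F (segment_pt U W ((1 - u) + u * r)))) (erefl _).
by congr (segment_pt U W _); exact: etrans e1 (esym e2).
Qed.

Lemma diagram_table : is_knot p -> {subset p <= Om} -> crossing_table F p o.
Proof.
move=> K sub; have [n2 _] := K; have [d1 d2] := D.
have nlt i : (next i < n)%N by rewrite ltn_mod (leq_trans _ n2).
have [up neq _] := knot_simple K.
have vO i : (i < n)%N -> p`_i \in Om by move=> ip; apply: sub; rewrite mem_nth.
have vn i : (i < n)%N -> p`_i <> p`_(next i).
  by move=> ip; apply: neq; apply/edgesP; exists i.
split=> // [i j t u ip jp ht hu eX eY z|i j ip oi].
  have [ij|ij] := pselect (i = j).
    rewrite -ij in eX eY z; have [g0 _ _] := gen.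
    have pn := g0 _ _ (vO i ip) (vO _ (nlt i)) (vn i ip).
    have [_ e1] := lform_segment pn eX eY.
    have [_ e2] := lform_segment pn (erefl (fX F (edge_pt p i u))) (erefl (fY F (edge_pt p i u))).
    have tu : t = u := etrans e1 (esym e2).
    by move: z; rewrite tu ltxx.
  have [[]|[_ z']|h] // := diagram_pair ip jp ij ht hu eX eY.
    by move: z'; rewrite ltNge ltW.
  suff e : edge_pt p i t = edge_pt p j u by move: z; rewrite e ltxx.
  case: h => h.
    rewrite /edge_pt h in eX eY *.
    by apply: generic_adjacent eX eY; rewrite ?vO ?nlt //; exact: vn.
  rewrite /edge_pt h in eX eY *; apply/esym.
  by apply: generic_adjacent (esym eX) (esym eY); rewrite ?vO ?nlt //; exact: vn.
have [jp oj un] := d1 i ip j oi; split=> //.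
have [t [u [ht hu eX eY]]] := under_meet un.
exists t, u; split=> //; first by split=> //; exact: under_height un _ _ eX eY.
by move=> t' u' _ _ eX' eY'; rewrite (under_unique un eX eY) (under_unique un eX' eY').
Qed.

End Table.

End Diagram.

(** * Colourability of arcs as an isotopy invariant *)

Section Invariant.
Variable R : realType.
Local Notation pt := 'rV[R]_3.

Definition arcs_colorable (V : comNzRingType) (p : seq pt) (o : nat -> option nat) :=
  exists s : nat -> V, arc_coloring p o s /\ exists2 i, (i < size p)%N & s i <> s 0.

Lemma sub_generic F (Om Om' : seq pt) : {subset Om <= Om'} -> generic F Om' -> generic F Om.
Proof.
move=> sub [g0 g1 g3]; split.
- by move=> u v uO vO; apply: g0; apply: sub.
- by move=> u v w uO vO wO; apply: g1; apply: sub.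
- move=> u1 w1 u2 w2 u3 w3 N1 N2 N3 o1 p1 o2 p2 o3 p3.
  by apply: g3; apply: sub.
Qed.

(** Both diagrams use the same direction, so one small perturbation suits the two knots and the
    isotopy; there, colourings of arcs and colourings of points correspond. *)
Lemma isotopic_arcs (V : comNzRingType) (K L : knot R) oK oL al be :
  diagram (shear al be) K oK -> diagram (shear al be) L oL -> isotopic K L ->
  arcs_colorable V K oK <-> arcs_colorable V L oL.
Proof.
move=> dK dL /isotopic_colorable [Om inv].
have [d d0 near] := nb_and (nb_diagram dK) (nb_diagram dL).
have [al' [be' [ha hb gen]]] := exists_generic_shear (Om ++ vertices K ++ vertices L) al be d0.
have [dK' dL'] := near al' be' ha hb.
have tK : crossing_table (shear al' be') K oK.
  apply: (diagram_table dK' gen (knotP K)) => x xK.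
  by rewrite !mem_cat xK orbT.
have tL : crossing_table (shear al' be') L oL.
  apply: (diagram_table dL' gen (knotP L)) => x xL.
  by rewrite !mem_cat xL !orbT.
have := inv V (shear al' be'); case.
  by apply: sub_generic gen => x xO; rewrite mem_cat xO.
move=> KL LK; split=> -[s [arc [i ip ns]]].
  have /KL /(colorable_arc tL) [s' [arc' h]] := arc_colorable tK arc ip ns.
  by exists s'.
have /LK /(colorable_arc tK) [s' [arc' h]] := arc_colorable tL arc ip ns.
by exists s'.
Qed.

Lemma triangle_diagram F (A B C : pt) : diagram F [:: A; B; C] (fun _ => None).
Proof.
split=> // i i3 j j3 ij; constructor 3.
by move: i j i3 j3 ij => [|[|[|]]] // [|[|[|]]] //; auto.
Qed.

Lemma triangle_arcs V (A B C : pt) : ~ arcs_colorable V [:: A; B; C] (fun _ => None).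
Proof.
move=> [s [arc [i ip]]]; apply.
have := arc 0 isT; have := arc 1 isT; move=> /= h1 h2.
by move: i ip => [|[|[|]]] //= _; rewrite ?h1 h2.
Qed.

Lemma arc_run (V : comNzRingType) (p : seq pt) o (s : nat -> V) a b : arc_coloring p o s ->
  (a <= b < size p)%N -> all (fun k => o k == None) (iota a (b - a)) -> s b = s a.
Proof.
move=> arc; elim: b => [|b IH]; first by rewrite leqn0 => /andP[/eqP ->].
move=> /andP[]; rewrite leq_eqVlt => /orP[/eqP -> //|]; rewrite ltnS => ab bn.
rewrite subSn // -addn1 iotaD all_cat /= andbT subnKC // => /andP[h /eqP ob].
have := arc b (ltnW bn); rewrite ob modn_small // => ->.
by apply: IH; rewrite // ab ltnW.
Qed.

End Invariant.

(** * The trefoil and the figure eight *)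

Section IntegerDiagram.
Local Notation v0 := ((0, 0, 0) : ipoint).

(* Twice the projection along [(-1/2, 0, 1)]. *)
Definition iproj (q : ipoint) : int * int := (2 * q.1.1 + q.2, 2 * q.1.2).

Definition icross (u w u' w' : ipoint) : int :=
  let a := iproj u in let b := iproj w in let c := iproj u' in let d := iproj w' in
  (b.1 - a.1) * (d.2 - c.2) - (b.2 - a.2) * (d.1 - c.1).

Definition idet3 (a b d : ipoint) : int :=
  a.1.1 * (b.1.2 * d.2 - b.2 * d.1.2) - a.1.2 * (b.1.1 * d.2 - b.2 * d.1.1)
  + a.2 * (b.1.1 * d.1.2 - b.1.2 * d.1.1).

Definition ivec (u w : ipoint) : ipoint := (w.1.1 - u.1.1, w.1.2 - u.1.2, w.2 - u.2).

Definition iunder (u w u' w' : ipoint) : bool :=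
  has (fun k : int => [&& k * icross u w u u' < 0, 0 < k * icross u w u w',
      k * icross u' w' u' w < 0, 0 < k * icross u' w' u' u &
      0 < k * idet3 (ivec u w) (ivec u' w') (ivec u u')]) [:: 1; -1].

(** Separating lines that are horizontal, vertical or of slope 1 or -1 suffice for the two polygons
    tested below. *)
Definition iapart (u w u' w' : ipoint) : bool :=
  let r : seq int := [:: -1; 0; 1] in
  has (fun a => has (fun b => let f q := a * (iproj q).1 + b * (iproj q).2 in
    [&& f u < f u', f u < f w', f w < f u' & f w < f w']) r) r.

Definition idiagram (q : seq ipoint) (o : seq (option nat)) : bool :=
  let n := size q in let v := nth v0 q in let w i := v (i.+1 %% n)%N in
  let o i := nth None o i in
  all (fun i =>
    (if o i is Some j then [&& (j < n)%N, o j == None & iunder (v i) (w i) (v j) (w j)] else true) &&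
    all (fun j => [|| iapart (v i) (w i) (v j) (w j), o i == Some j, o j == Some i,
      j == (i.+1 %% n)%N | i == (j.+1 %% n)%N]) (iota i.+1 (n - i.+1))) (iota 0 n).

Variable R : realType.
(** Seen vertically, the two strands exchanged by a letter have their middle vertices over one
    point. The tilt moves the upper vertex forward and the lower one back, so that two edges cross
    in their interiors. *)
Local Notation F := (shear (1 / 2) 0 : frame R).

Let projX q : fX F (point_of R q) = (iproj q).1%:~R / 2.
Proof. by rewrite /= /px /pz !mxE /= inordK // rmorphD rmorphM /=; field. Qed.

Let projY q : fY F (point_of R q) = (iproj q).2%:~R / 2.
Proof. by rewrite /= /py /pz !mxE /= inordK // rmorphM /=; field. Qed.

Let crossE u w u' w' :
  cross F (point_of R u) (point_of R w) (point_of R u') (point_of R w') = (icross u w u' w')%:~R / 4.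
Proof. by rewrite /cross !projX !projY /icross !(rmorphB, rmorphM) /=; field. Qed.

Let det3E a b c d e f :
  det3 (vec (point_of R a) (point_of R b)) (vec (point_of R c) (point_of R d))
    (vec (point_of R e) (point_of R f)) = (idet3 (ivec a b) (ivec c d) (ivec e f))%:~R.
Proof.
rewrite /det3 /vec /px /py /pz !mxE /= inordK //= /idet3 /ivec /=.
by do 3 rewrite !(intrD, intrM, rmorphN) /=.
Qed.

Let iunderP u w u' w' : iunder u w u' w' ->
  under F (point_of R u) (point_of R w) (point_of R u') (point_of R w').
Proof.
move=> /hasP[k _ /and5P[h1 h2 h3 h4 h5]]; exists k%:~R.
rewrite !crossE det3E !mulrA -!intrM.
move: h1 h2 h3 h4 h5; rewrite -!(ltr_int R) => h1 h2 h3 h4 h5; split=> //; lra.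
Qed.

Let iapartP u w u' w' : iapart u w u' w' ->
  apart F (point_of R u) (point_of R w) (point_of R u') (point_of R w').
Proof.
move=> /hasP[a _ /hasP[b _ /and4P[h1 h2 h3 h4]]]; exists (2 * a%:~R), (2 * b%:~R) => /=.
have E q : 2 * a%:~R * fX F (point_of R q) + 2 * b%:~R * fY F (point_of R q) =
    (a * (iproj q).1 + b * (iproj q).2)%:~R :> R.
  by rewrite projX projY rmorphD !rmorphM /=; field.
by split; rewrite ![X in X < _]E ![X in _ < X]E ltr_int.
Qed.

Lemma idiagramP q o : idiagram q o ->
  diagram F [seq point_of R x | x <- q] (nth None o).
Proof.
move=> /allP D; have nP i : (i < size q)%N -> ((i.+1 %% size q) < size q)%N.
  by move=> ip; rewrite ltn_mod; exact: leq_ltn_trans ip.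
split; rewrite !size_map => i ip.
all: have /D /andP[d1 /allP d2] : i \in iota 0 (size q) by rewrite mem_iota.
  move=> j oi; move: d1; rewrite oi => /and3P[jp /eqP oj /iunderP].
  by rewrite -!(nth_map v0 0) ?nP.
move=> j jp ij; have /d2 : j \in iota i.+1 (size q - i.+1).
  by rewrite mem_iota ij subnKC.
rewrite /pair_ok size_map => /or4P[/iapartP h|/eqP h|/eqP h|/orP[/eqP h|/eqP h]].
- by constructor 1; rewrite !(nth_map v0) ?nP.
- by constructor 2; left.
- by constructor 2; right.
- by constructor 3; left.
- by constructor 3; right.
Qed.

End IntegerDiagram.

(** Edges are numbered along the traversal of [braid_closure]. With the chosen tilt, the second half
    of the lower strand of a letter passes under the first half of the upper one. *)
Definition trefoil_crossings : seq (option nat) :=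
  mkseq (fun i => if i == 3 then Some 13 else if i == 12 then Some 0
                  else if i == 16 then Some 4 else None)%N 22.

Definition figure_eight_crossings : seq (option nat) :=
  mkseq (fun i => if i == 3 then Some 25 else if i == 13 then Some 0
                  else if i == 18 then Some 5 else if i == 28 then Some 15 else None)%N 35.

Section Diagrams.
Variable R : realType.

Lemma trefoil_diagram : diagram (shear (1 / 2) 0) (trefoil R) (nth None trefoil_crossings).
Proof. by apply: idiagramP; vm_compute. Qed.

Lemma figure_eight_diagram :
  diagram (shear (1 / 2) 0) (figure_eight R) (nth None figure_eight_crossings).
Proof. by apply: idiagramP; vm_compute. Qed.

Lemma size_trefoil : size (trefoil R) = 22.
Proof. by rewrite size_map; vm_compute. Qed.

Lemma size_figure_eight : size (figure_eight R) = 35.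
Proof. by rewrite size_map; vm_compute. Qed.

Variable V : comNzRingType.

(** The colours 0, 1 and -1 on the three arcs, which change after the edges 3, 12 and 16. *)
Lemma trefoil_arcs3 : 3%:R = 0 :> V ->
  arcs_colorable V (trefoil R) (nth None trefoil_crossings).
Proof.
move=> ch; exists (fun i => if (3 < i <= 12)%N then 1 else if (12 < i <= 16)%N then -1 else 0).
split; last by exists 4%N; rewrite ?size_trefoil //= => /eqP; rewrite oner_eq0.
move=> i; rewrite size_trefoil => ip.
(* Away from the crossings the colour does not change; this is checked by computation on all 22
   edges. *)
have : all (fun i => [|| i == 3, i == 12 | i == 16]%N ||
  (nth None trefoil_crossings i == None) && ((3 < i <= 12)%N == (3 < i.+1 %% 22 <= 12)%N) &&
   ((12 < i <= 16)%N == (12 < i.+1 %% 22 <= 16)%N)) (iota 0 22) by [].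
move=> /allP /(_ i); rewrite mem_iota => /(_ ip) /orP[/or3P[/eqP ->|/eqP ->|/eqP ->]|] /=.
- by apply/eqP; rewrite -subr_eq0; apply/eqP; rewrite -[RHS]ch; ring.
- by rewrite subrr addr0.
- by apply/eqP; rewrite -subr_eq0 -oppr_eq0; apply/eqP; rewrite -[RHS]ch; ring.
by move=> /andP[/andP[/eqP -> /eqP ->] /eqP ->].
Qed.

(** The four arcs get 0, 2, -2 and 1; each crossing relation then holds up to a multiple of 5. *)
Lemma figure_eight_arcs5 : 5%:R = 0 :> V ->
  arcs_colorable V (figure_eight R) (nth None figure_eight_crossings).
Proof.
move=> ch; exists (fun i => if (3 < i <= 13)%N then 2%:R else if (13 < i <= 18)%N then - 2%:R
  else if (18 < i <= 28)%N then 1 else 0).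
split; last first.
  by exists 19%N; rewrite ?size_figure_eight //= => /eqP; rewrite oner_eq0.
move=> i; rewrite size_figure_eight => ip.
have : all (fun i => [|| i == 3, i == 13, i == 18 | i == 28]%N ||
  [&& nth None figure_eight_crossings i == None, (3 < i <= 13)%N == (3 < i.+1 %% 35 <= 13)%N,
   (13 < i <= 18)%N == (13 < i.+1 %% 35 <= 18)%N & (18 < i <= 28)%N == (18 < i.+1 %% 35 <= 28)%N])
  (iota 0 35) by [].
move=> /allP /(_ i); rewrite mem_iota => /(_ ip) /orP[/or4P[/eqP ->|/eqP ->|/eqP ->|/eqP ->]|] /=.
- by ring.
- by rewrite subrr addr0.
- by apply/eqP; rewrite -subr_eq0 -oppr_eq0; apply/eqP; rewrite -[RHS]ch; ring.
- by apply/eqP; rewrite -subr_eq0; apply/eqP; rewrite -[RHS]ch; ring.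
by move=> /and4P[/eqP -> /eqP -> /eqP -> /eqP ->].
Qed.

(** The difference of two crossing relations is three times the difference of two colours, so these
    are equal; the remaining colour follows. *)
Lemma trefoil_arcs : (forall x : V, x *+ 3 = 0 -> x = 0) ->
  ~ arcs_colorable V (trefoil R) (nth None trefoil_crossings).
Proof.
move=> reg [s [arc [i]]]; rewrite size_trefoil => ip; apply; move: i ip.
have run a b : (a <= b < 22)%N ->
    all (fun k => nth None trefoil_crossings k == None) (iota a (b - a)) -> s b = s a.
  by move=> h; apply: (arc_run arc); rewrite size_trefoil.
have at_ i : (i < 22)%N -> _ := fun h => arc i (etrans (congr1 (leq i.+1) size_trefoil) h).
have := at_ 3%N isT; have := at_ 12%N isT; have := at_ 21%N isT.
rewrite size_trefoil /= => e21 e12 e3.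
have r3 := run 0%N 3%N isT isT; have r12 := run 4%N 12%N isT isT.
have r21 := run 17%N 21%N isT isT.
rewrite r3 in e3; rewrite r12 in e12.
have s13 : s 13%N = s 0%N.
  apply: subr0_eq; apply: reg.
  rewrite -mulr_natl.
  transitivity (s 4%N + s 13%N - (s 0%N + s 0%N) - (s 0%N + s 4%N - (s 13%N + s 13%N))); first by ring.
  by rewrite e12 e3 !subrr.
have s4 : s 4%N = s 0%N.
  by apply: (addrI (s 0%N)); rewrite e3 s13.
have s17 : s 17%N = s 0%N by rewrite -r21 e21.
(* Every edge is reached without undercrossing from one of four starting edges, whose colours are
   now known to be equal. *)
have starts i : (i < 22)%N -> exists2 a, a \in [:: 0; 4; 13; 17]%N & (a <= i)%N &&
    all (fun k => nth None trefoil_crossings k == None) (iota a (i - a)).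
  move=> ip; suff /allP /(_ i) : all (fun i => has (fun a => (a <= i)%N &&
      all (fun k => nth None trefoil_crossings k == None) (iota a (i - a))) [:: 0; 4; 13; 17]%N)
      (iota 0 22).
    by rewrite mem_iota => /(_ ip) /hasP.
  by vm_compute.
move=> i ip; have [a ha /andP[ai h]] := starts i ip.
rewrite (run a) ?ai //; move: ha; rewrite !inE.
by move=> /or4P[/eqP ->|/eqP ->|/eqP ->|/eqP ->].
Qed.

End Diagrams.

(** * The torus knots T(2, n) *)

Section Torus.
Variables (R : realType) (n : nat).
Hypothesis n_odd : odd n.
Local Notation pt := 'rV[R]_3.

Definition mkpt (x y z : R) : pt := \row_(j < 3) [:: x; y; z]`_j.

(* The vertices with [y = 0] sink as [k] grows, so that a rising edge always passes
   over the descending one. *)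
Definition zigzag (b : bool) (k : nat) : pt :=
  mkpt k%:R (odd k (+) b)%:R (if odd k (+) b then 0 else - k%:R).

(** The corners of the two closing arcs, one above the zigzag and one below it. As [n] is odd, each
    arc leads from the end of one strand to the start of the other. *)
Definition torus_apex : pt := mkpt 0 n.+1%:R 0.
Definition torus_nadir : pt := mkpt 0 (- n.+1%:R) 0.

Definition torus_vertex (i : nat) : pt :=
  if (i <= n)%N then zigzag false i else if i == n.+1 then torus_apex
  else if (i <= n.+2 + n)%N then zigzag true (i - n.+2) else torus_nadir.

Definition torus_polygon : seq pt := mkseq torus_vertex (n.+2 + n.+2).

Definition torus_crossings (i : nat) : option nat :=
  if (i < n)%N then if odd i then Some (n.+2 + i)%N else None
  else if (n.+2 <= i < n.+2 + n)%N then if odd (i - n.+2) then None else Some (i - n.+2)%N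
  else None.

Local Notation p := torus_polygon.
Local Notation o := torus_crossings.
Local Notation F := (shear 0 0 : frame R).
Local Notation next i := (i.+1 %% size p)%N.

(** The second strand starts after the apex, whence the offset [n.+2]. *)
Definition torus_index (b : bool) k := ((if b then n.+2 else 0) + k)%N.
Local Notation ix := torus_index.

Lemma size_torus : size p = (n.+2 + n.+2)%N. Proof. exact: size_mkseq. Qed.

Lemma torus_gt0 : (0 < n)%N. Proof. by case: (n) n_odd. Qed.

Lemma torus_vertexE i : (i < n.+2 + n.+2)%N -> p`_i = torus_vertex i.
Proof. by move=> ip; rewrite nth_mkseq. Qed.

Lemma torus_vertex_index b k : (k <= n)%N -> p`_(ix b k) = zigzag b k.
Proof.
move=> kn; rewrite torus_vertexE /torus_vertex /torus_index; last by case: b; lia.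
case: b => /=; last by rewrite add0n kn.
rewrite ifF; last by lia.
rewrite ifF; last by lia.
by rewrite leq_add2l kn addKn.
Qed.

Lemma torus_vertex_apex : p`_n.+1 = torus_apex.
Proof. by rewrite torus_vertexE /torus_vertex; [rewrite ltnn eqxx|lia]. Qed.

Lemma torus_vertex_nadir : p`_(n.+2 + n.+1) = torus_nadir.
Proof.
rewrite torus_vertexE /torus_vertex; last by lia.
by rewrite !ifF //; lia.
Qed.

Lemma torus_next_index b k : (k < n)%N -> next (ix b k) = ix b k.+1.
Proof. by move=> kn; rewrite size_torus /torus_index modn_small; case: b; lia. Qed.

Lemma torus_next_n : next (ix false n) = n.+1.
Proof. by rewrite size_torus /torus_index modn_small; lia. Qed.

Lemma torus_next_apex : next n.+1 = ix true 0.
Proof. by rewrite size_torus /torus_index modn_small; lia. Qed.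

Lemma torus_next_2n : next (ix true n) = (n.+2 + n.+1)%N.
Proof. by rewrite size_torus /torus_index modn_small; lia. Qed.

Lemma torus_next_nadir : next (n.+2 + n.+1) = ix false 0.
Proof. by rewrite size_torus /torus_index -addnS modnn. Qed.

Lemma torus_edge_cases i : (i < size p)%N -> [\/ exists b k, (k < n)%N /\ i = ix b k,
  i = ix false n \/ i = n.+1 | i = ix true n \/ i = (n.+2 + n.+1)%N].
Proof.
rewrite size_torus /torus_index => ip.
have [h|h] := ltnP i n; first by constructor 1; exists false, i.
have [h1|h1] := ltnP i n.+2; first by constructor 2; lia.
have [h2|h2] := ltnP i (n.+2 + n); last by constructor 3; lia.
by constructor 1; exists true, (i - n.+2)%N; lia.
Qed.

Lemma torus_crossing_index b k : (k < n)%N ->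
  o (ix b k) = if odd k (+) b then Some (ix (~~ b) k) else None.
Proof.
move=> kn; rewrite /torus_crossings /torus_index; case: b => /=.
  rewrite ifF; last by lia.
  by rewrite ifT ?addKn ?addbT; [case: odd|lia].
by rewrite add0n kn addbF.
Qed.

Lemma torus_crossing_none i : [\/ i = n, i = n.+1 | (n.+2 + n <= i)%N] -> o i = None.
Proof.
rewrite /torus_crossings => h.
have [h1 h2] : (n <= i)%N /\ ~~ (n.+2 <= i < n.+2 + n)%N by case: h => [->|->|h]; lia.
by rewrite ltnNge h1 (negbTE h2).
Qed.

Lemma fX_mkpt x y z : fX F (mkpt x y z) = x.
Proof. by rewrite /= /px /pz !mxE /=; ring. Qed.

Lemma fY_mkpt x y z : fY F (mkpt x y z) = y.
Proof. by rewrite /= /py /pz !mxE /=; ring. Qed.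

Lemma apart_mkpt (a b x1 y1 z1 x2 y2 z2 x3 y3 z3 x4 y4 z4 : R) :
  a * x1 + b * y1 < a * x3 + b * y3 -> a * x1 + b * y1 < a * x4 + b * y4 ->
  a * x2 + b * y2 < a * x3 + b * y3 -> a * x2 + b * y2 < a * x4 + b * y4 ->
  apart F (mkpt x1 y1 z1) (mkpt x2 y2 z2) (mkpt x3 y3 z3) (mkpt x4 y4 z4).
Proof. by move=> h1 h2 h3 h4; exists a, b; move=> f; split; rewrite /f !fX_mkpt !fY_mkpt. Qed.

Lemma bool01 (b : bool) : 0 <= (b%:R : R) <= 1.
Proof. by case: b; rewrite ?ler01 lexx. Qed.

Lemma under_zigzag b k : odd k (+) b ->
  under F (zigzag b k) (zigzag b k.+1) (zigzag (~~ b) k) (zigzag (~~ b) k.+1).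
Proof.
move=> yb; exists 1; rewrite /cross /zigzag !fX_mkpt !fY_mkpt /det3 /vec /px /py /pz !mxE /= inordK //=.
rewrite addbN addNb addNb addbN yb /= -natr1.
by split; lra.
Qed.

Lemma torus_ends b k : (k < n)%N -> p`_(ix b k) = zigzag b k /\ p`_(next (ix b k)) = zigzag b k.+1.
Proof. by move=> kn; rewrite torus_next_index // !torus_vertex_index // ltnW. Qed.

Lemma torus_ends_n : p`_(ix false n) = zigzag false n /\ p`_(next (ix false n)) = torus_apex.
Proof. by rewrite torus_next_n torus_vertex_index // torus_vertex_apex. Qed.

Lemma torus_ends_apex : p`_n.+1 = torus_apex /\ p`_(next n.+1) = zigzag true 0.
Proof. by rewrite torus_next_apex torus_vertex_index // torus_vertex_apex. Qed.

Lemma torus_ends_2n : p`_(ix true n) = zigzag true n /\ p`_(next (ix true n)) = torus_nadir.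
Proof. by rewrite torus_next_2n torus_vertex_index // torus_vertex_nadir. Qed.

Lemma torus_ends_nadir : p`_(n.+2 + n.+1) = torus_nadir /\ p`_(next (n.+2 + n.+1)) = zigzag false 0.
Proof. by rewrite torus_next_nadir torus_vertex_index // torus_vertex_nadir. Qed.

Lemma pair_ok_sym i j : pair_ok F p o i j -> pair_ok F p o j i.
Proof.
move=> [h|[h|h]|[h|h]].
- by constructor 1; exact: apartC.
- by constructor 2; right.
- by constructor 2; left.
- by constructor 3; right.
- by constructor 3; left.
Qed.

Lemma natrSr k : k.+1%:R = k%:R + 1 :> R. Proof. by rewrite natr1. Qed.

Lemma natr_le a b : (a <= b)%N -> (a%:R : R) <= b%:R. Proof. by rewrite ler_nat. Qed.

(** Two columns apart, the abscissa separates. Edges of opposite strands in neighbouring columns are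
    parallel diagonals, separated by [x + y] or [x - y]. *)
Lemma torus_pair_zigzag b k b' k' : (k < n)%N -> (k' < n)%N -> (k <= k')%N -> ix b k <> ix b' k' ->
  pair_ok F p o (ix b k) (ix b' k').
Proof.
move=> kn kn' kk ne; have [e1 e2] := torus_ends b kn; have [e1' e2'] := torus_ends b' kn'.
have [h|h] := ltnP k.+1 k'.
  constructor 1; rewrite e1 e2 e1' e2'; have := natr_le h; rewrite !natrSr => h'.
  by apply: (@apart_mkpt 1 0); rewrite ?natrSr; lra.
have [ek|ek] : k' = k \/ k' = k.+1 by lia.
  rewrite ek in ne *; have eb : b' = ~~ b by case: b b' ne {e1 e2 e1' e2'} => -[].
  rewrite eb; constructor 2; rewrite !torus_crossing_index // negbK addbN.
  by case: (odd k (+) b); [left|right].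
have [eb|eb] := eqVneq b' b; first by constructor 3; left; rewrite torus_next_index // ek eb.
have {}eb : b' = ~~ b by case: b b' eb {ne e1 e2 e1' e2'} => -[].
constructor 1; rewrite e1 e2 e1' e2' ek eb /zigzag /= !addNb !addbN !negbK.
case: (odd k (+) b) => /=.
  by apply: (@apart_mkpt 1 1); rewrite ?natrSr; lra.
by apply: (@apart_mkpt 1 (-1)); rewrite ?natrSr; lra.
Qed.

Lemma torus_height_n b : odd n (+) b = ~~ b. Proof. by rewrite n_odd. Qed.

(** The closing edge lies on the line [x + y = n + 1], and the zigzag stays below it except at the
    adjacent edge. *)
Lemma torus_pair_n b k : (k < n)%N -> pair_ok F p o (ix b k) (ix false n).
Proof.
move=> kn; have [e1 e2] := torus_ends b kn; have [e3 e4] := torus_ends_n.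
have [/andP[bk /eqP ek]|h] := boolP (~~ b && (k.+1 == n)).
  by constructor 3; left; rewrite torus_next_index // (negbTE bk) ek.
constructor 1; rewrite e1 e2 e3 e4; have h1 := natr_le kn; rewrite !natrSr in h1.
have y1 := bool01 (odd k (+) b); have y2 := bool01 (odd k.+1 (+) b).
have h2 : k%:R + 1 + (odd k.+1 (+) b)%:R <= n%:R :> R.
  have [ek|ek] := eqVneq k.+1 n.
    by move: h; rewrite ek eqxx andbT negbK => ->; rewrite n_odd -ek natrSr /= addr0.
  have h3 : (k.+2 <= n)%N by rewrite ltn_neqAle ek kn.
  by have := natr_le h3; rewrite !natrSr; lra.
by apply: (@apart_mkpt 1 1); rewrite ?torus_height_n ?natrSr; rewrite /= in y1 y2 h2 *; lra.
Qed.

Lemma torus_pair_2n b k : (k < n)%N -> pair_ok F p o (ix b k) (ix true n).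
Proof.
move=> kn; have [e1 e2] := torus_ends b kn; have [e3 e4] := torus_ends_2n.
have [/andP[bk /eqP ek]|h] := boolP (b && (k.+1 == n)).
  by constructor 3; left; rewrite torus_next_index // bk ek.
constructor 1; rewrite e1 e2 e3 e4; have h1 := natr_le kn; rewrite !natrSr in h1.
have y1 := bool01 (odd k (+) b); have y2 := bool01 (odd k.+1 (+) b).
have h2 : k%:R + 1 - (odd k.+1 (+) b)%:R <= n%:R - 1 :> R.
  have [ek|ek] := eqVneq k.+1 n.
    by move: h; rewrite ek eqxx andbT => /negbTE ->; rewrite n_odd -ek natrSr /=; lra.
  have h3 : (k.+2 <= n)%N by rewrite ltn_neqAle ek kn.
  by have := natr_le h3; rewrite !natrSr; lra.
by apply: (@apart_mkpt 1 (-1)); rewrite ?torus_height_n ?natrSr; rewrite /= in y1 y2 h2 *; lra.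
Qed.

Lemma torus_pair_apex b k : (k < n)%N -> pair_ok F p o (ix b k) n.+1.
Proof.
move=> kn; have [e1 e2] := torus_ends b kn; have [e3 e4] := torus_ends_apex.
have [/andP[bk /eqP ek]|h] := boolP (b && (k == 0%N)).
  by constructor 3; right; rewrite torus_next_apex bk ek.
constructor 1; rewrite e1 e2 e3 e4; have h1 := natr_le kn; rewrite !natrSr in h1.
have y1 := bool01 (odd k (+) b); have y2 := bool01 (odd k.+1 (+) b).
have k0 : (0 : R) <= k%:R := ler0n _ k.
have : (odd k (+) b)%:R <= k%:R :> R.
  case: k h {e1 e2 y1 y2 kn h1 k0} => [|k] h; first by move: h; rewrite andbT => /negbTE ->.
  by have := bool01 (odd k.+1 (+) b); rewrite natrSr; have := ler0n R k; lra.
by move=> h2; apply: (@apart_mkpt (-1) 1); rewrite ?natrSr; rewrite /= in y1 y2 h2 *; lra.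
Qed.

Lemma torus_pair_nadir b k : (k < n)%N -> pair_ok F p o (ix b k) (n.+2 + n.+1).
Proof.
move=> kn; have [e1 e2] := torus_ends b kn; have [e3 e4] := torus_ends_nadir.
have [/andP[bk /eqP ek]|h] := boolP (~~ b && (k == 0%N)).
  by constructor 3; right; rewrite torus_next_nadir (negbTE bk) ek.
constructor 1; rewrite e1 e2 e3 e4; have h1 := natr_le kn; rewrite !natrSr in h1.
have y1 := bool01 (odd k (+) b); have y2 := bool01 (odd k.+1 (+) b).
have k0 : (0 : R) <= k%:R := ler0n _ k.
have : 1 <= k%:R + (odd k (+) b)%:R :> R.
  case: k h {e1 e2 y1 y2 kn h1 k0} => [|k] h; first by move: h; rewrite andbT negbK => ->; rewrite /= mulr0n mulr1n add0r.
  by have := bool01 (odd k.+1 (+) b); rewrite natrSr; have := ler0n R k; lra.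
by move=> h2; apply: (@apart_mkpt (-1) (-1)); rewrite ?natrSr; rewrite /= in y1 y2 h2 *; lra.
Qed.

Lemma torus_pair_far i j : i = ix false n \/ i = n.+1 -> j = ix true n \/ j = (n.+2 + n.+1)%N ->
  pair_ok F p o i j.
Proof.
have [e1 e2] := torus_ends_n; have [e3 e4] := torus_ends_apex.
have [e5 e6] := torus_ends_2n; have [e7 e8] := torus_ends_nadir.
have h := ler0n R n.
move=> [->|->] [->|->]; constructor 1; rewrite ?(e1, e2, e3, e4, e5, e6, e7, e8); apply: apartC;
  by apply: (@apart_mkpt 0 1); rewrite ?torus_height_n ?natrSr /=; lra.
Qed.

Lemma torus_pair i j : (i < size p)%N -> (j < size p)%N -> i <> j -> pair_ok F p o i j.
Proof.
move=> /torus_edge_cases ci /torus_edge_cases cj.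
have strip b k : (k < n)%N -> [\/ j = ix false n \/ j = n.+1 | j = ix true n \/ j = (n.+2 + n.+1)%N] ->
    pair_ok F p o (ix b k) j.
  by move=> kn; case=> -[] ->; [apply: torus_pair_n|apply: torus_pair_apex|apply: torus_pair_2n|apply: torus_pair_nadir].
case: ci => [[b [k [kn ->]]]|hi|hi].
- case: cj => [[b' [k' [kn' ->]]] ne|h _|h _]; [|by apply: strip; auto|by apply: strip; auto].
  have [h|h] := leqP k k'; first exact: torus_pair_zigzag.
  by apply/pair_ok_sym/torus_pair_zigzag => //; [exact: ltnW|exact: nesym].
- case: cj => [[b' [k' [kn' ->]]]|hj|hj] ne.
  + by apply: pair_ok_sym; case: hi => ->; [apply: torus_pair_n|apply: torus_pair_apex].
  + case: hi hj ne => -> [] -> // _; constructor 3; [left|right]; exact/esym/torus_next_n.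
  + exact: torus_pair_far.
case: cj => [[b' [k' [kn' ->]]]|hj|hj] ne.
- by apply: pair_ok_sym; case: hi => ->; [apply: torus_pair_2n|apply: torus_pair_nadir].
- by apply/pair_ok_sym/torus_pair_far.
case: hi hj ne => -> [] -> // _; constructor 3; [left|right]; exact/esym/torus_next_2n.
Qed.

Lemma torus_diagram : diagram F p o.
Proof.
split=> [i ip j|i ip j jp ij]; last first.
  by apply: torus_pair => // e; rewrite e ltnn in ij.
case: (torus_edge_cases ip) => [[b [k [kn ->]]]|h|h]; last 2 first.
- by rewrite torus_crossing_none //; case: h => ->; [constructor 1|constructor 2].
- by rewrite torus_crossing_none //; constructor 3; case: h => ->; rewrite /torus_index; lia.
rewrite torus_crossing_index //; case: ifP => // yb [<-]; split.
- by rewrite size_torus /torus_index; case: (b) => /=; lia.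
- by rewrite torus_crossing_index // addbN yb.
by have [-> ->] := torus_ends b kn; have [-> ->] := torus_ends (~~ b) kn; exact: under_zigzag.
Qed.

Lemma torus_is_knot : is_knot p.
Proof.
have [e1 e2] := torus_ends_n; have [e3 e4] := torus_ends_apex.
have [e5 e6] := torus_ends_2n; have [e7 e8] := torus_ends_nadir.
have nz := ltr0n R n; rewrite torus_gt0 in nz.
apply: (diagram_knot torus_diagram) => [|i ip|i ip]; first by rewrite size_torus; lia.
  case: (torus_edge_cases ip) => [[b [k [kn ->]]]|[->|->]|[->|->]].
  - by have [-> ->] := torus_ends b kn; left; rewrite !fX_mkpt natrSr; lra.
  - by rewrite e1 e2; left; rewrite !fX_mkpt; lra.
  - by rewrite e3 e4; right; rewrite !fY_mkpt natrSr /=; lra.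
  - by rewrite e5 e6; left; rewrite !fX_mkpt; lra.
  - by rewrite e7 e8; right; rewrite !fY_mkpt natrSr /=; lra.
case: (torus_edge_cases ip) => [[b [k [kn ->]]]|[->|->]|[->|->]].
- have [-> ->] := torus_ends b kn; rewrite torus_next_index //.
  have [kn1|kn1] := ltnP k.+1 n.
    have [_ ->] := torus_ends b kn1; rewrite /cross !fX_mkpt !fY_mkpt /= !addNb negbK.
    by case: (odd k (+) b); rewrite !natrSr /=; lra.
  have -> : k.+1 = n by lia.
  have ek : n = k.+1 by lia.
  have ok : odd k = false by apply/negbTE; move: n_odd; rewrite ek.
  case: b; [rewrite e6|rewrite e2]; rewrite /cross !fX_mkpt !fY_mkpt torus_height_n ok /=.
    by rewrite ek !natrSr; have := ler0n R k; lra.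
  by rewrite ek !natrSr; have := ler0n R k; lra.
- by rewrite e1 e2 torus_next_n e4 /cross !fX_mkpt !fY_mkpt torus_height_n natrSr /=; nra.
- rewrite e3 e4 torus_next_apex; have [_ ->] := torus_ends true torus_gt0.
  by rewrite /cross !fX_mkpt !fY_mkpt natrSr /=; nra.
- by rewrite e5 e6 torus_next_2n e8 /cross !fX_mkpt !fY_mkpt torus_height_n natrSr /=; nra.
- rewrite e7 e8 torus_next_nadir; have [_ ->] := torus_ends false torus_gt0.
  by rewrite /cross !fX_mkpt !fY_mkpt natrSr /=; nra.
Qed.

Definition torus_knot : knot R := Knot torus_is_knot.

Section Colours.
Variable V : comNzRingType.

(** Abscissa minus height is unchanged along a rising edge; along a descending one in column [k] it
    goes from [k - 1] to [k + 1], under an edge of colour [k]. The strands close up because [n] is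
    zero in [V]. *)
Lemma torus_arcs : n%:R = 0 :> V -> arcs_colorable V torus_knot o.
Proof.
move=> ch; pose col b k : V := k%:R - (odd k (+) b)%:R.
pose s i := if (i <= n)%N then col false i else if i == n.+1 then -1
  else if (i <= n.+2 + n)%N then col true (i - n.+2)%N else 0.
have s_ix b k : (k <= n)%N -> s (ix b k) = col b k.
  move=> kn; rewrite /s /torus_index; case: b => /=; last by rewrite add0n kn.
  rewrite ifF; last by lia.
  rewrite ifF; last by lia.
  by rewrite leq_add2l kn addKn.
have s_apex : s n.+1 = -1 by rewrite /s ltnn eqxx.
have s_nadir : s (n.+2 + n.+1)%N = 0.
  by rewrite /s !ifF //; lia.
exists s; split; last first.
  exists n.+1; first by rewrite size_torus; lia.
  rewrite s_apex (s_ix false 0%N) // /col subr0 => /eqP.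
  by rewrite oppr_eq0 oner_eq0.
move=> i ip; case: (torus_edge_cases ip) => [[b [k [kn ->]]]|[->|->]|[->|->]].
- rewrite torus_crossing_index // torus_next_index //; case yb: (odd k (+) b).
    by rewrite !s_ix ?(ltnW kn) // /col /= addNb addbN yb -natr1 /=; ring.
  by rewrite !s_ix ?(ltnW kn) // /col /= addNb yb -natr1 /=; ring.
- rewrite torus_crossing_none; last by constructor 1.
  by rewrite torus_next_n s_apex s_ix // /col torus_height_n ch sub0r.
- rewrite torus_crossing_none; last by constructor 2.
  by rewrite torus_next_apex s_apex s_ix // /col sub0r.
- rewrite torus_crossing_none; last by constructor 3; rewrite /torus_index; lia.
  by rewrite torus_next_2n s_nadir s_ix // /col torus_height_n ch subrr.
- rewrite torus_crossing_none; last by constructor 3; lia.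
  by rewrite torus_next_nadir s_nadir s_ix // /col subrr.
Qed.

(* Along the strands the colours form an arithmetic progression, which the two
   closing arcs force to have [n] times its difference equal to zero. *)
Lemma torus_no_arcs : (forall x : V, x *+ n = 0 -> x = 0) -> ~ arcs_colorable V torus_knot o.
Proof.
move=> reg [s [arc [i ip]]]; apply.
pose d := s (ix false 0%N) - s (ix true 0%N).
(* The general solution of the crossing relations, by induction for both strands at once since each
   refers to the other. *)
have prog b k : (k <= n)%N -> s (ix b k) = s (ix false 0%N) + d * (k%:R - (odd k (+) b)%:R).
  elim: k b => [|k IH] b kn.
    by case: b => /=; rewrite /d ?mulr0n ?mulr1n; ring.
  have step b' : if odd k (+) b' then s (ix b' k) + s (ix b' k.+1) = s (ix (~~ b') k) + s (ix (~~ b') k)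
      else s (ix b' k.+1) = s (ix b' k).
    have ipk : (ix b' k < size p)%N by rewrite size_torus /torus_index; case: (b') => /=; lia.
    by have := arc _ ipk; rewrite torus_crossing_index // torus_next_index //; case: ifP.
  have := step b; have := IH b (ltnW kn); have := IH (~~ b) (ltnW kn).
  rewrite addbN /= addNb; case: (odd k (+) b) => /= e1 e2 e3.
    by rewrite e1 e2 in e3; apply: (addrI _ (etrans e3 _)); rewrite -natr1; ring.
  by rewrite e3 e2 -natr1; ring.
have after j j' : (j < size p)%N -> o j = None -> next j = j' -> s j' = s j.
  by move=> jp oj <-; have := arc j jp; rewrite oj.
have sn : s n.+1 = s (ix false n).
  by apply: after torus_next_n; [rewrite size_torus /torus_index; lia|apply: torus_crossing_none; constructor 1].
have s1 : s (ix true 0%N) = s n.+1.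
  by apply: after torus_next_apex; [rewrite size_torus; lia|apply: torus_crossing_none; constructor 2].
have s2 : s (n.+2 + n.+1)%N = s (ix true n).
  apply: after torus_next_2n; first by rewrite size_torus /torus_index; lia.
  by apply: torus_crossing_none; constructor 3; rewrite /torus_index; lia.
have d0 : d = 0.
  apply: reg; move: s1; rewrite sn (prog true 0%N) // (prog false n) // torus_height_n /= sub0r mulrN mulr1 => /addrI e.
  by rewrite -mulr_natr; apply: (addIr (- d)); rewrite add0r [RHS]e; ring.
have flat b k : (k <= n)%N -> s (ix b k) = s (ix false 0%N).
  by move=> kn; rewrite (prog b k) // d0 mul0r addr0.
by case: (torus_edge_cases ip) => [[b [k [kn ->]]]|[->|->]|[->|->]];
  rewrite ?s2 ?sn flat // ltnW.
Qed.

End Colours.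

End Torus.

(** * Prime fields and the proof of the theorem *)

Lemma prime_field_char (p : nat) : prime p -> p%:R = 0 :> 'F_p.
Proof. by move=> /pchar_Fp /pcharf0. Qed.

Lemma prime_field_reg (p n : nat) : prime p -> prime n -> p != n ->
  forall x : 'F_p, x *+ n = 0 -> x = 0.
Proof.
move=> pp pn ne x; rewrite -mulr_natr => /eqP; rewrite mulf_eq0 => /orP[/eqP //|].
by rewrite -(dvdn_pcharf (pchar_Fp pp)) dvdn_prime2 // (negbTE ne).
Qed.

Lemma increasing_primes : exists f : nat -> nat,
  (forall i, odd (f i) /\ prime (f i)) /\ injective f.
Proof.
(* Starting at 3 keeps all the primes odd, as the torus knots require. *)
pose f := fix f i := if i is j.+1 then s2val (prime_above (f j)) else 3%N.
have pf i : prime (f i) by case: i => [|i] //=; case: prime_above.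
have lt i : (f i < f i.+1)%N by rewrite /=; case: prime_above.
have mono : {homo f : i j / (i < j)%N} by apply: homo_ltn => //; exact: ltn_trans.
exists f; split=> [i|i j e].
  split=> //; have [e|//] := even_prime (pf i).
  suff : (2 < f i)%N by rewrite e.
  by case: i {e} => // i; exact: ltn_trans (mono 0%N i.+1 isT).
by have [/mono|/mono|//] := ltngtP i j; rewrite e ltnn.
Qed.

Theorem theorem1p4 (R : realType) :
  ((forall (A B C : 'rV[R]_3) (h : noncollinear A B C),
      ~ isotopic (trivial_knot h) (trefoil R) /\
      ~ isotopic (trivial_knot h) (figure_eight R)) /\
   ~ isotopic (trefoil R) (figure_eight R)) /\
  (exists K : nat -> knot R, forall i j : nat, i <> j -> ~ isotopic (K i) (K j)).
Proof.
have t3 := @trefoil_arcs3 R 'F_3 (@prime_field_char 3 isT).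
have e5 := @figure_eight_arcs5 R 'F_5 (@prime_field_char 5 isT).
split; first split.
- move=> A B C h; split=> iso.
    have [_ /(_ t3)] := @isotopic_arcs _ 'F_3 (trivial_knot h) _ _ _ _ _ (triangle_diagram _ A B C) (trefoil_diagram R) iso.
    exact: triangle_arcs.
  have [_ /(_ e5)] := @isotopic_arcs _ 'F_5 (trivial_knot h) _ _ _ _ _ (triangle_diagram _ A B C) (figure_eight_diagram R) iso.
  exact: triangle_arcs.
- move=> iso.
  have [_ /(_ e5)] := isotopic_arcs 'F_5 (trefoil_diagram R) (figure_eight_diagram R) iso.
  by apply: trefoil_arcs; apply: prime_field_reg.
have [f [hf injf]] := increasing_primes.
exists (fun i => torus_knot R (proj1 (hf i))) => i j ij iso.
have [pi pj] := (proj2 (hf i), proj2 (hf j)).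
move: (proj1 (hf i)) (proj1 (hf j)) iso => oi oj iso.
have [+ _] := @isotopic_arcs _ 'F_(f i) (torus_knot R oi) (torus_knot R oj) _ _ _ _ (torus_diagram R oi)
  (torus_diagram R oj) iso.
move=> /(_ (torus_arcs R oi (prime_field_char pi))).
apply: torus_no_arcs; apply: prime_field_reg => //.
by apply/eqP => /injf.
Qed.
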